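(* Let $\psi\in\mathsf{SC}$. Then: (i) if $\psi(\tfrac12)<c_*$, then problem (P) has a unique solution, and it is the unique minimizer of $\mathcal{W}$ in $M_{\rm sym}$; (ii) if $\psi(\tfrac12)\ge c_*$, then problem (P) has no solution.
   Context: $\mathsf{SC}$ denotes the class of functions $\psi:[0,1]\to\mathbb{R}$ such that (i) $\psi(x)=\psi(1-x)$ for $x\in[0,1]$; (ii) $\psi(0)<0$, $\psi(\tfrac12)>0$ and $\psi(x)=(1-2x)\psi(0)+2x\,\psi(\tfrac12)$ for $0\le x\le\tfrac12$. $H(0,1):=H^2(0,1)\cap H^1_0(0,1)$, and $$M_{\rm sym}:=\{v\in H(0,1) : v\ge\psi \text{ in } [0,1],\ v(x)=v(1-x)\text{ for }0\le x\le\tfrac12\}.$$ The elastic energy is $$\mathcal{W}(u):=\int_0^1\left(\frac{u''(x)}{(1+u'(x)^2)^{3/2}}\right)^2\sqrt{1+u'(x)^2}\,dx ,$$ and its first variation at $u$ in direction $\varphi$ is $$\mathcal{W}'(u)(\varphi)=\int_0^1\left[2\frac{u''\varphi''}{(1+(u')^2)^{5/2}}-5\frac{(u'')^2u'\varphi'}{(1+(u')^2)^{7/2}}\right]dx .$$ Problem (P): find $u\in M_{\rm sym}$ such that $\mathcal{W}'(u)(v-u)\ge0$ for all $v\in M_{\rm sym}$. $c_*:=2/c_0$, where $c_0:=\int_{\mathbb{R}}(1+t^2)^{-5/4}\,dt$. *)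

(* Defs.v *)
From mathcomp Require Import all_boot all_order all_algebra.
From mathcomp Require Import all_classical all_reals all_analysis.

Set Implicit Arguments.
Unset Strict Implicit.
Unset Printing Implicit Defensive.

Import Order.TTheory GRing.Theory Num.Theory.
Import numFieldNormedType.Exports.

Local Open Scope classical_set_scope.
Local Open Scope ring_scope.

(* A function on [0, 1] is represented by a function on R whose values outside
   [0, 1] are irrelevant. *)

Section sobolev.
Context {R : realType}.
Implicit Types u g phi : R -> R.

Notation mu := (@lebesgue_measure R).
Notation I := (`]0, 1[%classic : set R).

Definition L2 u := (u \_ I) \in Lfun mu 2%:E.

(* C^1_c(0,1), each function being extended by 0 to R. *)
Definition C1c phi :=
  [/\ forall x : R, derivable phi x 1,
      continuous (phi^`())%classic,
      compact (closure [set x | phi x != 0]) &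
      closure [set x | phi x != 0] `<=` I].

(* As is customary on an interval, the Sobolev spaces are defined with test
   functions in C^1_c(0,1) (Brezis, Functional Analysis, Sobolev Spaces and
   Partial Differential Equations, Chapter 8). *)
Definition weak_derivative u g := forall phi, C1c phi ->
  \int[mu]_(x in I) (u x * phi^`()%classic x) = - \int[mu]_(x in I) (g x * phi x).

Definition H1 u := L2 u /\ exists g, L2 g /\ weak_derivative u g.

(* A representative of the weak derivative of u in H^1(0,1); it is determined
   up to a null set of (0,1). *)
Definition wderiv u : R -> R :=
  xget (cst 0) [set g | L2 g /\ weak_derivative u g].

Definition H2 u := H1 u /\ H1 (wderiv u).

Definition H1norm u : R :=
  Num.sqrt (\int[mu]_(x in I) (u x ^+ 2 + wderiv u x ^+ 2)).

(* H^1_0(0,1): the closure of C^1_c(0,1) in H^1(0,1). *)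
Definition H10 u :=
  H1 u /\ forall e : R, 0 < e -> exists2 phi, C1c phi & H1norm (u \- phi) < e.

(* H^2(0,1) `&` H^1_0(0,1); as usual, its elements are identified with their
   continuous representatives on [0, 1], so that pointwise conditions make
   sense. *)
Definition H u := [/\ {within `[0, 1], continuous u}, H2 u & H10 u].

End sobolev.

Section obstacle.
Context {R : realType}.
Implicit Types psi u v phi : R -> R.

Notation mu := (@lebesgue_measure R).
Notation I := (`]0, 1[%classic : set R).

Definition SC psi :=
  [/\ forall x, 0 <= x <= 1 -> psi x = psi (1 - x),
      psi 0 < 0,
      0 < psi (1 / 2) &
      forall x, 0 <= x <= 1 / 2 ->
        psi x = (1 - 2 * x) * psi 0 + 2 * x * psi (1 / 2)].

Definition Msym psi v :=
  [/\ H v,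
      forall x, 0 <= x <= 1 -> psi x <= v x &
      forall x, 0 <= x <= 1 / 2 -> v x = v (1 - x)].

Definition W u : R :=
  let u' := wderiv u in let u'' := wderiv u' in
  \int[mu]_(x in I)
    ((u'' x / (1 + u' x ^+ 2) `^ (3 / 2)) ^+ 2 * Num.sqrt (1 + u' x ^+ 2)).

Definition dW u phi : R :=
  let u' := wderiv u in let u'' := wderiv u' in
  let phi' := wderiv phi in let phi'' := wderiv phi' in
  \int[mu]_(x in I)
    (2 * (u'' x * phi'' x / (1 + u' x ^+ 2) `^ (5 / 2))
     - 5 * (u'' x ^+ 2 * u' x * phi' x / (1 + u' x ^+ 2) `^ (7 / 2))).

Definition solves_P psi u :=
  Msym psi u /\ forall v, Msym psi v -> 0 <= dW u (v \- u).

Definition minimizes_W psi u :=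
  Msym psi u /\ forall v, Msym psi v -> W u <= W v.

End obstacle.

Definition c0 (R : realType) : R :=
  \int[@lebesgue_measure R]_t (1 + t ^+ 2) `^ (- (5 / 4)).

Definition cstar (R : realType) : R := 2 / c0 R.

(* Main.v *)
Require Import Defs.
From mathcomp Require Import all_boot all_order all_algebra.
From mathcomp Require Import all_classical all_reals all_analysis.
From mathcomp Require Import measurable_realfun.
From mathcomp Require Import ring lra.

Set Implicit Arguments.
Unset Strict Implicit.
Unset Printing Implicit Defensive.

Import Order.TTheory GRing.Theory Num.Theory.
Import numFieldNormedType.Exports.

Local Open Scope classical_set_scope.
Local Open Scope ring_scope.

(** Put h = psi(1/2). A symmetric function v of H(0, 1) is determined by its
    restriction to [0, 1/2], hence by its slope p there, which satisfies
    p(1/2) = 0; its energy is twice the integral over [0, 1/2] of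
    p'^2 / (1 + p^2)^(5/2). The Sobolev classes enter only through [H_rep] and
    [rep_H]: the elements of H(0, 1) are the functions with boundary values 0
    whose derivative is absolutely continuous with a square integrable density.

    The energy bound. Let v be admissible and let s be the maximum of p, attained
    at x0. As p vanishes at 1/2 and has mean at least 2 h, s > 2 h. For c > 0 the
    identity
      p'^2 / (1 + p^2)^(5/2) = (p' / (1 + p^2)^(5/4) + d sqrt(s - p))^2
        - 2 d sqrt(s - p) p' / (1 + p^2)^(5/4) - d^2 (s - p),
    with d = - c on [0, x0] and d = c on [x0, 1/2], has an exact derivative as its
    second term. Integrating it, dropping the squares and choosing the best c gives
    a lower bound of the energy in terms of h and s alone ([energy_bound]), with
    equality only if p(0) = s, v(1/2) = h and
      p' = - c (1 + p^2)^(5/4) sqrt(s - p),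
    that is, if p is an [extremal]. As a function of the angle atan s the bound has
    a unique minimum ([bound_min]): its derivative has the sign of the function
    [shoot h], which is increasing.

    The elastica. The equation of the extremals is integrated in closed form: x is
    proportional to [abscissa s (p x)]. Therefore extremals exist, are unique
    once c is related to s by the length of the half interval, and end at the
    height h if and only if shoot h (atan s) = 0 ([extremal_height]). At pi / 2 the
    value of [shoot h] is 1 / h - c0 / 2 = 1 / h - 1 / cstar ([cstar_isqsin]), so that a
    zero exists if and only if h < cstar ([shoot_exists], [shoot_none]).

    Part (i). For h < cstar the symmetric elastica u of height h attains the
    minimum of the bound, and is the unique minimizer by the equality case
    ([elastica_least_energy]). Along an extremal the first variation in the
    direction w - u reduces to a nonnegative multiple of w(1/2) - h, so u solves
    the variational inequality ([elastica_solves_P]).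

    Conversely the slope p of any solution w is an extremal that ends at the height
    h ([solution_extremal]). A suitable test direction shows that w is concave, so
    that w > psi except possibly at 1/2. All small perturbations that do not lower
    w(1/2) are thus admissible, and the inequality becomes an equation with one
    multiplier, the reaction of the obstacle at 1/2; its first integral is the
    equation of the extremals. As the shooting function has at most one zero,
    solutions are unique, and for h >= cstar there are none. *)

(** * Rules for continuity and derivatives *)

Section continuity_rules.
Context {R : realType} {T : topologicalType}.
Implicit Types f g : T -> R.

Lemma cont_cst (k : R) : continuous (fun _ : T => k).
Proof. by move=> x; exact: cvg_cst. Qed.

Lemma contD f g : continuous f -> continuous g -> continuous (fun x => f x + g x).
Proof. by move=> cf cg x; exact: (cvgD (cf x) (cg x)). Qed.

Lemma contN f : continuous f -> continuous (fun x => - f x).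
Proof. by move=> cf x; exact: (cvgN (cf x)). Qed.

Lemma contB f g : continuous f -> continuous g -> continuous (fun x => f x - g x).
Proof. by move=> cf cg x; exact: (cvgB (cf x) (cg x)). Qed.

Lemma contM f g : continuous f -> continuous g -> continuous (fun x => f x * g x).
Proof. by move=> cf cg x; exact: (cvgM (cf x) (cg x)). Qed.

Lemma contV f : (forall x, f x != 0) -> continuous f -> continuous (fun x => (f x)^-1).
Proof. by move=> f0 cf x; exact: (cvgV (f0 x) (cf x)). Qed.

Lemma cont_comp (h : R -> R) f : continuous h -> continuous f ->
  continuous (fun x => h (f x)).
Proof. by move=> ch cf x; exact: (continuous_comp (cf x) (ch (f x))). Qed.

Lemma contX n f : continuous f -> continuous (fun x => f x ^+ n).
Proof. by move=> cf; exact: (cont_comp (@exprn_continuous _ n) cf). Qed.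

Lemma cont_sqrt f : continuous f -> continuous (fun x => Num.sqrt (f x)).
Proof. by move=> cf; exact: (cont_comp (@sqrt_continuous _) cf). Qed.

End continuity_rules.

Lemma within_comp {R : realType} (a b : R) (h f : R -> R) : continuous h ->
  {within `[a, b], continuous f} -> {within `[a, b], continuous (fun x => h (f x))}.
Proof. by move=> ch cf x; apply: continuous_comp; [exact: cf|exact: ch]. Qed.

Section derivative_rules.
Context {R : realType}.
Implicit Types (f g : R -> R) (x a b k : R).

Lemma der_cst k x : is_derive x 1 (fun=> k) 0.
Proof. exact: is_derive_cst. Qed.

Lemma der_id x : is_derive x 1 (fun t : R => t) 1.
Proof. exact: is_derive_id. Qed.

Lemma derD f g x a b : is_derive x 1 f a -> is_derive x 1 g b ->
  is_derive x 1 (fun t => f t + g t) (a + b).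
Proof. by move=> fa gb; exact: is_deriveD. Qed.

Lemma derN f x a : is_derive x 1 f a -> is_derive x 1 (fun t => - f t) (- a).
Proof. by move=> fa; exact: is_deriveN. Qed.

Lemma derB f g x a b : is_derive x 1 f a -> is_derive x 1 g b ->
  is_derive x 1 (fun t => f t - g t) (a - b).
Proof. by move=> fa gb; exact: is_deriveB. Qed.

Lemma derM f g x a b : is_derive x 1 f a -> is_derive x 1 g b ->
  is_derive x 1 (fun t => f t * g t) (f x * b + g x * a).
Proof. by move=> fa gb; exact: is_deriveM. Qed.

Lemma der_comp f g x a b : is_derive (g x) 1 f a -> is_derive x 1 g b ->
  is_derive x 1 (fun t => f (g t)) (a * b).
Proof. by move=> fa gb; exact: is_derive1_comp. Qed.

Lemma derX n f x a : is_derive x 1 f a ->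
  is_derive x 1 (fun t => f t ^+ n.+1) (n.+1%:R * f x ^+ n * a).
Proof.
move=> fa; have := is_deriveX n.+1 fa; congr (is_derive _ _ _ _).
by apply/funext => t; elim: n {fa} => [|n IH] //; rewrite exprS [in RHS]exprS -IH.
Qed.

Lemma der_sqrt f x a : 0 < f x -> is_derive x 1 f a ->
  is_derive x 1 (fun t => Num.sqrt (f t)) (a / (2 * Num.sqrt (f x))).
Proof.
by move=> f0 fa; rewrite mulrC; apply: der_comp fa; exact: is_derive1_sqrt.
Qed.

Lemma derV f x a : f x != 0 -> is_derive x 1 f a ->
  is_derive x 1 (fun t => (f t)^-1) (- (f x) ^- 2 * a).
Proof. by move=> f0 fa; exact: is_deriveV. Qed.

Lemma der_eq f x a b : is_derive x 1 f a -> a = b -> is_derive x 1 f b.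
Proof. by move=> fa <-. Qed.

Lemma der_continuous f x a : is_derive x 1 f a -> {for x, continuous f}.
Proof. by move=> [fa _]; exact/differentiable_continuous/derivable1_diffP. Qed.

End derivative_rules.

(** * Integrals on intervals and absolute continuity *)

Section interval_integrals.
Context {R : realType}.
Implicit Types (a b c x y z k : R) (f g h p q D N : R -> R).

Notation mu := (@lebesgue_measure R).

Definition L1 a b f := mu.-integrable `]a, b[ (EFin \o f).

Definition itg f x y : R := \int[mu]_(t in `]x, y[) f t.

Lemma L1_sub a b x y f : a <= x -> y <= b -> L1 a b f -> L1 x y f.
Proof.
move=> ax yb; apply: integrableS => //.
by apply: subset_itv; rewrite bnd_simp.
Qed.

Lemma L1_meas a b f : L1 a b f -> measurable_fun `]a, b[ f.
Proof. by move=> /measurable_int /measurable_EFinP. Qed.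

Lemma L1D a b f g : L1 a b f -> L1 a b g -> L1 a b (fun t => f t + g t).
Proof. by move=> fi gi; rewrite /L1 (_ : EFin \o _ = (EFin \o f) \+ (EFin \o g))%E//; exact: integrableD. Qed.

Lemma L1Z a b k f : L1 a b f -> L1 a b (fun t => k * f t).
Proof.
by move=> fi; rewrite /L1 (_ : EFin \o _ = (fun t => k%:E * (EFin \o f) t))%E//; exact: integrableZl.
Qed.

Lemma L1N a b f : L1 a b f -> L1 a b (fun t => - f t).
Proof. by move=> fi; rewrite /L1 (_ : EFin \o _ = -%E \o (EFin \o f))%E//; exact: integrableN. Qed.

Lemma L1B a b f g : L1 a b f -> L1 a b g -> L1 a b (fun t => f t - g t).
Proof. by move=> fi gi; exact: (L1D fi (L1N gi)). Qed.

Lemma L1_norm a b f : L1 a b f -> L1 a b (fun t => `|f t|).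
Proof. by move=> fi; exact: integrable_norm. Qed.

Lemma eq_L1 a b f g : (forall x, a < x < b -> f x = g x) -> L1 a b f -> L1 a b g.
Proof.
by move=> fg; apply: eq_integrable => // x; rewrite inE/= in_itv/= => /fg ->.
Qed.

Lemma le_L1 a b f g : measurable_fun `]a, b[ f ->
  (forall x, a < x < b -> `|f x| <= g x) -> L1 a b g -> L1 a b f.
Proof.
move=> mf fg gi; apply: (le_integrable _ _ _ gi) => //.
  exact/measurable_EFinP.
by move=> x /=; rewrite in_itv/= lee_fin => /fg /le_trans; apply; exact: ler_norm.
Qed.

Lemma L1_cst a b k : L1 a b (fun=> k).
Proof.
apply: (@measurable_bounded_integrable _ _ _ mu) => //.
  rewrite (_ : (mu `]a, b[ < +oo)%E)//.
  by rewrite (lebesgue_measure_itv `]a, b[)/=; case: ifP => _ //; rewrite -EFinD ltry.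
exists `|k|; split => // M kM x _ /=; exact: ltW.
Qed.

Lemma L1_mul_bounded a b k f g : measurable_fun `]a, b[ f ->
  (forall x, a < x < b -> `|f x| <= k) -> L1 a b g -> L1 a b (fun t => f t * g t).
Proof.
move=> mf fk gi; apply: (@le_L1 _ _ _ (fun t => k * `|g t|)).
- by apply: measurable_funM => //; exact: L1_meas gi.
- by move=> x xab; rewrite normrM ler_wpM2r// fk.
- exact/L1Z/L1_norm.
Qed.

Lemma within_cvgP a b f x : {within `[a, b], continuous f} -> a <= x <= b ->
  forall e : R, 0 < e -> exists2 d : R, 0 < d &
  forall y, a <= y <= b -> `|y - x| < d -> `|f y - f x| < e.
Proof.
move=> /subspace_continuousP cf xab e e0.
have /cvgrPdist_lt /(_ _ e0) := cf x xab.
rewrite near_withinE => /nbhs_ballP[d d0 H]; exists d => // y yab yx.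
by rewrite distrC; apply: H => //; rewrite /ball/= distrC.
Qed.

Lemma within_cvg a b f :
  (forall x, a <= x <= b -> forall e : R, 0 < e -> exists2 d : R, 0 < d &
    forall y, a <= y <= b -> `|y - x| < d -> `|f y - f x| < e) ->
  {within `[a, b], continuous f}.
Proof.
move=> H; apply/subspace_continuousP => x xab.
apply/cvgrPdist_lt => e e0; rewrite near_withinE.
have [d d0 Hd] := H x xab e e0.
apply/nbhs_ballP; exists d => // y; rewrite /ball/= => yx yab.
by rewrite distrC; apply: Hd => //; rewrite distrC.
Qed.

Lemma continuous_itv_bounded a b f : {within `[a, b], continuous f} ->
  exists2 k : R, 0 < k & forall x, a <= x <= b -> `|f x| <= k.
Proof.
move=> cf; have [ab|ba] := leP a b; last first.
  by exists 1 => // x /andP[ax xb]; move: (le_lt_trans (le_trans ax xb) ba); rewrite ltxx.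
have [c1 _ H1] := EVT_max ab cf; have [c2 _ H2] := EVT_min ab cf.
exists (1 + `|f c1| + `|f c2|) => [|x xab].
  by rewrite -addrA ltr_pwDl// addr_ge0.
have := H1 x; have := H2 x; rewrite !in_itv/= => /(_ xab) A /(_ xab) B.
rewrite ler_norml; apply/andP; split.
  have := ler_norm (- f c2); rewrite normrN => C.
  have := normr_ge0 (f c1); lra.
have := ler_norm (f c1); have := normr_ge0 (f c2); lra.
Qed.

Lemma continuous_itv_meas a b f : {within `[a, b], continuous f} ->
  measurable_fun `]a, b[ f.
Proof.
move=> cf; apply: (@measurable_funS _ _ _ _ `[a, b]) => //.
  exact: subset_itv_oo_cc.
exact: subspace_continuous_measurable_fun.
Qed.

Lemma L1_continuous a b f : {within `[a, b], continuous f} -> L1 a b f.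
Proof.
move=> cf; have [k k0 fk] := continuous_itv_bounded cf.
apply: (@le_L1 _ _ _ (fun=> k)); first exact: continuous_itv_meas.
  by move=> x /andP[ax xb]; apply: fk; rewrite !ltW.
exact: L1_cst.
Qed.

Lemma L1_mul_continuous a b f g : {within `[a, b], continuous f} ->
  L1 a b g -> L1 a b (fun t => f t * g t).
Proof.
move=> cf; have [k k0 fk] := continuous_itv_bounded cf.
apply: L1_mul_bounded; first exact: continuous_itv_meas.
  by move=> x /andP[ax xb]; apply: fk; rewrite !ltW.
Qed.

Lemma itgxx f x : itg f x x = 0.
Proof. by rewrite /itg set_itv_ge ?Rintegral_set0// bnd_simp ltxx. Qed.

Lemma itg_split f x y z : x <= y -> y <= z -> L1 x z f ->
  itg f x z = itg f x y + itg f y z.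
Proof.
rewrite le_eqVlt => /predU1P[-> _ _|xy]; first by rewrite itgxx add0r.
move=> yz fi; rewrite /itg.
have E := @Rintegral_itvB R f (BRight x) (BLeft z) y fi.
move: yz; rewrite le_eqVlt => /predU1P[<-|yz]; first by rewrite -!/(itg _ _ _) itgxx addr0.
rewrite -E ?bnd_simp//; last exact: ltW.
rewrite (@Rintegral_itv_bndo_bndc _ (BRight x) y f); first by rewrite addrC subrK.
by apply: (L1_sub _ _ fi); rewrite // ltW.
Qed.

Lemma itgD a b f g : L1 a b f -> L1 a b g ->
  itg (fun t => f t + g t) a b = itg f a b + itg g a b.
Proof. exact: RintegralD. Qed.

Lemma itgB a b f g : L1 a b f -> L1 a b g ->
  itg (fun t => f t - g t) a b = itg f a b - itg g a b.
Proof. exact: RintegralB. Qed.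

Lemma itgZ a b k f : L1 a b f -> itg (fun t => k * f t) a b = k * itg f a b.
Proof. exact: RintegralZl. Qed.

Lemma itgN a b f : L1 a b f -> itg (fun t => - f t) a b = - itg f a b.
Proof.
move=> fi; rewrite -mulN1r -itgZ//.
by apply: eq_Rintegral => x _; rewrite mulN1r.
Qed.

Lemma eq_itg a b f g : (forall x, a < x < b -> f x = g x) -> itg f a b = itg g a b.
Proof. by move=> fg; apply: eq_Rintegral => x; rewrite inE/= in_itv/= => /fg. Qed.

Lemma itg_cst a b k : a <= b -> itg (fun=> k) a b = k * (b - a).
Proof.
move=> ab; rewrite /itg Rintegral_cst//= lebesgue_measure_itv/= lte_fin.
by move: ab; rewrite le_eqVlt => /predU1P[->|->]//; rewrite ltxx subrr.
Qed.

Lemma aeS (P Q : R -> Prop) : (forall x, P x -> Q x) ->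
  {ae mu, forall x, P x} -> {ae mu, forall x, Q x}.
Proof. by move=> PQ; apply: (@filterS _ _ (ae_filter_ringOfSetsType mu)). Qed.

Lemma aeS2 (P Q S : R -> Prop) : (forall x, P x -> Q x -> S x) ->
  {ae mu, forall x, P x} -> {ae mu, forall x, Q x} -> {ae mu, forall x, S x}.
Proof. by move=> PQ; apply: (@filterS2 _ _ (ae_filter_ringOfSetsType mu)). Qed.

Definition aeI a b (P : R -> Prop) := {ae mu, forall x, a < x < b -> P x}.

Lemma aeI_sub a b x y (P : R -> Prop) : a <= x -> y <= b -> aeI a b P -> aeI x y P.
Proof.
move=> ax yb; apply: aeS => t H /andP[xt ty]; apply: H.
by rewrite (le_lt_trans ax xt) (lt_le_trans ty yb).
Qed.

Lemma aeI_all a b (P : R -> Prop) : (forall x, a < x < b -> P x) -> aeI a b P.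
Proof. by move=> H; exact: aeW. Qed.

Lemma aeI_and a b (P Q : R -> Prop) : aeI a b P -> aeI a b Q ->
  aeI a b (fun x => P x /\ Q x).
Proof. by apply: aeS2 => x HP HQ xab; split; [exact: HP|exact: HQ]. Qed.

Lemma aeI_imp a b (P Q : R -> Prop) : (forall x, a < x < b -> P x -> Q x) ->
  aeI a b P -> aeI a b Q.
Proof. by move=> PQ; apply: aeS => x HP xab; apply: PQ (HP xab). Qed.

Lemma ae_eq_itg a b f g : measurable_fun `]a, b[ f -> measurable_fun `]a, b[ g ->
  aeI a b (fun x => f x = g x) -> itg f a b = itg g a b.
Proof.
move=> mf mg fg; congr fine; apply: ae_eq_integral => //; try exact/measurable_EFinP.
by move: fg; apply: aeS => x H xab; rewrite H//; move: xab; rewrite /= in_itv.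
Qed.

Lemma ae_L1 a b f g : measurable_fun `]a, b[ g -> L1 a b f ->
  aeI a b (fun x => f x = g x) -> L1 a b g.
Proof.
move=> mg fi fg; have mf := L1_meas fi.
apply/integrableP; split; first exact/measurable_EFinP.
case/integrableP : fi => _; apply: le_lt_trans.
rewrite le_eqVlt; apply/orP; left; apply/eqP.
apply: ae_eq_integral => //.
- by apply: measurableT_comp => //; exact/measurable_EFinP.
- by apply: measurableT_comp => //; exact/measurable_EFinP.
move: fg; apply: aeS => x H xab.
by rewrite /= H//; move: xab; rewrite /= in_itv.
Qed.

Lemma itg_ge0 a b f : (forall x, a < x < b -> 0 <= f x) -> 0 <= itg f a b.
Proof. by move=> f0; apply: Rintegral_ge0 => x /=; rewrite in_itv/= => /f0. Qed.

Lemma itg_le a b f g : L1 a b f -> L1 a b g ->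
  (forall x, a < x < b -> f x <= g x) -> itg f a b <= itg g a b.
Proof. by move=> fi gi fg; apply: le_Rintegral => // x /=; rewrite in_itv/= => /fg. Qed.

Lemma itg_le_ae a b f g : L1 a b f -> L1 a b g ->
  aeI a b (fun x => f x <= g x) -> itg f a b <= itg g a b.
Proof.
move=> fi gi fg; have mf := L1_meas fi; have mg := L1_meas gi.
have mm : measurable_fun `]a, b[ (fun x => Num.max (f x) (g x)).
  exact: measurable_maxr.
rewrite (@ae_eq_itg a b g (fun x => Num.max (f x) (g x)))//; last first.
  by move: fg; apply: aeS => x H xab; rewrite max_r// H.
apply: itg_le => // [|x xab]; last by rewrite le_max lexx.
apply: (ae_L1 _ gi) => //.
by move: fg; apply: aeS => x H xab; rewrite max_r// H.
Qed.

Lemma itg_norm_le a b f g : L1 a b f -> L1 a b g ->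
  aeI a b (fun x => `|f x| <= g x) -> `|itg f a b| <= itg g a b.
Proof.
move=> fi gi fg; apply: (@le_trans _ _ (itg (fun t => `|f t|) a b)).
  by apply: le_normr_Rintegral.
by apply: itg_le_ae => //; exact: L1_norm.
Qed.

Lemma itg_norm_cst a b k f : a <= b -> L1 a b f ->
  aeI a b (fun x => `|f x| <= k) -> `|itg f a b| <= k * (b - a).
Proof.
by move=> ab fi fk; rewrite -itg_cst//; apply: itg_norm_le => //; exact: L1_cst.
Qed.

Lemma itg_eq0_ae a b f : L1 a b f -> aeI a b (fun x => 0 <= f x) ->
  itg f a b = 0 -> aeI a b (fun x => f x = 0).
Proof.
move=> fi f0 If; have mf := L1_meas fi.
have E : itg (fun x => `|f x|) a b = 0.
  rewrite -If; apply: ae_eq_itg => //; first exact: measurableT_comp.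
  by move: f0; apply: aeS => x H xab; rewrite ger0_norm// H.
have : (\int[mu]_(x in `]a, b[) `|(EFin \o f) x| = 0)%E.
  rewrite -(@fineK _ (\int[mu]_(x in `]a, b[) `|(EFin \o f) x|)%E).
    by congr (_%:E).
  by apply: integrable_fin_num => //; exact: integrable_abse.
move=> /(ae_eq_integral_abs mu (measurable_itv _) ((measurable_EFinP _ _).2 mf)).1.
by apply: filterS => x /= H1 xab; apply: EFin_inj; apply: H1; rewrite in_itv.
Qed.

(** A bound on increments that holds near each point holds globally: the set of
    the x up to which it holds is nonempty, and its supremum cannot be less
    than b. *)
Lemma local_increment a b D N : a <= b ->
  (forall x, a <= x <= b -> exists2 d : R, 0 < d & forall y z, a <= y -> y <= z ->
     z <= b -> `|y - x| < d -> `|z - x| < d -> `|D z - D y| <= N z - N y) ->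
  `|D b - D a| <= N b - N a.
Proof.
move=> ab loc.
pose S := [set x | a <= x <= b /\ forall y, a <= y <= x -> `|D y - D a| <= N y - N a].
have Sa : S a.
  split; first by rewrite lexx.
  by move=> y; rewrite -eq_le => /eqP <-; rewrite !subrr normr0.
have Sub : ubound S b by move=> x [/andP[_ ->]].
have hS : has_sup S by split; [exists a|exists b].
set c := sup S.
have cb : c <= b by apply: ge_sup; [exists a|].
have ac : a <= c by apply: ub_le_sup Sa; exists b.
have cab : a <= c <= b by rewrite ac.
have [d d0 Hd] := loc c cab.
have [x [/andP[ax xb] Hx] cdx] := sup_adherent d0 hS.
have xc : x <= c by apply: ub_le_sup; [exists b|split; [rewrite ax|]].
have Hall y : a <= y <= b -> y < c + d -> `|D y - D a| <= N y - N a.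
  move=> /andP[ay yb] ycd; have [yx|/ltW xy] := leP y x; first by apply: Hx; rewrite ay.
  have xcd : `|x - c| < d by rewrite distrC ger0_norm ?subr_ge0//; move: cdx; rewrite -/c; lra.
  have yc : `|y - c| < d.
    by rewrite ltr_norml; apply/andP; split; move: cdx; rewrite -/c; lra.
  have H1 := Hd x y ax xy yb xcd yc.
  have H2 := Hx x; rewrite ax lexx /= in H2; have {}H2 := H2 isT.
  have -> : D y - D a = (D y - D x) + (D x - D a) by ring.
  by rewrite (le_trans (ler_normD _ _))//; lra.
have [cb'|bc] := ltP c b; last by apply: Hall; rewrite ?ab ?lexx//; lra.
pose m := Num.min (c + d / 2) b.
have Sm : S m.
  split; first by rewrite /m le_min ge_min lexx orbT ab andbT; lra.
  move=> y /andP[ay]; rewrite /m le_min => /andP[yc yb].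
  by apply: Hall; [rewrite ay|lra].
have : m <= c by apply: ub_le_sup => //; exists b.
by rewrite /m ge_min => /orP[]; lra.
Qed.

(** Absolute continuity is stated with its density, so that p' is a datum and
    nothing has to be differentiated almost everywhere. *)
Definition AC a b p g := L1 a b g /\
  forall x y, a <= x -> x <= y -> y <= b -> p y - p x = itg g x y.

Lemma AC_sub a b x y p g : a <= x -> y <= b -> AC a b p g -> AC x y p g.
Proof.
move=> ax yb [gi H]; split; first exact: L1_sub gi.
move=> s t xs st ty; apply: H => //; first exact: le_trans xs.
exact: le_trans ty yb.
Qed.

Lemma AC_eq a b p q g : (forall x, a <= x <= b -> p x = q x) ->
  AC a b p g -> AC a b q g.
Proof.
move=> pq [gi H]; split=> // x y ax xy yb.
by rewrite -!pq ?H ?ax ?(le_trans ax xy) ?yb ?(le_trans xy yb).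
Qed.

Lemma AC_ae a b p g h : measurable_fun `]a, b[ h -> aeI a b (fun x => g x = h x) ->
  AC a b p g -> AC a b p h.
Proof.
move=> mh gh [gi H]; split; first exact: ae_L1 gi gh.
move=> x y ax xy yb; rewrite H//; apply: ae_eq_itg.
- exact: L1_meas (L1_sub ax yb gi).
- by apply: measurable_funS mh => //; apply: subset_itv; rewrite bnd_simp.
- exact: aeI_sub gh.
Qed.

Lemma AC_eq_density a b p g h : (forall x, a < x < b -> g x = h x) ->
  AC a b p g -> AC a b p h.
Proof.
move=> gh [gi H]; split; first exact: eq_L1 gi.
move=> x y ax xy yb; rewrite H//; apply: eq_itg => t /andP[xt ty].
by apply: gh; rewrite (le_lt_trans ax xt) (lt_le_trans ty yb).
Qed.

Lemma AC_itg a b g : L1 a b g -> AC a b (itg g a) g.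
Proof.
move=> gi; split=> // x y ax xy yb.
rewrite (@itg_split _ _ x y)//; first by rewrite addrC addKr.
by apply: L1_sub gi.
Qed.

Lemma ACD a b p q g h : AC a b p g -> AC a b q h ->
  AC a b (fun x => p x + q x) (fun x => g x + h x).
Proof.
move=> [gi H] [hi K]; split; first exact: L1D.
move=> x y ax xy yb; rewrite itgD; last 2 first.
- exact: L1_sub gi.
- exact: L1_sub hi.
by rewrite -H// -K//; ring.
Qed.

Lemma ACZ a b k p g : AC a b p g -> AC a b (fun x => k * p x) (fun x => k * g x).
Proof.
move=> [gi H]; split; first exact: L1Z.
move=> x y ax xy yb; rewrite itgZ; last exact: L1_sub gi.
by rewrite -H// mulrBr.
Qed.

Lemma AC_cst a b k : AC a b (fun=> k) (fun=> 0).
Proof.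
by split; [exact: L1_cst|move=> x y ax xy yb; rewrite itg_cst// mul0r subrr].
Qed.

Lemma ACB a b p q g h : AC a b p g -> AC a b q h ->
  AC a b (fun x => p x - q x) (fun x => g x - h x).
Proof.
move=> pg /(ACZ (-1)) qh; apply: AC_eq_density (AC_eq _ (ACD pg qh)) => x _ /=; ring.
Qed.

Lemma AC_fact a b p g x y : AC a b p g -> a <= x -> x <= y -> y <= b ->
  p y = p x + itg g x y.
Proof. by move=> [gi H] ax xy yb; rewrite -H//; ring. Qed.

Lemma within_sub a b x y f : a <= x -> y <= b -> {within `[a, b], continuous f} ->
  {within `[x, y], continuous f}.
Proof. by move=> ax yb; apply: continuous_subspaceW; apply: subset_itv; rewrite bnd_simp. Qed.

Lemma eq_within a b f g : (forall x, a <= x <= b -> f x = g x) ->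
  {within `[a, b], continuous f} -> {within `[a, b], continuous g}.
Proof.
move=> fg cf; apply: within_cvg => x xab e e0.
have [d d0 H] := within_cvgP cf xab e0; exists d => // y yab yx.
by rewrite -!fg// H.
Qed.

Lemma L1_restrict a b f : L1 a b f -> mu.-integrable setT (EFin \o (f \_ `]a, b[)).
Proof.
move=> fi; have := (@integrable_mkcond _ _ _ mu `]a, b[ (EFin \o f) (measurable_itv _)).1 fi.
by rewrite restrict_EFin. Qed.

Lemma itg_restrict a b c f x : a <= c -> c <= x -> x <= b -> L1 a b f ->
  itg f c x = \int[mu]_(t in `]c, x]) (f \_ `]a, b[) t.
Proof.
move=> ac cx xb fi; rewrite -(@Rintegral_itv_bndo_bndc _ (BRight c) x); last first.
  by apply: integrableS (L1_restrict fi).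
apply: eq_itg => t /andP[ct tx]; rewrite patchE mem_set//= in_itv/=.
by rewrite (le_lt_trans ac ct) (lt_le_trans tx xb).
Qed.

Lemma AC_continuous a b p g : AC a b p g -> {within `[a, b], continuous p}.
Proof.
move=> [gi H]; have [ab|ba] := leP a b; last first.
  by rewrite set_itv_ge -?leNgt ?bnd_simp -?ltNge//; exact: continuous_subspace0.
have gT := L1_restrict gi.
have gab : mu.-integrable `[a, b] (EFin \o (g \_ `]a, b[)) by exact: integrableS gT.
have C := parameterized_integral_continuous ab gab.
apply: (@eq_within _ _ (fun x => p a + parameterized_integral mu a x (g \_ `]a, b[))).
  move=> x /andP[ax xb]; rewrite -(subrK (p a) (p x)) (H a x)// addrC; congr (_ + _).
  rewrite /parameterized_integral -Rintegral_itv_obnd_cbnd ?(@itg_restrict a b)//.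
  exact: integrableS gT.
apply: within_cvg => x xab e e0; have [d d0 Hd] := within_cvgP C xab e0.
by exists d => // y yab yx; rewrite opprD addrACA subrr add0r; exact: Hd.
Qed.

Lemma near_itv a b x : a < x < b -> \forall y \near x, a < y < b.
Proof.
move=> xab; have : x \in `]a, b[ by rewrite in_itv.
by move=> /near_in_itvoo; apply: filterS => y; rewrite in_itv.
Qed.
(** The integrand is cut off outside ]a, b[ so that the fundamental theorem of
    calculus applies to an integrable function on the line. *)
Lemma AC_derive a b p g x : AC a b p g -> a < x < b ->
  {for x, continuous g} -> is_derive x 1 p (g x).
Proof.
move=> [gi H] /andP[ax xb] cg; have gT := L1_restrict gi.
have near_ab : \forall y \near x, a < y < b by apply: near_itv; rewrite ax.
have cg0 : {for x, continuous (g \_ `]a, b[)}.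
  rewrite /prop_for /continuous_at patchE mem_set/= ?in_itv/= ?ax//.
  apply: (cvg_trans _ cg); apply: near_eq_cvg; apply: filterS near_ab => y yab.
  by rewrite patchE mem_set//= in_itv.
have gb : mu.-integrable [set` Interval (BRight a) (BRight b)] (EFin \o (g \_ `]a, b[)).
  exact: integrableS gT.
have [||dF dE] := @continuous_FTC1 R _ (BRight a) x b xb gb; [by rewrite lte_fin|exact: cg0|].
have E : {near x, (fun y => \int[mu]_(t in [set` Interval (BRight a) (BRight y)]) (g \_ `]a, b[) t)
   =1 (fun y => p y - p a)}.
  apply: filterS near_ab => y /andP[ay yb].
  by rewrite -(@itg_restrict a b a g y) ?H ?(ltW ay) ?(ltW yb).
have D1 : is_derive x 1 (fun y => p y - p a) (g x).
  apply: near_eq_is_derive; first exact: E.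
  apply: DeriveDef => //; rewrite -derive1E dE patchE mem_set//= in_itv/=.
  by rewrite ax.
have D2 := is_deriveD D1 (is_derive_cst (p a) x 1).
rewrite addr0 in D2; apply: near_eq_is_derive D2.
by near=> y; rewrite /= subrK.
Unshelve. all: by end_near.
Qed.

Lemma derive_AC a b p g : {within `[a, b], continuous p} ->
  (forall x, a < x < b -> is_derive x 1 p (g x)) ->
  {within `[a, b], continuous g} -> AC a b p g.
Proof.
move=> cp dp cg; split; first exact: L1_continuous.
move=> x y ax; rewrite le_eqVlt => /predU1P[-> _|xy yb]; first by rewrite itgxx subrr.
have cgxy := within_sub ax yb cg; have cpxy := within_sub ax yb cp.
have [_ pr pl] := (continuous_within_itvP _ xy).1 cpxy.
have inab z : z \in `]x, y[ -> a < z < b.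
  by rewrite in_itv/= => /andP[xz zy]; rewrite (le_lt_trans ax xz) (lt_le_trans zy yb).
have := @continuous_FTC2 R g p x y xy cgxy.
move=> /(_ _ _)/wrap[].
  by split => // z /inab zab; have [] := dp z zab.
  by move=> z /inab zab; rewrite derive1E; have [_ ->] := dp z zab.
move=> E; rewrite /itg.
have gi : L1 x y g by exact: L1_continuous.
have gi' : mu.-integrable `]x, y] (EFin \o g).
  apply: (@integrableS _ _ _ mu `[x, y]%classic) => //; first exact: subset_itv_oc_cc.
  by apply: continuous_compact_integrable => //; exact: segment_compact.
by rewrite Rintegral_itv_bndo_bndc// Rintegral_itv_obnd_cbnd// /Rintegral E.
Qed.

(** By Lebesgue's differentiation theorem f is a.e. the derivative of its
    indefinite integral. *)
Lemma itg_eq0_all a b f : L1 a b f ->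
  (forall x y, a <= x -> x <= y -> y <= b -> itg f x y = 0) ->
  aeI a b (fun x => f x = 0).
Proof.
move=> fi H; have fT := L1_restrict fi.
have := @FTC1 R (f \_ `]a, b[) (BRight a) _ _.
move=> /(_ _ _)/wrap[].
- by move=> y; exact: integrableS fT.
- exact: integrable_locally_restrict.
apply: aeS => x + xab; have /andP[ax xb] := xab.
move=> /(_ _)/wrap[]; first by rewrite lte_fin.
move=> [_]; rewrite derive1E patchE mem_set/= ?in_itv//= => <-.
rewrite (@near_eq_derive _ _ _ _ (cst 0)) ?derive_cst//.
apply: filterS (near_itv xab) => y /andP[ay yb].
by rewrite -(@itg_restrict a b a f y) ?H// ltW.
Qed.

Lemma AC_density_unique a b p g h : AC a b p g -> AC a b p h ->
  aeI a b (fun x => g x = h x).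
Proof.
move=> pg ph; have [gi G] := ACB pg ph.
have := itg_eq0_all gi; move=> /(_ _)/wrap[].
  by move=> x y ax xy yb; rewrite -G// !subrr.
by apply: aeI_imp => x _ /eqP; rewrite subr_eq0 => /eqP.
Qed.

Lemma mean_value (f f' : R -> R) x y : (forall z, is_derive z 1 f (f' z)) ->
  exists2 c, Num.min x y <= c /\ c <= Num.max x y & f y - f x = f' c * (y - x).
Proof.
move=> df; have cf u v : {within `[u, v], continuous f}.
  by apply: continuous_subspaceT => z; apply/differentiable_continuous/derivable1_diffP.
have [xy|/ltW yx] := leP x y.
  have [c] := MVT_segment xy (fun z _ => df z) (cf x y).
  by rewrite in_itv/= => /andP[]; exists c.
have [c] := MVT_segment yx (fun z _ => df z) (cf y x).
rewrite in_itv/= => /andP[yc cx] E; exists c; first by [].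
by rewrite -opprB E -mulrN opprB.
Qed.

(** On a short interval the increment of f o p is f' at an intermediate value
    times the increment of p, hence close to the integral of (f' o p) p'. *)
Lemma AC_comp a b p g (f f' : R -> R) : (forall x, is_derive x 1 f (f' x)) ->
  continuous f' -> AC a b p g -> AC a b (fun x => f (p x)) (fun x => f' (p x) * g x).
Proof.
move=> df cf pg; have cp := AC_continuous pg; have [gi G] := pg.
have cfp : {within `[a, b], continuous (fun x => f' (p x))}.
  by move=> x; apply: continuous_comp; [exact: cp|exact: cf].
have hi : L1 a b (fun x => f' (p x) * g x) by exact: L1_mul_continuous.
split=> // x y ax xy yb.
have gxy := L1_sub ax yb gi; have hxy := L1_sub ax yb hi.
have ab : a <= b by exact: le_trans (le_trans ax xy) yb.
apply/eqP; rewrite -subr_eq0 -normr_le0; apply/ler_addgt0Pl => e e0.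
(* [local_increment] bounds the error by e' times the integral of |g|. *)
set I := itg (fun t => `|g t|) x y.
have I0 : 0 <= I by apply: itg_ge0.
pose e' := e / (1 + I); have e'0 : 0 < e' by rewrite divr_gt0// ltr_pwDl.
suff : `|f (p y) - f (p x) - itg (fun t => f' (p t) * g t) x y| <= e' * I.
  move=> /le_trans; apply; rewrite addr0 /e' mulrAC ler_pdivrMr ?ltr_pwDl//.
  by rewrite ler_pM2l// lerDr.
pose D z := f (p z) - itg (fun t => f' (p t) * g t) x z.
pose N z := e' * itg (fun t => `|g t|) x z.
have := @local_increment x y D N xy; rewrite /D /N !itgxx subr0 mulr0 subr0.
have -> : f (p y) - itg (fun t => f' (p t) * g t) x y - f (p x) =
          f (p y) - f (p x) - itg (fun t => f' (p t) * g t) x y by ring.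
apply=> c /andP[xc cy].
have cf' := cf (p c); move/cvgrPdist_lt : cf' => /(_ (e' / 2)) /(_ (divr_gt0 e'0 (ltr0n _ 2))) /nbhs_ballP[d1 d10 H1].
have cab : a <= c <= b by rewrite (le_trans ax xc) (le_trans cy yb).
have [d d0 H2] := within_cvgP cp cab d10.
exists d => // u z xu uz zy uc zc.
have uab : a <= u <= b by rewrite (le_trans ax xu) (le_trans uz (le_trans zy yb)).
have zab : a <= z <= b by rewrite (le_trans ax (le_trans xu uz)) (le_trans zy yb).
have [xi [xiu xiv] Exi] := mean_value (p u) (p z) df.
have near_xi : `|p c - xi| < d1.
  have := H2 u uab uc; have := H2 z zab zc; rewrite !ltr_norml => /andP[A B] /andP[A' B'].
  move: xiu xiv; rewrite minEle maxEle; clear -A B A' B'.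
  by case: ifP => _ ? ?; apply/andP; split; lra.
have gux : L1 x u g := L1_sub (lexx x) (le_trans uz zy) gxy.
have guz : L1 u z g := L1_sub xu zy gxy.
have huz : L1 u z (fun t => f' (p t) * g t) := L1_sub xu zy hxy.
rewrite (@itg_split _ x u z)//; last exact: L1_sub hxy.
rewrite (@itg_split (fun t => `|g t|) x u z)//; last exact: L1_norm (L1_sub _ _ gxy).
rewrite [leRHS](_ : _ = e' * itg (fun t => `|g t|) u z); last by ring.
rewrite -itgZ; last exact: L1_norm.
have -> : f (p z) - (itg (fun t => f' (p t) * g t) x u + itg (fun t => f' (p t) * g t) u z) -
  (f (p u) - itg (fun t => f' (p t) * g t) x u) =
  (f (p z) - f (p u)) - itg (fun t => f' (p t) * g t) u z by ring.
rewrite Exi G//; last 2 first.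
- by case/andP: uab.
- by case/andP: zab.
rewrite -itgZ// -itgB//; last exact: L1Z.
apply: itg_norm_le; first by apply: L1B => //; exact: L1Z.
  by apply/L1Z/L1_norm.
apply: aeI_all => t /andP[ut tz]; rewrite -mulrBl normrM ler_wpM2r//.
have tc : `|t - c| < d.
  move: uc zc; rewrite !ltr_norml; clear -ut tz => /andP[? ?] /andP[? ?].
  by apply/andP; split; lra.
have tab : a <= t <= b.
  by clear -uab zab ut tz; case/andP: uab zab => ? ? /andP[? ?]; apply/andP; split; lra.
have A := H1 xi near_xi; have B : `|f' (p c) - f' (p t)| < e' / 2.
  by apply: H1; rewrite /ball/= distrC; exact: H2.
have -> : f' xi - f' (p t) = (f' (p c) - f' (p t)) - (f' (p c) - f' xi) by ring.
rewrite (le_trans (ler_normB _ _))// [leRHS]splitr lerD//; exact: ltW.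
Qed.

(** Polarization: 4 p q = (p + q)^2 - (p - q)^2 reduces the product rule to the
    chain rule. *)
Lemma ACM a b p q g h : AC a b p g -> AC a b q h ->
  AC a b (fun x => p x * q x) (fun x => p x * h x + q x * g x).
Proof.
move=> pg qh.
have dsq x : is_derive x 1 (fun t : R => t ^+ 2) (2 * x).
  by apply: is_derive_eq; rewrite /GRing.scale/= mulr1 -mulr_natl; ring.
have csq : continuous (fun t : R => 2 * t).
  by move=> x; exact: mulrl_continuous.
have A := AC_comp dsq csq (ACD pg qh).
have B := AC_comp dsq csq (ACB pg qh).
have C := ACZ (1 / 4) (ACB A B).
apply: AC_eq_density (AC_eq _ C) => x _ /=; by field.
Qed.

Lemma AC_nonincreasing a b p g : AC a b p g -> aeI a b (fun x => g x <= 0) ->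
  forall x y, a <= x -> x <= y -> y <= b -> p y <= p x.
Proof.
move=> [gi H] g0 x y ax xy yb; rewrite -subr_le0 H//.
rewrite -[leRHS](mul0r (y - x)) -itg_cst//; apply: itg_le_ae.
- exact: L1_sub gi.
- exact: L1_cst.
- exact: aeI_sub g0.
Qed.

Lemma AC_by_parts a b p q g h : a <= b -> AC a b p g -> AC a b q h ->
  itg (fun x => p x * h x) a b = p b * q b - p a * q a - itg (fun x => q x * g x) a b.
Proof.
move=> ab pg qh; have [gi _] := pg; have [hi _] := qh.
have [_ /(_ a b (lexx _) ab (lexx _)) ->] := ACM pg qh.
have cp := AC_continuous pg; have cq := AC_continuous qh.
rewrite itgD; first by rewrite addrK.
  exact: L1_mul_continuous.
exact: L1_mul_continuous.
Qed.

End interval_integrals.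

(** * Square integrable functions and weak derivatives *)

Section square_integrable.
Context {R : realType}.
Implicit Types (a b c d x y z k e : R) (f g h p q u v phi psi : R -> R).

Notation I := (`]0, 1[%classic : set R).

Definition Q2 a b f := measurable_fun `]a, b[ f /\ L1 a b (fun x => f x ^+ 2).

Lemma L2P u : L2 u <-> Q2 0 1 u.
Proof.
split=> [ul|[mu1 ui]].
  have um : measurable_fun setT (u \_ I).
    by move: ul; rewrite /L2 inE => /andP[/[!inE]/= mu1 _].
  split; first by apply/(measurable_restrictT _ _).2 => //; exact: um.
  have := Lfun2_integrable_sqr ul => H.
  apply: (@eq_L1 _ _ _ (fun x => (u \_ I) x ^+ 2)).
    by move=> x x01; rewrite patchE mem_set//= in_itv.
  exact: integrableS H.
have um : measurable_fun setT (u \_ I) by apply/(measurable_restrictT _ _).1.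
rewrite /L2 inE; apply/andP; split; rewrite inE//=.
rewrite /finite_norm unlock; apply: poweR_lty.
have := L1_restrict ui => /integrableP[_]; apply: le_lt_trans.
rewrite le_eqVlt; apply/orP; left; apply/eqP; apply: eq_integral => x _ /=.
rewrite powR_mulrn// real_normK ?num_real//; congr (_%:E).
rewrite !patchE; case: ifP => _; last by rewrite normr0 expr0n.
by rewrite ger0_norm ?sqr_ge0.
Qed.

Lemma Q2_L1M a b f g : Q2 a b f -> Q2 a b g -> L1 a b (fun x => f x * g x).
Proof.
move=> [mf fi] [mg gi]; apply: (@le_L1 _ _ _ _ (fun x => f x ^+ 2 + g x ^+ 2)).
- exact: measurable_funM.
- move=> x _; rewrite normrM -(real_normK (num_real (f x))) -(real_normK (num_real (g x))).
  have := sqr_ge0 (`|f x| - `|g x|); have := sqr_ge0 (`|f x|); have := sqr_ge0 (`|g x|); nra.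
- exact: L1D.
Qed.

Lemma Q2_cst a b k : Q2 a b (fun=> k).
Proof. by split; [exact: measurable_cst|exact: L1_cst]. Qed.

Lemma Q2_L1 a b f : Q2 a b f -> L1 a b f.
Proof.
move=> fi; apply: eq_L1 (Q2_L1M (Q2_cst a b 1) fi) => x _; exact: mul1r.
Qed.

Lemma Q2D a b f g : Q2 a b f -> Q2 a b g -> Q2 a b (fun x => f x + g x).
Proof.
move=> Qf Qg; have [mf fi] := Qf; have [mg gi] := Qg; split; first exact: measurable_funD.
apply: eq_L1 (L1D (L1D fi gi) (L1Z 2 (Q2_L1M Qf Qg))) => x _ /=; ring.
Qed.

Lemma Q2_mul_bounded a b k f g : measurable_fun `]a, b[ f ->
  (forall x, a < x < b -> `|f x| <= k) -> Q2 a b g -> Q2 a b (fun x => f x * g x).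
Proof.
move=> mf fk [mg gi]; split; first exact: measurable_funM.
apply: (@eq_L1 _ _ _ (fun x => f x ^+ 2 * g x ^+ 2)); first by move=> x _; rewrite exprMn.
apply: (@L1_mul_bounded _ _ _ (k ^+ 2)) => //; first exact: measurable_funX.
by move=> x /fk H; rewrite normrX lerXn2r// ?nnegrE// (le_trans _ H).
Qed.

Lemma Q2_mul_continuous a b f g : {within `[a, b], continuous f} -> Q2 a b g ->
  Q2 a b (fun x => f x * g x).
Proof.
move=> cf Qg; have [k k0 fk] := continuous_itv_bounded cf.
apply: (@Q2_mul_bounded _ _ k) => //; first exact: continuous_itv_meas.
by move=> x /andP[ax xb]; apply: fk; rewrite !ltW.
Qed.

Lemma Q2Z a b k f : Q2 a b f -> Q2 a b (fun x => k * f x).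
Proof. by apply: (@Q2_mul_bounded _ _ `|k|) => //; exact: measurable_cst. Qed.

Lemma Q2B a b f g : Q2 a b f -> Q2 a b g -> Q2 a b (fun x => f x - g x).
Proof.
move=> Qf /(Q2Z (-1)) Qg; have := Q2D Qf Qg.
by congr (Q2 _ _ _); apply/funext => x; rewrite mulN1r.
Qed.

Lemma Q2_continuous a b f : {within `[a, b], continuous f} -> Q2 a b f.
Proof.
move=> cf; have := Q2_mul_continuous cf (Q2_cst a b 1).
by congr (Q2 _ _ _); apply/funext => x; rewrite mulr1.
Qed.

Lemma Q2_sub a b x y f : a <= x -> y <= b -> Q2 a b f -> Q2 x y f.
Proof.
move=> ax yb [mf fi]; split; last exact: L1_sub fi.
by apply: measurable_funS mf => //; apply: subset_itv; rewrite bnd_simp.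
Qed.

Lemma itg0 a b f : (forall x, a < x < b -> f x = 0) -> itg f a b = 0.
Proof.
move=> f0; rewrite (eq_itg (g := fun=> 0))//; have [ab|ba] := leP a b.
  by rewrite itg_cst// mul0r.
by rewrite /itg set_itv_ge ?Rintegral_set0// bnd_simp -leNgt ltW.
Qed.

Lemma ae_itg0 a b f : L1 a b f -> aeI a b (fun x => f x = 0) -> itg f a b = 0.
Proof.
move=> fi f0; rewrite -[RHS](@itg0 a b (fun=> 0))//; apply: ae_eq_itg => //.
exact: L1_meas.
Qed.

Lemma continuous_ae_eq a b f g : a < b -> {within `[a, b], continuous f} ->
  {within `[a, b], continuous g} -> aeI a b (fun x => f x = g x) ->
  forall x, a <= x <= b -> f x = g x.
Proof.
move=> ab cf cg fg x xab; apply/eqP; rewrite -subr_eq0; apply/negPn/negP => fgx.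
pose D t := f t - g t; pose e := `|D x|; have e0 : 0 < e by rewrite normr_gt0.
have e30 : 0 < e / 3 by rewrite divr_gt0.
have [d1 d10 H1] := within_cvgP cf xab e30; have [d2 d20 H2] := within_cvgP cg xab e30.
pose d := Num.min d1 d2; have d0 : 0 < d by rewrite lt_min d10.
pose y := Num.max a (x - d / 2); pose z := Num.min b (x + d / 2).
have /andP[ax xb] := xab.
have yz : y < z by rewrite /y /z lt_min !gt_max; apply/andP; split; apply/andP; split; lra.
have ay : a <= y by rewrite /y le_max lexx.
have zb : z <= b by rewrite /z ge_min lexx.
have big t : y < t < z -> e / 3 <= `|D t|.
  rewrite /y /z gt_max lt_min => /andP[/andP[at_ xt] /andP[tb tx]].
  have tab : a <= t <= b by rewrite !ltW.
  have txd : `|t - x| < d by rewrite ltr_norml; apply/andP; split; lra.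
  have /andP[t1 t2] : (`|t - x| < d1) && (`|t - x| < d2) by rewrite -lt_min.
  have A := H1 t tab t1; have B := H2 t tab t2.
  have E : D x = D t - ((f t - f x) - (g t - g x)) by rewrite /D; ring.
  have := ler_normB (D t) ((f t - f x) - (g t - g x)); rewrite -E -/e.
  have := ler_normB (f t - f x) (g t - g x); lra.
have cD : {within `[a, b], continuous D} by move=> t; apply: continuousB; [exact: cf|exact: cg].
have Di : L1 y z (fun t => `|D t|) by apply/L1_norm/(L1_sub ay zb)/L1_continuous.
have I0 : itg (fun t => `|D t|) y z = 0.
  apply: ae_itg0 => //; apply: aeI_sub ay zb _; apply: aeI_imp fg => t _ E.
  by rewrite /D E subrr normr0.
have : itg (fun=> e / 3) y z <= itg (fun t => `|D t|) y z.
  by apply: itg_le => //; exact: L1_cst.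
rewrite I0 itg_cst ?(ltW yz)//; apply/negP.
by rewrite -ltNge mulr_gt0// subr_gt0.
Qed.

(** Its indefinite integral vanishes before d, and after 1 - d because of the
    zero mean. *)
Lemma C1c_primitive d psi : 0 < d -> continuous psi ->
  (forall x, x < d \/ 1 - d < x -> psi x = 0) -> itg psi 0 1 = 0 ->
  exists2 phi, C1c phi & phi^`()%classic = psi.
Proof.
move=> d0 cpsi psi0 Ipsi.
have pi a b : L1 a b psi by apply/L1_continuous/continuous_subspaceT.
pose phi x := itg psi (-1) x.
have phi_l x : x <= d -> phi x = 0.
  by move=> xd; apply: itg0 => t /andP[_ tx]; apply: psi0; left; exact: lt_le_trans xd.
have phi_r x : 1 - d <= x -> phi x = 0.
  move=> dx; have [x1|x1] := leP x (-1).
    by apply: itg0 => t /andP[t1 t2]; move: (lt_trans t1 t2); rewrite ltNge x1.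
  have A : AC (-1) (Num.max x 1) phi psi by exact: AC_itg.
  have p1 : phi 1 = 0.
    rewrite (AC_fact (x := 0) A) ?le_max ?lexx ?orbT ?lerN10// Ipsi.
    by rewrite phi_l ?addr0// ltW.
  have [x1'|/ltW x1'] := leP 1 x.
    have h1 : -1 <= 1 :> R by lra.
    rewrite (AC_fact (x := 1) A) ?le_max ?lexx//.
    by rewrite p1 add0r itg0// => t /andP[t1 _]; apply: psi0; right; lra.
  have := AC_fact (x := x) (y := 1) A; rewrite p1 ltW// x1' le_max lexx orbT.
  by move=> /(_ isT isT isT) ->; rewrite itg0 ?addr0// => t /andP[t1 _]; apply: psi0; right; lra.
have dphi x : is_derive x 1 phi (psi x).
  have [xd|dx] := ltP x d.
    rewrite psi0; last by left.
    apply: near_eq_is_derive (is_derive_cst 0 x 1).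
    have : x \in `]x - 1, d[ by rewrite in_itv/=; apply/andP; split; lra.
    move=> /near_in_itvoo; apply: filterS => y; rewrite in_itv/= => /andP[_ yd].
    by rewrite phi_l// ltW.
  apply: (@AC_derive _ (-1) (x + 1)).
  - exact: AC_itg.
  - by apply/andP; split; lra.
  - exact: cpsi.
have E : phi^`()%classic = psi by apply/funext => x; rewrite derive1E; have [_ ->] := dphi x.
have supp : closure [set x | phi x != 0] `<=` `[d, 1 - d]%classic.
  have /closure_id -> : closed (`[d, 1 - d]%classic : set R) by exact: interval_closed.
  apply: closureS => x /= px; rewrite in_itv/= !leNgt; apply/andP; split; apply: contra px => H.
    by rewrite phi_l// ltW.
  by rewrite phi_r// ltW.
exists phi => //; split=> //.
- by rewrite E.
- apply: subclosed_compact supp; first exact: closed_closure.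
  exact: segment_compact.
- apply: (subset_trans supp) => x /=; rewrite !in_itv/= => /andP[dx xd].
  by apply/andP; split; lra.
Qed.

Lemma C1c_props phi : C1c phi -> [/\ phi 0 = 0, phi 1 = 0 & AC 0 1 phi (phi^`()%classic)].
Proof.
move=> [dphi cphi _ supp].
have out x : ~ I x -> phi x = 0.
  move=> xI; apply/eqP/negPn/negP => px; apply: xI; apply: supp.
  exact: (@subset_closure _ [set x | phi x != 0]).
split.
- by apply: out; rewrite /= in_itv/= ltxx.
- by apply: out; rewrite /= in_itv/= ltxx andbF.
- apply: derive_AC.
  + apply: continuous_subspaceT => x.
    exact/differentiable_continuous/derivable1_diffP.
  + by move=> x _; apply: DeriveDef => //; rewrite derive1E.
  + exact: continuous_subspaceT.
Qed.

(** The trapezoids approximate indicator functions of intervals; they produce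
    test functions without any convolution. *)
Definition ramp (t : R) : R := Num.min (Num.max t 0) 1.
Definition trapezoid a b e x : R := ramp ((x - a) / e + 1) - ramp ((x - b) / e).

Lemma ramp0 t : t <= 0 -> ramp t = 0.
Proof. by move=> t0; rewrite /ramp max_r// min_l. Qed.

Lemma ramp1 t : 1 <= t -> ramp t = 1.
Proof. by move=> t1; rewrite /ramp max_l ?min_r// (le_trans _ t1). Qed.

Lemma ramp01 t : 0 <= ramp t <= 1.
Proof. by rewrite /ramp le_min le_max lexx orbT ler01 ge_min lexx orbT. Qed.

Lemma ramp_continuous : continuous ramp.
Proof.
move=> t; apply: (@continuous_min _ _ (fun t : R => Num.max t 0) (fun=> 1)); last exact: cst_continuous.
by apply: (@continuous_max _ _ (fun t : R => t) (fun=> 0)); [exact: cvg_id|exact: cst_continuous].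
Qed.

Lemma trapezoid_continuous a b e : continuous (trapezoid a b e).
Proof.
move=> x; apply: (@continuousB _ _ _ (fun x => ramp ((x - a) / e + 1)) (fun x => ramp ((x - b) / e))).
  apply: continuous_comp; last exact: ramp_continuous.
  apply: (@continuousD _ _ _ (fun x : R => (x - a) / e) (fun=> 1)); last exact: cst_continuous.
  apply: (@continuousM _ _ (fun x : R => x - a) (fun=> e^-1)); last exact: cst_continuous.
  by apply: (@continuousB _ _ _ (fun x : R => x) (fun=> a)); [exact: cvg_id|exact: cst_continuous].
apply: continuous_comp; last exact: ramp_continuous.
apply: (@continuousM _ _ (fun x : R => x - b) (fun=> e^-1)); last exact: cst_continuous.
by apply: (@continuousB _ _ _ (fun x : R => x) (fun=> b)); [exact: cvg_id|exact: cst_continuous].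
Qed.

Lemma trapezoid_out a b e x : 0 < e -> a <= b -> x <= a - e \/ b + e <= x ->
  trapezoid a b e x = 0.
Proof.
move=> e0 ab [xa|bx]; rewrite /trapezoid.
  rewrite !ramp0 ?subrr//; first by rewrite pmulr_lle0 ?invr_gt0//; lra.
  by rewrite -lerBrDr sub0r ler_pdivrMr//; lra.
rewrite !ramp1 ?subrr//; first by rewrite ler_pdivlMr//; lra.
by rewrite lerDr divr_ge0// ?(ltW e0)//; lra.
Qed.

Lemma trapezoid_in a b e x : 0 < e -> a <= x -> x <= b -> trapezoid a b e x = 1.
Proof.
move=> e0 ax xb; rewrite /trapezoid ramp1 ?ramp0 ?subr0//.
  by rewrite pmulr_lle0 ?invr_gt0//; lra.
by rewrite lerDr divr_ge0// ?(ltW e0)//; lra.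
Qed.

Lemma trapezoid_ge0_le1 a b e x : 0 < e -> a <= b -> 0 <= trapezoid a b e x <= 1.
Proof.
move=> e0 ab; have [xb|/ltW bx] := leP x b.
  rewrite /trapezoid [X in _ - X]ramp0 ?subr0 ?ramp01//.
  by rewrite pmulr_lle0 ?invr_gt0//; lra.
rewrite /trapezoid ramp1; last by rewrite lerDr divr_ge0// ?(ltW e0)//; lra.
by have := ramp01 ((x - b) / e); lra.
Qed.

(** A fixed function of integral at least 1/3 supported in the interior, used to
    correct the mean of a function without changing it near 0 and 1. *)
Definition bump : R -> R := trapezoid (1 / 3) (2 / 3) (1 / 6).

Lemma bump_continuous : continuous bump.
Proof. exact: trapezoid_continuous. Qed.

Lemma bump_itg_ge : 1 / 3 <= itg bump 0 1.
Proof.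
have bi a b : L1 a b bump by apply/L1_continuous/continuous_subspaceT/trapezoid_continuous.
have b0 x : 0 <= bump x.
  by have /andP[] : 0 <= bump x <= 1 by apply: trapezoid_ge0_le1; lra.
have e : itg bump (1 / 3) (2 / 3) = 1 / 3.
  transitivity (itg (fun=> 1 : R) (1 / 3) (2 / 3)); last by rewrite itg_cst; lra.
  by apply: eq_itg => x /andP[x1 x2]; rewrite /bump trapezoid_in; [|lra|exact: ltW|exact: ltW].
rewrite (@itg_split _ bump 0 (1 / 3) 1); [|lra|lra|exact: bi].
rewrite (@itg_split _ bump (1 / 3) (2 / 3) 1); [|lra|lra|exact: bi].
have : 0 <= itg bump 0 (1 / 3) by apply: itg_ge0.
have : 0 <= itg bump (2 / 3) 1 by apply: itg_ge0.
lra.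
Qed.

Lemma small2 (x y : R) : 0 < x -> 0 < y -> exists r : R, [/\ 0 < r, r < x & r < y].
Proof.
move=> x0 y0; exists (Num.min x y / 2).
have : 0 < Num.min x y by rewrite lt_min x0.
have : Num.min x y <= x by rewrite ge_min lexx.
have : Num.min x y <= y by rewrite ge_min lexx orbT.
by split; lra.
Qed.

(** The integral of h against a trapezoid differs from its integral over [a, b]
    by the contribution of the two ramps, which is small since the indefinite
    integral of |h| is continuous. *)
Lemma trapezoid_itg_eq0 h a b : L1 0 1 h -> 0 < a -> a <= b -> b < 1 ->
  (forall e, 0 < e -> e < a -> b + e < 1 -> itg (fun x => h x * trapezoid a b e x) 0 1 = 0) ->
  itg h a b = 0.
Proof.
move=> hi a0 ab b1 H; have hn := L1_norm hi; have An := AC_itg hn.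
have cn := AC_continuous An.
apply/eqP; rewrite -normr_le0; apply/ler_addgt0Pl => e e0; rewrite addr0.
have e20 : 0 < e / 2 by rewrite divr_gt0.
have a01 : 0 <= a <= 1 by apply/andP; split; lra.
have b01 : 0 <= b <= 1 by apply/andP; split; lra.
have [d1 d10 H1] := within_cvgP cn a01 e20.
have [d2 d20 H2] := within_cvgP cn b01 e20.
have b10 : 0 < 1 - b by lra.
have [r1 [r10 r1a r1b]] := small2 a0 b10; have [r2 [r20 r2a r2b]] := small2 d10 d20.
have [r [r0 rr1 rr2]] := small2 r10 r20.
have ra : r < a := lt_trans rr1 r1a.
have rb : b + r < 1 by rewrite -ltrBrDl (lt_trans rr1).
have ar0 : 0 <= a - r by rewrite subr_ge0 ltW.
have ara : a - r <= a by rewrite gerBl ltW.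
have bbr : b <= b + r by rewrite lerDl ltW.
have b1' := ltW b1; have rb' := ltW rb.
have a1 := le_trans ab b1'; have b0 := le_trans (ltW a0) ab.
have cT := @trapezoid_continuous a b r.
have hT : L1 0 1 (fun x => h x * trapezoid a b r x).
  apply: eq_L1 (L1_mul_continuous (continuous_subspaceT cT) hi) => x _; exact: mulrC.
have := H r r0 ra rb.
rewrite (@itg_split _ _ 0 (a - r))//; last exact: le_trans ara a1.
rewrite itg0 ?add0r; last first.
  move=> x /andP[_ xa]; rewrite trapezoid_out ?mulr0//; left; exact: ltW.
rewrite (@itg_split _ _ (a - r) a)//; last exact: L1_sub hT.
rewrite (@itg_split _ _ a b)//; last exact: L1_sub (ltW a0) _ hT.
rewrite (@itg_split _ _ b (b + r))//; last exact: L1_sub hT.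
rewrite [X in _ + (_ + (_ + X))]itg0 ?addr0; last first.
  move=> x /andP[xb _]; rewrite trapezoid_out ?mulr0//; right; exact: ltW.
rewrite [X in _ + (X + _)](eq_itg (g := h)); last first.
  by move=> x /andP[ax xb]; rewrite trapezoid_in ?mulr1// ltW.
have small x : `|h x * trapezoid a b r x| <= `|h x|.
  have /andP[T0 T1] := trapezoid_ge0_le1 x r0 ab.
  by rewrite normrM ler_piMr// ger0_norm.
have A1 : `|itg (fun x => h x * trapezoid a b r x) (a - r) a| <= itg (fun x => `|h x|) (a - r) a.
  by apply: itg_norm_le; [exact: L1_sub hT|exact: L1_sub hn|exact: aeI_all].
have A2 : `|itg (fun x => h x * trapezoid a b r x) b (b + r)| <= itg (fun x => `|h x|) b (b + r).
  by apply: itg_norm_le; [exact: L1_sub hT|exact: L1_sub hn|exact: aeI_all].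
have ar01 : 0 <= a - r <= 1 by rewrite ar0 (le_trans ara).
have br01 : 0 <= b + r <= 1 by rewrite rb' (le_trans b0).
have B1 := H1 _ ar01; rewrite addrAC subrr add0r normrN gtr0_norm// in B1.
have B2 := H2 _ br01; rewrite addrAC subrr add0r gtr0_norm// in B2.
have {}B1 := B1 (lt_trans rr2 r2a); have {}B2 := B2 (lt_trans rr2 r2b).
move: An => [_ Ah]; rewrite Ah// in B2.
rewrite distrC Ah// in B1.
move: B1 B2 A1 A2.
set x1 := itg _ (a - r) a; set x2 := itg _ b (b + r); set x3 := itg _ (a - r) a.
set x4 := itg _ b (b + r) => B1 B2 A1 A2 E.
have -> : itg h a b = - (x3 + x4) by clear -E; lra.
clear -A1 A2 B1 B2; rewrite normrN (le_trans (ler_normD _ _))//.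
have := ler_norm x1; have := ler_norm x2; lra.
Qed.

(** The lemma of du Bois-Reymond. A trapezoid minus a multiple of [bump] has zero
    mean, hence is the derivative of a test function; so f - k is orthogonal to
    all trapezoids, where k is the mean of f weighted by [bump]. *)
Lemma du_bois_reymond f : L1 0 1 f ->
  (forall phi, C1c phi -> itg (fun x => f x * phi^`()%classic x) 0 1 = 0) ->
  exists k, aeI 0 1 (fun x => f x = k).
Proof.
move=> fi H.
have cT a b e := @trapezoid_continuous a b e.
have Ti a b e c d : L1 c d (trapezoid a b e) by apply/L1_continuous/continuous_subspaceT.
have fT a b e : L1 0 1 (fun x => f x * trapezoid a b e x).
  apply: eq_L1 (L1_mul_continuous (continuous_subspaceT (cT a b e)) fi) => x _; exact: mulrC.
pose m := itg bump 0 1; have m0 : 0 < m by rewrite /m; have := bump_itg_ge; lra.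
pose k := itg (fun x => f x * bump x) 0 1 / m.
have hi : L1 0 1 (fun x => f x - k) by apply: L1B => //; exact: L1_cst.
have main a b : 0 < a -> a <= b -> b < 1 -> itg (fun x => f x - k) a b = 0.
  move=> a0 ab b1; apply: trapezoid_itg_eq0 => // e e0 ea eb.
  pose t := itg (trapezoid a b e) 0 1 / m.
  pose psi x := trapezoid a b e x - t * bump x.
  have cpsi : continuous psi.
    move=> x; apply: (@continuousB _ _ _ (trapezoid a b e) (fun x => t * bump x)); first exact: cT.
    by apply: (@continuousM _ _ (fun=> t) bump); [exact: cst_continuous|exact: cT].
  have ae0 : 0 < a - e by lra.
  have be0 : 0 < 1 - b - e by lra.
  have [r [r0 rr1 rr2]] := small2 ae0 be0.
  have r60 : 0 < 1 / 6 :> R by lra.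
  have [d [d0 dr d6]] := small2 r0 r60.
  have [||phi Cphi dphi] := @C1c_primitive d psi d0 cpsi.
  - move=> x xd; rewrite /psi.
    have -> : trapezoid a b e x = 0.
      by apply: trapezoid_out => //; case: xd => ?; [left|right]; lra.
    have -> : bump x = 0.
      by apply: trapezoid_out; [lra|lra|case: xd => ?; [left|right]; lra].
    by rewrite mulr0 subrr.
  - rewrite /psi itgB; [|exact: Ti|exact/L1Z/Ti].
    rewrite itgZ; last exact: Ti.
    by rewrite -/m /t divfK ?subrr// gt_eqF.
  have E : itg (fun x => f x * trapezoid a b e x - t * (f x * bump x)) 0 1 = 0.
    by rewrite -[RHS](H phi Cphi) dphi; apply: eq_itg => x _; rewrite /psi; ring.
  rewrite itgB// ?itgZ// in E; [|exact/fT|exact/L1Z/fT].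
  rewrite (eq_itg (g := fun x => f x * trapezoid a b e x - k * trapezoid a b e x)); last first.
    by move=> x _; ring.
  rewrite itgB//; last by apply/L1Z/Ti.
  rewrite itgZ; last exact: Ti.
  by rewrite -[RHS]E; congr (_ - _); rewrite /k /t; field; rewrite gt_eqF.
exists k; have An := AC_itg hi; have cn := AC_continuous An.
pose F := itg (fun x => f x - k) 0.
have Fc x y : 0 < x -> x <= y -> y < 1 -> F y = F x.
  move=> x0 xy y1; apply/eqP; rewrite -subr_eq0; apply/eqP.
  by have [_ ->] := An; [rewrite main|exact: ltW| |exact: ltW].
have Fall x : 0 <= x <= 1 -> F x = F (1 / 2).
  move=> x01; apply/eqP; rewrite -subr_eq0 -normr_le0; apply/ler_addgt0Pl => e e0.
  rewrite addr0; have [d d0 Hd] := within_cvgP cn x01 e0.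
  have [r [r0 rd r4]] := small2 d0 (ltr01 : 0 < 1 :> R).
  have [y [y0 y1 yx]] : exists y : R, [/\ 0 < y, y < 1 & `|y - x| < d].
    have [x2|x2] := leP x (1 / 2).
      by exists (x + r / 2); rewrite addrAC subrr add0r; split; [lra|lra|rewrite gtr0_norm; lra].
    by exists (x - r / 2); rewrite addrAC subrr add0r normrN; split; [lra|lra|rewrite gtr0_norm; lra].
  have -> : F (1 / 2) = F y.
    have [y2|/ltW y2] := leP y (1 / 2); last by rewrite (Fc (1 / 2) y)//; lra.
    by rewrite (Fc y (1 / 2))//; lra.
  by rewrite distrC ltW// Hd// !ltW.
have := itg_eq0_all hi; move=> /(_ _)/wrap[].
  move=> x y x0 xy y1; have [_ <-] := An => //.
  by change (F y - F x = 0); rewrite !Fall ?subrr//; apply/andP; split; lra.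
by apply: aeI_imp => x _ /eqP; rewrite subr_eq0 => /eqP.
Qed.

Lemma weak_derivative_AC p g : AC 0 1 p g -> weak_derivative p g.
Proof.
move=> pg phi /C1c_props[p0 p1 A].
by have := AC_by_parts ler01 pg A; rewrite p0 p1 !mulr0 subrr sub0r /itg => ->;
  congr (- _); apply: eq_Rintegral => x _; exact: mulrC.
Qed.

Lemma C1c_L1 f phi : L1 0 1 f -> C1c phi ->
  L1 0 1 (fun x => f x * phi x) /\ L1 0 1 (fun x => f x * phi^`()%classic x).
Proof.
move=> fi Cphi; have [_ _ A] := C1c_props Cphi; have [_ cphi _ _] := Cphi.
split; apply: eq_L1 (L1_mul_continuous _ fi) => [x _|]; try exact: mulrC.
  exact: AC_continuous A.
exact: continuous_subspaceT.
Qed.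

(** The indefinite integral F of g - h has the weak derivative 0, so it is
    constant by du Bois-Reymond. *)
Lemma weak_derivative_unique u g h : L1 0 1 g -> L1 0 1 h ->
  weak_derivative u g -> weak_derivative u h -> aeI 0 1 (fun x => g x = h x).
Proof.
move=> gi hi ug uh; have di := L1B gi hi; have Ad := AC_itg di.
pose F := itg (fun x => g x - h x) 0.
have Fi : L1 0 1 F by apply/L1_continuous/(AC_continuous Ad).
have [phi Cphi|k Fk] := du_bois_reymond Fi.
  have := weak_derivative_AC Ad Cphi; rewrite -!/(itg _ 0 1) => ->.
  rewrite (eq_itg (g := fun x => g x * phi x - h x * phi x)); last by move=> x _; ring.
  have [gp _] := C1c_L1 gi Cphi; have [hp _] := C1c_L1 hi Cphi.
  rewrite itgB//; have := ug _ Cphi; have := uh _ Cphi; rewrite -!/(itg _ 0 1) => -> /eqP.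
  by rewrite eqr_opp => /eqP ->; rewrite subrr oppr0.
have cF := AC_continuous Ad.
have Fx := @continuous_ae_eq 0 1 F (fun=> k) ltr01 cF (continuous_subspaceT (@cst_continuous _ _ k)) Fk.
have := itg_eq0_all di; move=> /(_ _)/wrap[].
  move=> x y x0 xy y1; have [_ <-] := Ad => //.
  change (F y - F x = 0); rewrite (Fx y) ?(Fx x) ?subrr//.
    by rewrite x0 (le_trans xy y1).
  by rewrite (le_trans x0 xy).
by apply: aeI_imp => x _ /eqP; rewrite subr_eq0 => /eqP.
Qed.

(** The difference of u and the indefinite integral of g has the weak
    derivative 0. *)
Lemma weak_derivative_repr u g : L1 0 1 u -> L1 0 1 g -> weak_derivative u g ->
  exists2 p, AC 0 1 p g & aeI 0 1 (fun x => u x = p x).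
Proof.
move=> ui gi ug; have Ag := AC_itg gi.
have di : L1 0 1 (fun x => u x - itg g 0 x).
  by apply: L1B => //; apply/L1_continuous/(AC_continuous Ag).
have [phi Cphi|k Hk] := du_bois_reymond di.
  have [_ up] := C1c_L1 ui Cphi.
  have [_ gp] := C1c_L1 (L1_continuous (AC_continuous Ag)) Cphi.
  rewrite (eq_itg (g := fun x => u x * phi^`()%classic x - itg g 0 x * phi^`()%classic x)).
    rewrite itgB//; have := ug _ Cphi; have := weak_derivative_AC Ag Cphi.
    by rewrite -!/(itg _ 0 1) => -> ->; rewrite subrr.
  by move=> x _; ring.
exists (fun x => itg g 0 x + k).
  by apply: AC_eq_density (ACD Ag (AC_cst 0 1 k)) => x _; rewrite addr0.
by apply: aeI_imp Hk => x _ <-; rewrite addrC subrK.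
Qed.

Lemma weak_derivative_ae u v g : measurable_fun I u -> measurable_fun I v ->
  aeI 0 1 (fun x => u x = v x) -> weak_derivative u g -> weak_derivative v g.
Proof.
move=> mu1 mv uv ug phi Cphi; rewrite -(ug phi Cphi).
have [_ cphi _ _] := Cphi.
have mp : measurable_fun I (phi^`()%classic).
  by apply: continuous_itv_meas; exact: continuous_subspaceT.
rewrite -!/(itg _ 0 1); apply: ae_eq_itg; try exact: measurable_funM.
by apply: aeI_imp uv => x _ ->.
Qed.

Lemma wderivP u : (exists g, L2 g /\ weak_derivative u g) ->
  L2 (wderiv u) /\ weak_derivative u (wderiv u).
Proof. exact: xgetPex. Qed.

(** Weak derivatives being unique almost everywhere, the chosen one is the
    density of any absolutely continuous representative. *)
Lemma wderiv_ae u p g : measurable_fun I u -> aeI 0 1 (fun x => u x = p x) ->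
  AC 0 1 p g -> Q2 0 1 g ->
  [/\ Q2 0 1 (wderiv u), weak_derivative u (wderiv u) & aeI 0 1 (fun x => wderiv u x = g x)].
Proof.
move=> mu1 up pg gQ; have mp := continuous_itv_meas (AC_continuous pg).
have ug : weak_derivative u g.
  apply: weak_derivative_ae (weak_derivative_AC pg) => //.
  by apply: aeI_imp up => x _ ->.
have [/L2P wQ uw] : L2 (wderiv u) /\ weak_derivative u (wderiv u).
  by apply: wderivP; exists g; split=> //; exact/L2P.
split=> //; apply: weak_derivative_unique uw ug; exact: Q2_L1.
Qed.

End square_integrable.

(** * The space H(0, 1) *)

Section sobolev_representation.
Context {R : realType}.
Implicit Types (a b c d x y z k e : R) (f g h p q r u v w phi psi : R -> R).

(** The concrete description of H(0, 1): v is differentiable with an absolutely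
    continuous derivative p, whose density g is square integrable. *)
Definition rep v p g := [/\ AC 0 1 v p, AC 0 1 p g, Q2 0 1 g, v 0 = 0 & v 1 = 0].

Lemma wderiv2 v p g : AC 0 1 v p -> AC 0 1 p g -> Q2 0 1 g ->
  [/\ aeI 0 1 (fun x => wderiv v x = p x), aeI 0 1 (fun x => wderiv (wderiv v) x = g x),
      Q2 0 1 (wderiv v) & Q2 0 1 (wderiv (wderiv v))].
Proof.
move=> vp pg gQ; have cp := AC_continuous pg.
have mv := continuous_itv_meas (AC_continuous vp).
have [wQ vw wp] := wderiv_ae mv (aeI_all (fun x _ => erefl (v x))) vp (Q2_continuous cp).
have [w1 _] := wQ.
by have [w2Q _ wg] := wderiv_ae w1 wp pg gQ.
Qed.

Lemma AC_H1 v p : AC 0 1 v p -> Q2 0 1 p -> H1 v.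
Proof.
move=> vp pQ; split; first exact/L2P/Q2_continuous/(AC_continuous vp).
by exists p; split; [exact/L2P|exact: weak_derivative_AC].
Qed.

Lemma AC_H2 v p g : AC 0 1 v p -> AC 0 1 p g -> Q2 0 1 g -> H2 v.
Proof.
move=> vp pg gQ; have cp := AC_continuous pg; split; first exact: AC_H1 vp (Q2_continuous cp).
have [wp _ wQ _] := wderiv2 vp pg gQ; split; first exact/L2P.
exists g; split; first exact/L2P.
have [w1 _] := wQ.
apply: weak_derivative_ae (weak_derivative_AC pg) => //.
  exact: continuous_itv_meas.
by apply: aeI_imp wp => x _ ->.
Qed.

Lemma H2_repr v : {within `[0, 1], continuous v} -> H2 v ->
  exists p g, [/\ AC 0 1 v p, AC 0 1 p g & Q2 0 1 g].
Proof.
move=> cv [[/L2P vQ /wderivP[/L2P wQ vw]] [_ /wderivP[/L2P gQ wg]]].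
have [p pg wp] := weak_derivative_repr (Q2_L1 wQ) (Q2_L1 gQ) wg.
have [V Vw vV] := weak_derivative_repr (Q2_L1 vQ) (Q2_L1 wQ) vw.
have Vp := AC_ae (continuous_itv_meas (AC_continuous pg)) wp Vw.
exists p, (wderiv (wderiv v)); split=> //; apply: AC_eq Vp => x x01; apply/esym.
by move: x x01; apply: continuous_ae_eq => //; exact: AC_continuous Vw.
Qed.

Lemma abs_le_sq e x : 0 < e -> `|x| <= (e^-1 * x ^+ 2 + e) / 2.
Proof.
move=> e0; rewrite ler_pdivlMr// -subr_ge0.
have -> : e^-1 * x ^+ 2 + e - `|x| * 2 = e^-1 * (`|x| - e) ^+ 2.
  by rewrite sqrrB (real_normK (num_real x)) !mulrDr mulrN -mulrnAr expr2 mulKf ?gt_eqF//; field; rewrite gt_eqF.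
by rewrite mulr_ge0 ?invr_ge0 ?(ltW e0)// sqr_ge0.
Qed.

(** The trace inequality of H^1(0, 1): |v x| is at most the mean of |v| plus the
    integral of |p|, and both are estimated by means of 2 |y| <= y^2 / e + e. *)
Lemma trace_le v p e : 0 < e -> AC 0 1 v p -> Q2 0 1 p ->
  itg (fun x => v x ^+ 2 + p x ^+ 2) 0 1 <= e ^+ 2 ->
  forall x, 0 <= x <= 1 -> `|v x| <= 2 * e.
Proof.
move=> e0 vp pQ E x x01; have cv := AC_continuous vp.
have vQ := Q2_continuous cv.
have [[_ v2i] [_ p2i]] := (vQ, pQ); have vi := Q2_L1 vQ; have pi := Q2_L1 pQ.
have A1 : itg (fun x => `|v x|) 0 1 + itg (fun x => `|p x|) 0 1 <=
    itg (fun x => (e^-1 / 2) * (v x ^+ 2 + p x ^+ 2) + e) 0 1.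
  rewrite -itgD; [|exact: L1_norm|exact: L1_norm]; apply: itg_le.
  - by apply: L1D; exact: L1_norm.
  - by apply: L1D; [exact/L1Z/L1D|exact: L1_cst].
  - by move=> y _; have := abs_le_sq (v y) e0; have := abs_le_sq (p y) e0; lra.
have B : `|v x| <= itg (fun x => `|v x|) 0 1 + itg (fun x => `|p x|) 0 1.
  rewrite -[leLHS](mulr1 `|v x|) -[X in _ * X]subr0 -itg_cst//.
  rewrite -[X in _ + X]mulr1 -[X in _ + _ * X]subr0 -[X in _ + X]itg_cst// -itgD; last 2 first.
  - exact: L1_norm.
  - exact: L1_cst.
  apply: itg_le; [exact: L1_cst|by apply: L1D; [exact: L1_norm|exact: L1_cst]|].
  move=> y /andP[y0 y1].
  have key s t : 0 <= s -> s <= t -> t <= 1 -> `|v t - v s| <= itg (fun x => `|p x|) 0 1.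
    move=> s0 st t1; have [_ ->] := vp => //.
    have pn := L1_norm pi.
    apply: (@le_trans _ _ (itg (fun x => `|p x|) s t)).
      apply: itg_norm_le; [exact: L1_sub pi|exact: L1_sub pn|exact: aeI_all].
    rewrite (@itg_split _ _ 0 s)//; last exact: le_trans t1.
    rewrite (@itg_split _ _ s t 1)//; last exact: L1_sub pn.
    by rewrite addrCA lerDl addr_ge0// itg_ge0.
  have {}key : `|v x - v y| <= itg (fun x => `|p x|) 0 1.
    case/andP: x01 => x0 x1; have [xy|/ltW yx] := leP x y.
      by rewrite distrC key// ltW.
    by rewrite key// ltW.
  have := ler_normD (v y) (v x - v y); rewrite addrC subrK; lra.
apply: (le_trans B); apply: (le_trans A1).
rewrite itgD; [|exact/L1Z/L1D|exact: L1_cst].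
rewrite itgZ; last exact: L1D.
rewrite itg_cst// subr0 mulr1.
have : e^-1 / 2 * itg (fun x => v x ^+ 2 + p x ^+ 2) 0 1 <= e^-1 / 2 * e ^+ 2.
  by rewrite ler_wpM2l// divr_ge0// invr_ge0 ltW.
have -> : e^-1 / 2 * e ^+ 2 = e / 2 by field; rewrite gt_eqF.
lra.
Qed.

Lemma H1normE v p : AC 0 1 v p -> Q2 0 1 p ->
  H1norm v = Num.sqrt (itg (fun x => v x ^+ 2 + p x ^+ 2) 0 1).
Proof.
move=> vp pQ; have mv := continuous_itv_meas (AC_continuous vp).
have [[wm _] _ wp] := wderiv_ae mv (aeI_all (fun x _ => erefl (v x))) vp pQ.
have [pm _] := pQ.
congr Num.sqrt; apply: ae_eq_itg.
- by apply: measurable_funD; exact: measurable_funX.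
- by apply: measurable_funD; exact: measurable_funX.
- by apply: aeI_imp wp => x _ ->.
Qed.

Lemma C1c_AC_sub v p phi : AC 0 1 v p -> Q2 0 1 p -> C1c phi ->
  AC 0 1 (v \- phi) (fun x => p x - phi^`()%classic x) /\
  Q2 0 1 (fun x => p x - phi^`()%classic x).
Proof.
move=> vp pQ Cphi; have [_ _ A] := C1c_props Cphi; have [_ c _ _] := Cphi.
by split; [exact: ACB|apply: Q2B => //; apply: Q2_continuous; exact: continuous_subspaceT].
Qed.

(** Test functions vanish at 0 and 1, and evaluation at a point is continuous for
    the H^1 norm. *)
Lemma H10_boundary v p : AC 0 1 v p -> Q2 0 1 p -> H10 v -> v 0 = 0 /\ v 1 = 0.
Proof.
move=> vp pQ [_ H].
have key x : 0 <= x <= 1 -> (forall phi, C1c phi -> phi x = 0) -> v x = 0.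
  move=> x01 phi0; apply/eqP; rewrite -normr_le0; apply/ler_addgt0Pl => e e0.
  rewrite addr0; have e20 : 0 < e / 2 by rewrite divr_gt0.
  have [phi Cphi He] := H _ e20.
  have [A Q] := C1c_AC_sub vp pQ Cphi.
  have := @trace_le _ _ (e / 2) e20 A Q; rewrite mulrCA divff// mulr1.
  move=> T; suff E : itg (fun x => (v \- phi) x ^+ 2 + (p x - phi^`()%classic x) ^+ 2) 0 1 <= (e / 2) ^+ 2.
    by have := T E x x01; rewrite /= (phi0 _ Cphi) subr0.
  move: He; rewrite (H1normE A Q) => He.
  rewrite -[leLHS]sqr_sqrtr; last by apply: itg_ge0 => y _; rewrite addr_ge0 ?sqr_ge0.
  by rewrite lerXn2r// ?nnegrE ?sqrtr_ge0// ltW.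
by split; apply: key; rewrite ?lexx ?ler01// => phi /C1c_props[].
Qed.

Lemma H_rep v : H v -> exists p g, rep v p g.
Proof.
move=> [cv Hv Hv0]; have [p [g [vp pg gQ]]] := H2_repr cv Hv; exists p, g.
by have [v0 v1] := H10_boundary vp (Q2_continuous (AC_continuous pg)) Hv0.
Qed.

(** Composition with the retraction of the line onto [0, 1] extends a function
    continuous on [0, 1] to a continuous function. *)
Definition clamp (x : R) : R := Num.max 0 (Num.min x 1).

Lemma clamp_id x : 0 <= x <= 1 -> clamp x = x.
Proof. by move=> /andP[x0 x1]; rewrite /clamp min_l// max_r. Qed.

Lemma clamp01 x : 0 <= clamp x <= 1.
Proof. by rewrite /clamp le_max lexx/= ge_max ler01 ge_min lexx orbT. Qed.

Lemma clamp_lip x y : `|clamp x - clamp y| <= `|x - y|.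
Proof.
rewrite /clamp !maxEle !minEle; do !case: ifPn; rewrite -?ltNge ?ler_norml => *;
  have := ler_norm (x - y); have := ler_norm (y - x); rewrite (distrC y x) => *; apply/andP; split; lra.
Qed.

Lemma clamp_continuous f : {within `[0, 1], continuous f} -> continuous (f \o clamp).
Proof.
move=> cf x; apply/cvgrPdist_lt => e e0.
have [d d0 H] := within_cvgP cf (clamp01 x) e0.
apply/nbhs_ballP; exists d => // y; rewrite /ball/= => xy.
rewrite distrC; apply: H; first exact: clamp01.
by apply: le_lt_trans (clamp_lip _ _) _; rewrite distrC.
Qed.

Lemma trapezoid_near1 d : 0 < d -> d < 1 / 4 ->
  itg (fun x => 1 - trapezoid (2 * d) (1 - 2 * d) d x) 0 1 <= 4 * d.
Proof.
move=> d0 d4; set T := trapezoid _ _ _.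
have d12 : 2 * d <= 1 - 2 * d by lra.
have cT : continuous T by exact: trapezoid_continuous.
have i a b : L1 a b (fun x => 1 - T x).
  by apply: L1B; [exact: L1_cst|apply/L1_continuous/continuous_subspaceT].
have T01 x : 0 <= 1 - T x <= 1.
  by have := @trapezoid_ge0_le1 _ (2 * d) (1 - 2 * d) d x d0 d12; rewrite -/T; lra.
rewrite (@itg_split _ _ 0 (2 * d)); [|lra|lra|exact: i].
rewrite (@itg_split _ _ (2 * d) (1 - 2 * d)); [|lra|lra|exact: i].
rewrite [X in _ + (X + _)]itg0 ?add0r; last first.
  by move=> x /andP[x1 x2]; rewrite /T trapezoid_in ?subrr// ltW.
have bnd a b : a <= b -> itg (fun x => 1 - T x) a b <= b - a.
  move=> ab; rewrite -[leRHS]mul1r -itg_cst//; apply: itg_le => //; first exact: L1_cst.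
  by move=> x _; case/andP: (T01 x).
have b1 := bnd 0 (2 * d) ltac:(lra); have b2 := bnd (1 - 2 * d) 1 ltac:(lra); lra.
Qed.

(** The derivative p of v has zero mean; cutting it off near 0 and 1 and
    correcting the mean by a small bump gives the derivative of a test function. *)
Lemma rep_H10 v p g : rep v p g -> H10 v.
Proof.
move=> [vp pg gQ v0 v1]; have cp := AC_continuous pg; have pQ := Q2_continuous cp.
have pi := Q2_L1 pQ; have [K K0 pK] := continuous_itv_bounded cp.
split; first exact: AC_H1 vp pQ.
move=> e e0.
have cbump := @bump_continuous R.
have bumpi a b : L1 a b bump by apply/L1_continuous/continuous_subspaceT.
have bump01 x : 0 <= bump x <= 1 by apply: trapezoid_ge0_le1; lra.
pose m : R := itg bump 0 1; have m3 : 1 / 3 <= m by exact: bump_itg_ge.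
have m0 : 0 < m by lra.
(* A bounds the integral of |p| (1 - T), where T is the cut-off;
   34 = 16 + 2 * 9 comes from the bounds 4 A of |v - phi| and 3 A of |c|. *)
have [A [A0 A1 Ae]] : exists A : R, [/\ 0 < A, A <= 1 & 2 * K * A + 34 * A ^+ 2 < e ^+ 2].
  have P0 : 0 < e ^+ 2 / (2 * K + 34) by rewrite divr_gt0 ?exprn_gt0//; lra.
  have [r [r0 r1 re]] := small2 (ltr01 : 0 < 1 :> R) P0; exists r; split=> //; first exact: ltW.
  rewrite ltr_pdivlMr in re; last by lra.
  apply: le_lt_trans re; rewrite expr2; nra.
pose d0 := A / (4 * K); have d00 : 0 < d0 by rewrite divr_gt0// mulr_gt0.
have [d [dpos dd0 d4]] := small2 d00 (ltac:(lra) : 0 < 1 / 4 :> R).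
have dA : 4 * K * d <= A.
  by move: dd0; rewrite /d0 ltr_pdivlMr ?mulr_gt0// mulrC => /ltW.
pose T := trapezoid (2 * d) (1 - 2 * d) d.
have cT : continuous T by exact: trapezoid_continuous.
have T01 x : 0 <= T x <= 1 by apply: trapezoid_ge0_le1 => //; lra.
have Ti a b : L1 a b T by apply/L1_continuous/continuous_subspaceT.
have pTi : L1 0 1 (fun x => p x * T x) by apply: L1_mul_continuous => //; exact: Ti.
pose c := itg (fun x => p x * T x) 0 1 / m.
have p1T : L1 0 1 (fun x => p x * (1 - T x)).
  by apply: L1_mul_continuous => //; apply: L1B; [exact: L1_cst|exact: Ti].
have mean0 : itg p 0 1 = 0 by have [_ <-] := vp; rewrite ?v0 ?v1 ?subrr.
have p1Tn : itg (fun x => `|p x * (1 - T x)|) 0 1 <= A.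
  apply: (@le_trans _ _ (K * itg (fun x => 1 - T x) 0 1)); last first.
    apply: le_trans dA; rewrite (mulrC 4) -mulrA ler_pM2l//; exact: trapezoid_near1.
  rewrite -itgZ; last by apply: L1B; [exact: L1_cst|exact: Ti].
  apply: itg_le; [exact: L1_norm|by apply/L1Z/L1B; [exact: L1_cst|exact: Ti]|].
  move=> x /andP[x0 x1]; rewrite normrM (@ger0_norm _ (1 - T x)); last by case/andP: (T01 x) => *; rewrite subr_ge0.
  by have /andP[t0 t1] := T01 x; rewrite ler_wpM2r ?subr_ge0// pK// !ltW.
have cA : `|c| <= 3 * A.
  rewrite /c normrM normfV (gtr0_norm m0) ler_pdivrMr//.
  have -> : itg (fun x => p x * T x) 0 1 = - itg (fun x => p x * (1 - T x)) 0 1.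
    rewrite -[LHS]subr0 -[X in _ - X]mean0 -itgB// -itgN//; apply: eq_itg => x _; ring.
  rewrite normrN (@le_trans _ _ A)//.
    by apply: le_trans p1Tn; apply: itg_norm_le => //; [exact: L1_norm|exact: aeI_all].
  by rewrite mulrAC mulrC ler_peMr ?(ltW A0)//; lra.
pose pc := p \o clamp; have cpc : continuous pc by exact: clamp_continuous.
pose psi x := pc x * T x - c * bump x.
have cpsi : continuous psi.
  move=> x; apply: (@continuousB _ _ _ (fun x => pc x * T x) (fun x => c * bump x)).
    by apply: (@continuousM _ _ pc T); [exact: cpc|exact: cT].
  by apply: (@continuousM _ _ (fun=> c) bump); [exact: cst_continuous|exact: cbump].
have psiE x : 0 <= x <= 1 -> psi x = p x * T x - c * bump x.
  by move=> x01; rewrite /psi /pc /= clamp_id.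
have md0 : 0 < Num.min d (1 / 6) by rewrite lt_min dpos; lra.
have [||phi Cphi dphi] := @C1c_primitive _ (Num.min d (1 / 6)) psi md0 cpsi.
- move=> x xd; rewrite /psi.
  have md : Num.min d (1 / 6) <= d by rewrite ge_min lexx.
  have m6 : Num.min d (1 / 6) <= 1 / 6 by rewrite ge_min lexx orbT.
  have -> : T x = 0.
    by apply: trapezoid_out => //; [lra|case: xd => ?; [left|right]; lra].
  have -> : bump x = 0.
    by apply: trapezoid_out; [lra|lra|case: xd => ?; [left|right]; lra].
  by rewrite !mulr0 subrr.
- rewrite (eq_itg (g := fun x => p x * T x - c * bump x)); last first.
    by move=> x /andP[x0 x1]; apply: psiE; rewrite !ltW.
  rewrite itgB//; last exact/L1Z/bumpi.
  rewrite itgZ; last exact: bumpi.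
  by rewrite -/m /c divfK ?subrr// gt_eqF.
exists phi => //; have [D DQ] := C1c_AC_sub vp pQ Cphi.
rewrite (H1normE D DQ) dphi.
pose dl x := p x * (1 - T x) + c * bump x.
have dlE x : 0 < x < 1 -> p x - psi x = dl x.
  by move=> /andP[x0 x1]; rewrite psiE ?ltW// /dl; ring.
have dli : L1 0 1 dl by apply: L1D => //; exact/L1Z/bumpi.
rewrite dphi in D DQ; have {}D := AC_eq_density dlE D.
have sup x : 0 <= x <= 1 -> `|(v \- phi) x| <= 4 * A.
  move=> /andP[x0 x1].
  have [f0 _ _] := C1c_props Cphi.
  have -> : (v \- phi) x = itg dl 0 x.
    by have [_ <-] := D => //=; rewrite f0 v0; ring.
  apply: (@le_trans _ _ (itg (fun x => `|p x * (1 - T x)| + `|c|) 0 1)).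
    have bi : L1 0 1 (fun x => `|p x * (1 - T x)| + `|c|) by apply: L1D; [exact: L1_norm|exact: L1_cst].
    apply: (@le_trans _ _ (itg (fun x => `|p x * (1 - T x)| + `|c|) 0 x)).
      apply: itg_norm_le; [exact: L1_sub dli|exact: L1_sub bi|apply: aeI_all => y _].
      rewrite /dl (le_trans (ler_normD _ _))// lerD2l normrM ler_piMr//.
      by have /andP[h0 h1] := bump01 y; rewrite ger0_norm.
    by rewrite (@itg_split _ _ 0 x 1)// lerDl itg_ge0// => y _; rewrite addr_ge0.
  rewrite itgD; [|exact: L1_norm|exact: L1_cst].
  by rewrite itg_cst// subr0 mulr1; lra.
have E : itg (fun x => (v \- phi) x ^+ 2 + (p x - psi x) ^+ 2) 0 1 <= 2 * K * A + 34 * A ^+ 2.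
  have [_ d2i] := DQ; have [_ v2i] := Q2_continuous (AC_continuous D).
  apply: (@le_trans _ _ (itg (fun x => 2 * K * `|p x * (1 - T x)| + 34 * A ^+ 2) 0 1)).
    apply: itg_le; [exact: L1D|by apply: L1D; [exact/L1Z/L1_norm|exact: L1_cst]|].
    move=> x /andP[x0 x1]; rewrite dlE ?x0// /dl.
    have s1 : (v \- phi) x ^+ 2 <= 16 * A ^+ 2.
      have H1 : `|(v \- phi) x| <= 4 * A by apply: sup; rewrite !ltW.
      rewrite -(real_normK (num_real ((v \- phi) x))).
      by have := normr_ge0 ((v \- phi) x); nra.
    have s2 : (c * bump x) ^+ 2 <= 9 * A ^+ 2.
      rewrite -(real_normK (num_real (c * bump x))).
      have : `|c * bump x| <= 3 * A.
        apply: le_trans cA; rewrite normrM ler_piMr//.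
        by have /andP[h0 h1] := bump01 x; rewrite ger0_norm.
      by have := normr_ge0 (c * bump x); nra.
    have s3 : (p x * (1 - T x)) ^+ 2 <= K * `|p x * (1 - T x)|.
      rewrite -(real_normK (num_real (p x * (1 - T x)))) expr2 ler_wpM2r//.
      have /andP[t0 t1] := T01 x.
      rewrite normrM (@le_trans _ _ `|p x|)//; last by rewrite pK// !ltW.
      by rewrite ler_piMr// ger0_norm; lra.
    have := sqr_ge0 (p x * (1 - T x) - c * bump x).
    set a1 := p x * (1 - T x) in s3 *; set a2 := c * bump x in s2 *; nra.
  rewrite itgD; [|exact/L1Z/L1_norm|exact: L1_cst].
  rewrite itgZ; last exact: L1_norm.
  rewrite itg_cst// subr0 mulr1 lerD2r ler_wpM2l//; lra.
rewrite -(ger0_norm (ltW e0)) -sqrtr_sqr ltr_sqrt ?exprn_gt0//.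
exact: le_lt_trans Ae.
Qed.

Lemma rep_H v p g : rep v p g -> H v.
Proof.
move=> vpg; have [vp pg gQ v0 v1] := vpg; split.
- exact: AC_continuous vp.
- exact: AC_H2 vp pg gQ.
- exact: rep_H10 vpg.
Qed.

End sobolev_representation.

(** * Reflections *)

Section reflection.
Context {R : realType}.
Implicit Types (a b c x y z : R) (f g h p q r u v w phi psi : R -> R).

Notation mu := (@lebesgue_measure R).

Definition reflect c : R -> measurableTypeR R := fun x => c - x.

Lemma reflect_measurable c : measurable_fun setT (reflect c).
Proof.
apply: continuous_measurable_fun => x.
by apply: (@continuousB _ _ _ (fun=> c) (fun x : R => x)); [exact: cst_continuous|exact: cvg_id].
Qed.

Lemma lebesgue_measure_reflect c (A : set R) : measurable A ->
  pushforward mu (reflect c) A = mu A.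
Proof.
move=> mA; apply/esym/lebesgue_measure_unique => //=.
  exact: reflect_measurable.
move=> mr _ [[a b]] _ <-.
rewrite /pushforward (_ : _ @^-1` _ = `[c - b, c - a[%classic); last first.
  apply/seteqP; split=> x; rewrite /reflect /= !in_itv/= => /andP[H1 H2]; apply/andP; split; lra.
rewrite !lebesgue_measure_itv/= !lte_fin (_ : (c - b < c - a) = (a < b)); last first.
  by apply/idP/idP; lra.
by case: ifP => // _; rewrite -!EFinD; congr (_%:E); ring.
Qed.

Lemma preimage_reflect a b c : reflect c @^-1` `]a, b[ = `]c - b, c - a[%classic.
Proof.
apply/seteqP; split=> x; rewrite /reflect /= !in_itv/= => /andP[H1 H2]; apply/andP; split; lra.
Qed.

Lemma itg_reflect a b c f : L1 a b f ->
  L1 (c - b) (c - a) (fun x => f (c - x)) /\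
  itg (fun x => f (c - x)) (c - b) (c - a) = itg f a b.
Proof.
move=> fi; pose f0 := EFin \o (f \_ `]a, b[).
have fT : mu.-integrable setT f0 := L1_restrict fi.
have mf0 : measurable_fun setT f0 by exact: measurable_int fT.
have eqf x : c - b < x < c - a -> (f \_ `]a, b[) (c - x) = f (c - x).
  by move=> /andP[H1 H2]; rewrite patchE mem_set//= in_itv/=; apply/andP; split; lra.
have mcomp : measurable_fun setT (f0 \o reflect c).
  by apply: measurableT_comp => //; exact: reflect_measurable.
have int0 : mu.-integrable (reflect c @^-1` `]a, b[) (f0 \o reflect c).
  apply/integrableP; split; first by apply: measurable_funS mcomp.
  have mab : measurable_fun `]a, b[ (abse \o f0).
    by apply: measurableT_comp => //; apply: measurable_funS mf0.
  have E : (\int[mu]_(x in reflect c @^-1` `]a, b[) ((abse \o f0) \o reflect c) x =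
            \int[mu]_(x in `]a, b[) (abse \o f0) x)%E.
    rewrite -ge0_integral_pushforward//; [|exact: reflect_measurable|by move=> y _; exact: abse_ge0].
    by apply: eq_measure_integral => [|? B mB _]; [exact: reflect_measurable|exact: lebesgue_measure_reflect].
  rewrite /comp /= in E *; rewrite E.
  by have /integrableP[_] : mu.-integrable `]a, b[ f0 by exact: integrableS fT.
have E : (\int[mu]_(x in reflect c @^-1` `]a, b[) (f0 \o reflect c) x =
          \int[mu]_(x in `]a, b[) f0 x)%E.
  rewrite -integral_pushforward//; [|exact: reflect_measurable].
  by apply: eq_measure_integral => [|? B mB _]; [exact: reflect_measurable|exact: lebesgue_measure_reflect].
rewrite preimage_reflect in int0 E; split.
  by apply: (@eq_L1 _ _ _ ((f \_ `]a, b[) \o reflect c)) => // x /eqf.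
rewrite (eq_itg (g := (f \_ `]a, b[) \o reflect c)); last by move=> x /eqf.
rewrite /itg /Rintegral; congr fine; rewrite /= in E *; rewrite E.
by apply: eq_integral => x xab; rewrite /f0 /= patchE xab.
Qed.

Lemma AC_reflect a b c p g : AC a b p g ->
  AC (c - b) (c - a) (fun x => p (c - x)) (fun x => - g (c - x)).
Proof.
move=> [gi H]; have [ri _] := itg_reflect c gi; split; first exact: L1N.
move=> x y ax xy yb; rewrite itgN; last exact: L1_sub ri.
have gi' : L1 (c - y) (c - x) g by apply: L1_sub gi; lra.
have [_ E] := itg_reflect c gi'; rewrite !subKr in E.
by rewrite E -H; [ring|lra|lra|lra].
Qed.

End reflection.

(** * The fourth root of 1 + t^2 *)

Section quartic_root.
Context {R : realType}.
Implicit Types (t x y : R).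

(** All the powers of 1 + p^2 in the energy and its first variation are integer
    powers of this root, which makes them accessible to polynomial algebra. *)
Definition qroot t : R := Num.sqrt (Num.sqrt (1 + t ^+ 2)).

Lemma one_sqr_gt0 t : 0 < 1 + t ^+ 2.
Proof. by rewrite ltr_wpDr ?sqr_ge0. Qed.

Lemma qroot_gt0 t : 0 < qroot t.
Proof. by rewrite !sqrtr_gt0 one_sqr_gt0. Qed.

Lemma qroot_neq0 t : qroot t != 0.
Proof. by rewrite gt_eqF ?qroot_gt0. Qed.

Lemma qroot2 t : qroot t ^+ 2 = Num.sqrt (1 + t ^+ 2).
Proof. by rewrite sqr_sqrtr// sqrtr_ge0. Qed.

Lemma qroot4 t : qroot t ^+ 4 = 1 + t ^+ 2.
Proof. by rewrite (exprM _ 2 2) qroot2 sqr_sqrtr// ltW// one_sqr_gt0. Qed.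

Lemma qroot_ge1 t : 1 <= qroot t.
Proof.
have : 1 ^+ 4 <= qroot t ^+ 4 by rewrite expr1n qroot4 lerDl sqr_ge0.
by rewrite ler_pXn2r// nnegrE ?ler01// ltW// qroot_gt0.
Qed.

Lemma qrootN t : qroot (- t) = qroot t.
Proof. by rewrite /qroot sqrrN. Qed.

Lemma qroot_powR t n (a : R) : a = n%:R / 4 -> (1 + t ^+ 2) `^ a = qroot t ^+ n.
Proof.
move=> ->; rewrite -qroot4 -powR_mulrn ?ltW ?qroot_gt0// -powRrM.
by rewrite mulrCA divff ?mulr1 ?powR_mulrn ?ltW ?qroot_gt0.
Qed.

Lemma is_derive_qroot t : is_derive t 1 qroot (t / (2 * qroot t ^+ 3)).
Proof.
have d1 : is_derive t 1 (fun x => 1 + x ^+ 2) (2 * t).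
  apply: der_eq (derD (der_cst 1 t) (derX 1 (der_id t))) _; rewrite expr1; ring.
apply: der_eq (der_sqrt _ (der_sqrt _ d1)) _; rewrite ?sqrtr_gt0 ?one_sqr_gt0//.
rewrite -/(qroot t) -qroot2; field; exact: qroot_neq0.
Qed.

Lemma qroot_continuous : continuous qroot.
Proof.
apply: cont_sqrt; apply: cont_sqrt; apply: contD; first exact: cont_cst.
exact: exprn_continuous.
Qed.

Lemma qroot_pow_continuous n : continuous (fun t => qroot t ^+ n).
Proof.
exact/contX/qroot_continuous.
Qed.

Lemma qrootV_continuous n : continuous (fun t => (qroot t ^+ n)^-1).
Proof.
by apply: contV; [move=> t; rewrite expf_neq0 ?qroot_neq0|exact: qroot_pow_continuous].
Qed.

Lemma qroot_invX_le1 t n : (qroot t ^+ n)^-1 <= 1.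
Proof. by rewrite invf_le1 ?exprn_ege1 ?exprn_gt0 ?qroot_gt0 ?qroot_ge1. Qed.

End quartic_root.

(** * The energy and its first variation on the half interval *)

Section energy.
Context {R : realType}.
Implicit Types (a b c x y z : R) (f g h p q r u v w phi psi : R -> R).

Definition energy_density p g x := g x ^+ 2 / qroot (p x) ^+ 10.

Definition variation_density p g r q x :=
  2 * (g x * q x / qroot (p x) ^+ 10) -
  5 * (g x ^+ 2 * p x * r x / qroot (p x) ^+ 14).

Lemma measurable_qrootV a b n p : measurable_fun `]a, b[ p ->
  measurable_fun `]a, b[ (fun x => (qroot (p x) ^+ n)^-1).
Proof.
move=> mp; apply: (@measurableT_comp _ _ _ _ _ _ (fun t : R => (qroot t ^+ n)^-1)) mp.
by apply: continuous_measurable_fun; exact: qrootV_continuous.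
Qed.

Lemma energy_density_L1 a b p g : measurable_fun `]a, b[ p -> Q2 a b g ->
  L1 a b (energy_density p g).
Proof.
move=> mp [mg gi].
apply: (@eq_L1 _ _ _ (fun x => (qroot (p x) ^+ 10)^-1 * g x ^+ 2)).
  by move=> x _; rewrite mulrC.
apply: (@L1_mul_bounded _ _ _ 1) gi; first exact: measurable_qrootV.
by move=> x _; rewrite ger0_norm ?qroot_invX_le1// invr_ge0 exprn_ge0// ltW// qroot_gt0.
Qed.

Lemma variation_density_meas a b p g r q : measurable_fun `]a, b[ p ->
  measurable_fun `]a, b[ g -> measurable_fun `]a, b[ r -> measurable_fun `]a, b[ q ->
  measurable_fun `]a, b[ (variation_density p g r q).
Proof.
move=> mp mg mr mq.
have m1 := measurable_funM (measurable_funM mg mq) (measurable_qrootV 10 mp).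
have m2 := measurable_funM (measurable_funM (measurable_funM (measurable_funX 2 mg) mp) mr)
  (measurable_qrootV 14 mp).
have k k' : measurable_fun `]a, b[ (fun _ : R => k' : R) by exact: measurable_cst.
exact: measurable_funB (measurable_funM (k 2) m1) (measurable_funM (k 5) m2).
Qed.

Lemma variation_density_L1 a b p g r q : {within `[a, b], continuous p} ->
  {within `[a, b], continuous r} -> Q2 a b g -> Q2 a b q ->
  L1 a b (variation_density p g r q).
Proof.
move=> cp cr gQ qQ; have [_ gi] := gQ.
have cV n : {within `[a, b], continuous (fun x => (qroot (p x) ^+ n)^-1)}.
  by apply: (@within_comp _ _ _ (fun t => (qroot t ^+ n)^-1)) cp; exact: qrootV_continuous.
apply: L1B; apply: L1Z.
  apply: (@eq_L1 _ _ _ (fun x => (qroot (p x) ^+ 10)^-1 * (g x * q x))).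
    by move=> x _; rewrite mulrC.
  exact/L1_mul_continuous/Q2_L1M.
apply: (@eq_L1 _ _ _ (fun x => (p x * r x * (qroot (p x) ^+ 14)^-1) * g x ^+ 2)).
  by move=> x _; ring.
by apply: L1_mul_continuous gi; apply: contM; [exact: contM|exact: cV].
Qed.

Lemma W_itg v p g : AC 0 1 v p -> AC 0 1 p g -> Q2 0 1 g ->
  W v = itg (energy_density p g) 0 1.
Proof.
move=> vp pg gQ; have [wp wg [mw _] w2Q] := wderiv2 vp pg gQ; have [mw2 _] := w2Q.
have mp := continuous_itv_meas (AC_continuous pg).
transitivity (itg (energy_density (wderiv v) (wderiv (wderiv v))) 0 1).
  apply: eq_Rintegral => x _; rewrite /energy_density.
  rewrite (@qroot_powR _ _ 6); last by field.
  rewrite -qroot2; field; exact: qroot_neq0.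
apply: ae_eq_itg; [by apply: L1_meas; apply: energy_density_L1|by apply: L1_meas; apply: energy_density_L1|].
apply: (@aeI_imp _ _ _ _ _ _ (aeI_and wp wg)) => x _ [E1 E2].
by rewrite /energy_density E1 E2.
Qed.

Lemma dW_itg v p g phi r q : AC 0 1 v p -> AC 0 1 p g -> Q2 0 1 g ->
  AC 0 1 phi r -> AC 0 1 r q -> Q2 0 1 q ->
  dW v phi = itg (variation_density p g r q) 0 1.
Proof.
move=> vp pg gQ phir rq qQ.
have [wp wg [mw _] [mw2 _]] := wderiv2 vp pg gQ.
have [zr zq [mz _] [mz2 _]] := wderiv2 phir rq qQ.
have cp := AC_continuous pg; have cr := AC_continuous rq.
transitivity (itg (variation_density (wderiv v) (wderiv (wderiv v))
                     (wderiv phi) (wderiv (wderiv phi))) 0 1).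
  apply: eq_Rintegral => x _; rewrite /variation_density.
  rewrite (@qroot_powR _ _ 10); last by field.
  by rewrite (@qroot_powR _ _ 14)//; field.
apply: ae_eq_itg.
- exact: variation_density_meas.
- by apply: L1_meas; apply: variation_density_L1.
- apply: (@aeI_imp _ _ _ _ _ _ (aeI_and (aeI_and wp wg) (aeI_and zr zq))) => x _ [[E1 E2] [E3 E4]].
  by rewrite /variation_density E1 E2 E3 E4.
Qed.

Definition symmetric v := forall x, 0 <= x <= 1 / 2 -> v x = v (1 - x).

Lemma symmetricE v : symmetric v -> forall x, 0 <= x <= 1 -> v x = v (1 - x).
Proof.
move=> S x /andP[x0 x1]; have [xh|xh] := leP x (1 / 2); first by rewrite S ?x0.
by rewrite [RHS]S ?subKr//; apply/andP; split; lra.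
Qed.

Lemma AC_reflect01 p g : AC 0 1 p g ->
  AC 0 1 (fun x => p (1 - x)) (fun x => - g (1 - x)).
Proof. by move=> /(AC_reflect 1); rewrite subrr subr0. Qed.

Lemma symmetric_derivatives v p g : AC 0 1 v p -> AC 0 1 p g -> symmetric v ->
  (forall x, 0 <= x <= 1 -> p (1 - x) = - p x) /\ aeI 0 1 (fun x => g (1 - x) = g x).
Proof.
move=> vp pg S; have cp := AC_continuous pg.
have A1 : AC 0 1 v (fun x => - p (1 - x)).
  by apply: AC_eq (AC_reflect01 vp) => x x01; rewrite -symmetricE.
have rp := AC_reflect01 pg.
have E1 : forall x, 0 <= x <= 1 -> p x = - p (1 - x).
  apply: continuous_ae_eq => //; last exact: AC_density_unique vp A1.
  by apply: contN; exact: AC_continuous rp.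
split; first by move=> x x01; rewrite [in RHS]E1// opprK.
have A2 : AC 0 1 p (fun x => g (1 - x)).
  apply: (@AC_eq_density _ _ _ _ (fun x => -1 * - g (1 - x))); first by move=> x _; ring.
  by apply: AC_eq (ACZ (-1) rp) => x x01; rewrite (E1 x x01) mulN1r.
exact: AC_density_unique A2 pg.
Qed.

Lemma itg_symmetric f : L1 0 1 f -> aeI 0 1 (fun x => f (1 - x) = f x) ->
  itg f 0 1 = 2 * itg f 0 (1 / 2).
Proof.
move=> fi fs; have fh : L1 0 (1 / 2) f by apply: L1_sub fi; lra.
have fr : L1 (1 / 2) 1 f by apply: L1_sub fi; lra.
rewrite (@itg_split _ _ 0 (1 / 2)); [|lra|lra|exact: fi].
have [ri E] := itg_reflect 1 fh; rewrite subr0 in ri E.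
have h2 : 1 - 1 / 2 = 1 / 2 :> R by lra.
rewrite h2 in ri E.
rewrite (@ae_eq_itg _ (1 / 2) 1 f (fun x => f (1 - x))) ?E; [ring|exact: L1_meas|exact: L1_meas|].
apply: (@aeI_sub _ 0 1); [lra|lra|].
by apply: aeI_imp fs => x _ ->.
Qed.

Lemma W_half v p g : AC 0 1 v p -> AC 0 1 p g -> Q2 0 1 g -> symmetric v ->
  W v = 2 * itg (energy_density p g) 0 (1 / 2).
Proof.
move=> vp pg gQ S; rewrite (W_itg vp pg gQ).
have [ps gs] := symmetric_derivatives vp pg S.
apply: itg_symmetric.
  by apply: energy_density_L1 => //; apply: continuous_itv_meas; exact: AC_continuous pg.
apply: aeI_imp gs => x /andP[x0 x1] E.
by rewrite /energy_density E ps ?qrootN// !ltW.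
Qed.

Lemma dW_half v p g phi r q : AC 0 1 v p -> AC 0 1 p g -> Q2 0 1 g -> symmetric v ->
  AC 0 1 phi r -> AC 0 1 r q -> Q2 0 1 q -> symmetric phi ->
  dW v phi = 2 * itg (variation_density p g r q) 0 (1 / 2).
Proof.
move=> vp pg gQ S phir rq qQ S'; rewrite (dW_itg vp pg gQ phir rq qQ).
have [ps gs] := symmetric_derivatives vp pg S.
have [rs qs] := symmetric_derivatives phir rq S'.
apply: itg_symmetric.
  by apply: variation_density_L1 => //; [exact: AC_continuous pg|exact: AC_continuous rq].
apply: (@aeI_imp _ _ _ _ _ _ (aeI_and gs qs)) => x /andP[x0 x1] [E E'].
by rewrite /variation_density E E' ps ?rs ?qrootN ?ltW//; ring.
Qed.

(** The two densities may disagree at c, whence the multiple of the indicator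
    function of the singleton c. *)
Lemma L1_glue a b c f : a <= c -> c <= b -> L1 a c f -> L1 c b f -> L1 a b f.
Proof.
move=> ac cb f1 f2.
have [i1 i2] := (L1_restrict f1, L1_restrict f2).
have i1' : L1 a b (f \_ `]a, c[) by exact: integrableS i1.
have i2' : L1 a b (f \_ `]c, b[) by exact: integrableS i2.
have i3 : L1 a b (fun x => \1_[set c] x * f c).
  apply: (@L1_mul_bounded _ _ _ 1); last exact: L1_cst.
    by apply: measurable_indic; exact: measurable_set1.
  by move=> x _; rewrite indicE; case: (x \in _); rewrite ?normr0 ?normr1.
apply: eq_L1 (L1D (L1D i1' i2') i3) => x /andP[ax xb].
have e1 : (x \in `]a, c[%classic) = (x < c) by apply/idP/idP; rewrite inE/= in_itv/= ax.
have e2 : (x \in `]c, b[%classic) = (c < x) by apply/idP/idP; rewrite inE/= in_itv/= xb andbT.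
have e3 : (x \in [set c]) = (x == c) by apply/idP/eqP; rewrite inE.
rewrite !patchE indicE e1 e2 e3; case: ltgtP => [xc|xc|->].
- by rewrite mul0r addr0; exact: addr0.
- by rewrite mul0r addr0; exact: add0r.
- by rewrite mul1r [X in X + _](addr0 (0 : R)) add0r.
Qed.

Lemma AC_glue a b c p g : a <= c -> c <= b -> AC a c p g -> AC c b p g -> AC a b p g.
Proof.
move=> ac cb [g1 H1] [g2 H2]; have gi := L1_glue ac cb g1 g2; split=> // x y ax xy yb.
have [yc|/ltW cy] := leP y c; first exact: H1.
have [xc|/ltW cx] := leP x c; last exact: H2.
rewrite (@itg_split _ _ x c y)//; last exact: L1_sub gi.
by rewrite -H1// -H2//; ring.
Qed.

(** The data on [0, 1/2] of the symmetric elements of H(0, 1): symmetry forces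
    p(1/2) = 0, and conversely that condition makes the even extension
    differentiable with an absolutely continuous derivative. *)
Definition half v p g := [/\ AC 0 (1 / 2) v p, AC 0 (1 / 2) p g, Q2 0 (1 / 2) g,
  v 0 = 0 & p (1 / 2) = 0].

Lemma rep_half v p g : rep v p g -> symmetric v -> half v p g.
Proof.
move=> [vp pg gQ v0 v1] S; have [ps _] := symmetric_derivatives vp pg S.
split=> //; [by apply: AC_sub vp; lra|by apply: AC_sub pg; lra|by apply: Q2_sub gQ; lra|].
by have := ps (1 / 2); rewrite (_ : 1 - 1 / 2 = 1 / 2 :> R); [move=> /(_ ltac:(lra))|]; lra.
Qed.

(** The even extension about 1/2; its derivative is odd, and continuous at 1/2 since
    p (1/2) = 0. *)
Lemma half_extend v p g : half v p g -> exists V P G,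
  [/\ rep V P G, symmetric V,
      forall x, 0 <= x <= 1 / 2 -> V x = v x,
      forall x, 0 <= x <= 1 / 2 -> P x = p x &
      forall x, 0 < x < 1 / 2 -> G x = g x].
Proof.
move=> [vp pg gQ v0 ph].
pose ext (s : R) (f : R -> R) x := if x <= 1 / 2 then f x else s * f (1 - x).
have extl s f x : x <= 1 / 2 -> ext s f x = f x by rewrite /ext => ->.
have extr s f x : 1 / 2 < x -> ext s f x = s * f (1 - x).
  by rewrite /ext leNgt => ->.
have h2 : 1 - 1 / 2 = 1 / 2 :> R by lra.
have h02 : 0 <= 1 / 2 :> R by lra.
have h21 : 1 / 2 <= 1 :> R by lra.
have refl f f' : AC 0 (1 / 2) f f' ->
    AC (1 / 2) 1 (fun x => f (1 - x)) (fun x => - f' (1 - x)).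
  by move=> /(AC_reflect 1); rewrite subr0 h2.
have gr := refl _ _ pg; have pr := refl _ _ vp.
have PG : AC 0 1 (ext (-1) p) (ext 1 g).
  apply: (AC_glue h02 h21).
    apply: AC_eq_density (AC_eq _ pg) => x /andP[_ xh]; rewrite extl//; exact: ltW.
  apply: (@AC_eq_density _ _ _ _ (fun x => -1 * - g (1 - x))).
    by move=> x /andP[xh _]; rewrite extr// mul1r mulN1r opprK.
  apply: AC_eq (ACZ (-1) gr) => x /andP[]; rewrite le_eqVlt => /predU1P[<- _|xh _].
    by rewrite extl// h2 ph mulr0.
  by rewrite extr.
have VP : AC 0 1 (ext 1 v) (ext (-1) p).
  apply: (AC_glue h02 h21).
    apply: AC_eq_density (AC_eq _ vp) => x /andP[_ xh]; rewrite extl//; exact: ltW.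
  apply: (@AC_eq_density _ _ _ _ (fun x => - p (1 - x))).
    by move=> x /andP[xh _]; rewrite extr// mulN1r.
  apply: AC_eq pr => x /andP[]; rewrite le_eqVlt => /predU1P[<- _|xh _].
    by rewrite extl// h2.
  by rewrite extr// mul1r.
exists (ext 1 v), (ext (-1) p), (ext 1 g); split.
- split=> //.
  + have [Gi _] := PG; split; first exact: L1_meas Gi.
    have [_ g2] := gQ; apply: (L1_glue h02 h21).
      by apply: eq_L1 g2 => x /andP[_ xh]; rewrite extl// ltW.
    have [r2 _] := itg_reflect 1 g2; rewrite subr0 h2 in r2.
    by apply: eq_L1 r2 => x /andP[xh _]; rewrite extr// mul1r.
  + by rewrite extl.
  + by rewrite extr ?mul1r ?subrr//; lra.
- move=> x /andP[x0]; rewrite le_eqVlt => /predU1P[->|xh]; first by rewrite h2.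
  by rewrite extl ?(ltW xh)// extr ?mul1r ?subKr//; lra.
- by move=> x /andP[_ xh]; rewrite extl.
- by move=> x /andP[_ xh]; rewrite extl.
- by move=> x /andP[_ xh]; rewrite extl// ltW.
Qed.

Lemma SC_le psi v : SC psi -> symmetric v ->
  (forall x, 0 <= x <= 1 / 2 -> psi x <= v x) -> forall x, 0 <= x <= 1 -> psi x <= v x.
Proof.
move=> [ps _ _ _] S H x x01; have /andP[x0 x1] := x01.
have [xh|xh] := leP x (1 / 2); first by apply: H; rewrite x0.
rewrite ps// (symmetricE S)//; apply: H; apply/andP; split; lra.
Qed.

Lemma Msym_rep psi v : Msym psi v -> exists p g, rep v p g /\ symmetric v.
Proof. by move=> [/H_rep[p [g vpg]] _ S]; exists p, g. Qed.

Lemma rep_Msym psi v p g : SC psi -> rep v p g -> symmetric v ->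
  (forall x, 0 <= x <= 1 / 2 -> psi x <= v x) -> Msym psi v.
Proof.
move=> hpsi vpg S H; split=> //; first exact: rep_H vpg.
exact: SC_le.
Qed.

End energy.

(** * Monotone functions *)

Section monotonicity.
Context {R : realType}.
Implicit Types (a b x y k : R) (f df : R -> R).

Lemma der_gt0_lt a b f df : a < b -> {within `[a, b], continuous f} ->
  (forall x, a < x < b -> is_derive x 1 f (df x)) ->
  (forall x, a < x < b -> 0 < df x) -> f a < f b.
Proof.
move=> ab cf fd f0; have fd' x : x \in `]a, b[ -> is_derive x 1 f (df x) by rewrite in_itv; exact: fd.
have [c] := MVT ab fd' cf.
by rewrite in_itv/= => /f0 c0 E; rewrite -subr_gt0 E mulr_gt0// subr_gt0.
Qed.

Lemma der_cst_linear a b k f : a <= b -> {within `[a, b], continuous f} ->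
  (forall x, a < x < b -> is_derive x 1 f k) -> f b - f a = k * (b - a).
Proof.
move=> ab cf fd; have fd' x : x \in `]a, b[ -> is_derive x 1 f k by rewrite in_itv; exact: fd.
by have [c _ ->] := @MVT_segment _ _ (fun=> k) _ _ ab fd' cf.
Qed.

End monotonicity.

(** * The shooting function and the energy bound *)

Section angle.
Context {R : realType}.
Implicit Types (a b c h k p s t x y : R).

Definition sqsin t : R := Num.sqrt (sin t).

Lemma sqsin_continuous : continuous sqsin.
Proof. exact/cont_sqrt/continuous_sin. Qed.

(** The integral of sqrt(sin) from 0 to b; the base point -4 < - pi makes the
    formula differentiable at every difference of two values of the arctangent. *)
Definition isqsin b : R := itg sqsin (-4) b - itg sqsin (-4) 0.

Lemma isqsin0 : isqsin 0 = 0.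
Proof. by rewrite /isqsin subrr. Qed.

Lemma is_derive_isqsin b : -4 < b -> is_derive b 1 isqsin (sqsin b).
Proof.
move=> b4; have si : L1 (-4) (b + 1) sqsin by apply/L1_continuous/continuous_subspaceT/sqsin_continuous.
have D : is_derive b 1 (itg sqsin (-4)) (sqsin b).
  apply: (AC_derive (AC_itg si)); last exact: sqsin_continuous.
  by apply/andP; split; lra.
by apply: der_eq (derB D (der_cst _ b)) _; rewrite subr0.
Qed.

Lemma isqsin_continuous a b : -4 < a -> {within `[a, b], continuous isqsin}.
Proof.
move=> a4; apply: within_cvg => x /andP[ax xb] e e0.
have := der_continuous (is_derive_isqsin (lt_le_trans a4 ax)).
move=> /cvgrPdist_lt /(_ e e0) /nbhs_ballP[d d0 H]; exists d => // y _ yx.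
by rewrite distrC; apply: H; rewrite /ball/= distrC.
Qed.

Lemma pi_half_gt0 : 0 < pi / 2 :> R.
Proof. by rewrite divr_gt0 ?pi_gt0. Qed.

Lemma isqsin_lt a b : 0 <= a -> a < b -> b <= pi -> isqsin a < isqsin b.
Proof.
move=> a0 ab bpi; apply: (der_gt0_lt (df := sqsin)) => //.
- by apply: isqsin_continuous; lra.
- by move=> x /andP[ax xb]; apply: is_derive_isqsin; lra.
- by move=> x /andP[ax xb]; rewrite sqrtr_gt0 sin_gt0_pi//; apply/andP; split; lra.
Qed.

Lemma isqsin_gt0 b : 0 < b -> b <= pi -> 0 < isqsin b.
Proof. by move=> b0 bpi; rewrite -isqsin0; exact: isqsin_lt. Qed.

Lemma isqsin_ge0 b : 0 <= b -> b <= pi -> 0 <= isqsin b.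
Proof. by rewrite le_eqVlt => /predU1P[<- _|b0 bpi]; [rewrite isqsin0|apply/ltW/isqsin_gt0]. Qed.

Lemma cos_atanE t : cos (atan t) = (qroot t ^+ 2)^-1.
Proof. by rewrite cos_atan qroot2. Qed.

Lemma sin_atanE t : sin (atan t) = t / qroot t ^+ 2.
Proof.
have c0 : cos (atan t) != 0 by rewrite cos_atanE invr_eq0 expf_neq0// qroot_neq0.
by rewrite -cos_atanE -{2}(atanK t) /tan divfK.
Qed.

Lemma sin_atanB s t : sin (atan s - atan t) = (qroot s * qroot t) ^- 2 * (s - t).
Proof.
rewrite sinB !sin_atanE !cos_atanE; field.
by rewrite !qroot_neq0.
Qed.

Lemma sqsin_atanB s t : sqsin (atan s - atan t) = Num.sqrt (s - t) / (qroot s * qroot t).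
Proof.
have q0 : 0 < qroot s * qroot t by rewrite mulr_gt0 ?qroot_gt0.
rewrite /sqsin sin_atanB sqrtrM; last by rewrite invr_ge0 exprn_ge0// ltW.
by rewrite sqrtrV ?exprn_ge0 ?(ltW q0)// sqrtr_sqr (gtr0_norm q0) mulrC.
Qed.

Lemma is_derive_atan t : is_derive t 1 atan (qroot t ^+ 4)^-1.
Proof. by rewrite qroot4; exact: is_derive1_atan. Qed.

Lemma atan_diff_gt s t : -4 < atan s - atan t.
Proof.
have := pihalf_lt2 R; have := atan_gtNpi2 s; have := atan_ltpi2 t; lra.
Qed.

(** A primitive of sqrt(s - p) / (1 + p^2)^(5/4), found by the substitution
    p = tan t, under which s - p becomes a multiple of sin (atan s - t). *)
Definition Phi s p : R := - (qroot s * isqsin (atan s - atan p)).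

Lemma is_derive_Phi s p : is_derive p 1 (Phi s) (Num.sqrt (s - p) / qroot p ^+ 5).
Proof.
have d1 : is_derive p 1 (fun t => atan s - atan t) (- (qroot p ^+ 4)^-1).
  by apply: der_eq (derB (der_cst (atan s) p) (is_derive_atan p)) _; rewrite sub0r.
have d2 := @der_comp _ isqsin (fun t => atan s - atan t) p _ _ (is_derive_isqsin (atan_diff_gt s p)) d1.
apply: der_eq (derN (derM (der_cst (qroot s) p) d2)) _.
rewrite sqsin_atanB; field; by rewrite !qroot_neq0.
Qed.

Lemma Phi_der_continuous s : continuous (fun p => Num.sqrt (s - p) / qroot p ^+ 5).
Proof.
apply: contM; last exact: qrootV_continuous.
by apply: cont_sqrt; apply: contB; [exact: cont_cst|move=> x; exact: cvg_id].
Qed.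

Lemma Phi_self s : Phi s s = 0.
Proof. by rewrite /Phi subrr isqsin0 mulr0 oppr0. Qed.

Lemma Phi0 s : Phi s 0 = - (qroot s * isqsin (atan s)).
Proof. by rewrite /Phi atan0 subr0. Qed.

Lemma Phi_le0 s p : p <= s -> Phi s p <= 0.
Proof.
move=> ps; rewrite oppr_le0 mulr_ge0 ?(ltW (qroot_gt0 _))// isqsin_ge0 ?subr_ge0 ?le_atan//.
have := atan_gtNpi2 p; have := atan_ltpi2 s; lra.
Qed.

Lemma Phi_eq0 s p : p <= s -> Phi s p = 0 -> p = s.
Proof.
rewrite le_eqVlt => /predU1P[//|ps] /eqP; rewrite oppr_eq0 mulf_eq0 gt_eqF ?qroot_gt0//=.
rewrite gt_eqF// isqsin_gt0 ?subr_gt0 ?lt_atan//.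
have := atan_gtNpi2 p; have := atan_ltpi2 s; lra.
Qed.

(** The denominator of the energy bound, and its derivative. *)
Definition den h t : R := sin t - 2 * h * cos t.
Definition den' h t : R := cos t + 2 * h * sin t.
(** At the angle t, its zeros single out the initial slopes tan t for which the
    rectangular elastica reaches the height h. *)
Definition shoot h t : R := 2 * sqsin t * (den h t / den' h t) - isqsin t.

Lemma is_derive_den h t : is_derive t 1 (den h) (den' h t).
Proof.
apply: der_eq (derB (is_derive_sin t) (derM (der_cst (2 * h) t) (is_derive_cos t))) _.
rewrite /den'; ring.
Qed.

Lemma is_derive_den' h t : is_derive t 1 (den' h) (- den h t).
Proof.
apply: der_eq (derD (is_derive_cos t) (derM (der_cst (2 * h) t) (is_derive_sin t))) _.
rewrite /den; ring.
Qed.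

Lemma den'_gt0 h t : 0 < h -> 0 <= t <= pi / 2 -> 0 < den' h t.
Proof.
move=> h0 /andP[t0 tpi]; have ph := pi_half_gt0.
have c0 : 0 <= cos t by apply: cos_ge0_pihalf; apply/andP; split; lra.
have s0 : 0 <= sin t by apply: sin_ge0_pi; apply/andP; split; lra.
have := cos2Dsin2 t; rewrite /den'.
move: c0; rewrite le_eqVlt => /predU1P[<-|c0]; last by rewrite ltr_wpDr// !mulr_ge0// ltW.
move=> E; have : sin t != 0 by apply/eqP => E0; move: E; rewrite E0 !expr2; lra.
by move=> sn; rewrite add0r !mulr_gt0// lt_def sn.
Qed.

Lemma den_lt h a b : 0 < h -> 0 <= a -> a < b -> b <= pi / 2 -> den h a < den h b.
Proof.
move=> h0 a0 ab bpi; apply: (der_gt0_lt (df := den' h)) => //.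
- apply: continuous_subspaceT => x; exact: der_continuous (is_derive_den h x).
- by move=> x _; exact: is_derive_den.
- by move=> x /andP[ax xb]; apply: den'_gt0 => //; apply/andP; split; lra.
Qed.

Lemma den_atan h s : den h (atan s) = (s - 2 * h) / qroot s ^+ 2.
Proof. by rewrite /den sin_atanE cos_atanE -mulrBl. Qed.

Lemma sqsin_gt0 x : 0 < x < pi -> 0 < sqsin x.
Proof. by move=> xp; rewrite sqrtr_gt0 sin_gt0_pi. Qed.

Lemma is_derive_sqsin x : 0 < x < pi -> is_derive x 1 sqsin (cos x / (2 * sqsin x)).
Proof. by move=> xp; exact: (der_sqrt (sin_gt0_pi xp) (is_derive_sin x)). Qed.

Definition shoot_der h x : R := cos x / sqsin x * (den h x / den' h x) +
   sqsin x * (1 + 2 * (den h x / den' h x) ^+ 2).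

Lemma is_derive_shoot h x : 0 < h -> 0 < x <= pi / 2 ->
  is_derive x 1 (shoot h) (shoot_der h x).
Proof.
move=> h0 /andP[x0 xpi]; have ph := pi_half_gt0.
have xp : 0 < x < pi by rewrite x0/=; lra.
have dn0 : den' h x != 0 by rewrite gt_eqF// den'_gt0// ltW.
have d1 := is_derive_sqsin xp.
have d2 := derM (is_derive_den h x) (derV dn0 (is_derive_den' h x)).
have x4 : -4 < x by lra.
apply: der_eq (derB (derM (derM (der_cst 2 x) d1) d2) (is_derive_isqsin x4)) _.
by rewrite /shoot_der; field; rewrite dn0 gt_eqF ?sqsin_gt0.
Qed.

Lemma shoot_der_gt0 h x : 0 < h -> 0 < x < pi / 2 -> 0 <= den h x -> 0 < shoot_der h x.
Proof.
move=> h0 /andP[x0 xpi] d0; have ph := pi_half_gt0.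
have s0 : 0 < sqsin x by apply: sqsin_gt0; rewrite x0/=; lra.
have c0 : 0 <= cos x by apply: cos_ge0_pihalf; apply/andP; split; lra.
have dn0 : 0 < den' h x by apply: den'_gt0 => //; rewrite !ltW.
have q0 : 0 <= den h x / den' h x by rewrite divr_ge0// ltW.
rewrite ltr_wpDl//; first by rewrite mulr_ge0// divr_ge0// ltW.
by rewrite mulr_gt0// ltr_wpDr// mulr_ge0// sqr_ge0.
Qed.

(** Where den h is nonnegative, both terms of the derivative of the shooting
    function are nonnegative and the second one is positive. *)
Lemma shoot_lt h a b : 0 < h -> 0 < a -> a < b -> b <= pi / 2 -> 0 <= den h a ->
  shoot h a < shoot h b.
Proof.
move=> h0 a0 ab bpi da; apply: (der_gt0_lt (df := shoot_der h) ab).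
- apply: within_cvg => x /andP[ax xb] e e0.
  have x0 : 0 < x <= pi / 2 by apply/andP; split; lra.
  have := der_continuous (is_derive_shoot h0 x0).
  move=> /cvgrPdist_lt /(_ e e0) /nbhs_ballP[d d0 H]; exists d => // y _ yx.
  by rewrite distrC; apply: H; rewrite /ball/= distrC.
- by move=> x /andP[ax xb]; apply: is_derive_shoot => //; apply/andP; split; lra.
- move=> x /andP[ax xb]; apply: shoot_der_gt0 => //; first by apply/andP; split; lra.
  by apply/ltW/(le_lt_trans da)/den_lt => //; lra.
Qed.

(** The lower bound of the energy on [0, 1/2] of the functions of height at least h
    whose largest slope is tan t. *)
Definition bound h t : R := 2 * isqsin t ^+ 2 / den h t.

Lemma is_derive_bound h t : 0 < h -> 0 < t <= pi / 2 -> 0 < den h t ->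
  is_derive t 1 (bound h) (2 * isqsin t * den' h t / den h t ^+ 2 * shoot h t).
Proof.
move=> h0 /andP[t0 tpi] d0.
have dn0 : den' h t != 0 by rewrite gt_eqF// den'_gt0// ltW.
have t4 : -4 < t by lra.
have d1 := derX 1 (is_derive_isqsin t4).
apply: der_eq (derM (derM (der_cst 2 t) d1) (derV (lt0r_neq0 d0) (is_derive_den h t))) _.
by rewrite /shoot; field; rewrite dn0 gt_eqF.
Qed.

(** The derivative of the bound is a positive multiple of the shooting function,
    which increases: the bound decreases before a and increases after it. *)
Lemma bound_min h a t : 0 < h -> 0 < a < pi / 2 -> 0 < den h a -> shoot h a = 0 ->
  0 < t < pi / 2 -> 0 < den h t -> t != a -> bound h a < bound h t.
Proof.
move=> h0 /andP[a0 api] da Sa /andP[t0 tpi] dt.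
have cont x y : 0 < x -> x < y -> y < pi / 2 -> 0 < den h x -> {within `[x, y], continuous bound h}.
  move=> x0 xy ypi dx; apply: within_cvg => z /andP[xz zy] e e0.
  have z0 : 0 < z <= pi / 2 by apply/andP; split; lra.
  have dz : 0 < den h z.
    by move: xz; rewrite le_eqVlt => /predU1P[<-//|xz]; apply/(lt_trans dx)/den_lt => //; lra.
  have := der_continuous (is_derive_bound h0 z0 dz).
  move=> /cvgrPdist_lt /(_ e e0) /nbhs_ballP[d d0 H]; exists d => // w _ wz.
  by rewrite distrC; apply: H; rewrite /ball/= distrC.
have pos z : 0 < z < pi / 2 -> 0 < den h z -> 0 < 2 * isqsin z * den' h z / den h z ^+ 2.
  move=> /andP[z0 zpi] dz; have ph := pi_half_gt0.
  rewrite divr_gt0 ?exprn_gt0// mulr_gt0 ?den'_gt0 ?(ltW z0) ?(ltW zpi)// mulr_gt0// isqsin_gt0//; lra.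
rewrite neq_lt => /orP[ta|at_].
- have := @der_gt0_lt _ t a (fun z => - bound h z) (fun z => - (2 * isqsin z * den' h z / den h z ^+ 2 * shoot h z)) ta.
  rewrite ltrN2; apply.
  + by apply: contN; apply: cont.
  + move=> z /andP[tz za]; apply: derN; apply: is_derive_bound => //; first by apply/andP; split; lra.
    by apply: (lt_trans dt); apply: den_lt => //; lra.
  + move=> z /andP[tz za]; have dz : 0 < den h z by apply: (lt_trans dt); apply: den_lt => //; lra.
    rewrite -mulrN mulr_gt0 ?pos//; first by apply/andP; split; lra.
    rewrite oppr_gt0 -Sa; apply: shoot_lt => //; [lra|lra|exact: ltW].
- apply: (der_gt0_lt (df := fun z => 2 * isqsin z * den' h z / den h z ^+ 2 * shoot h z) at_).
  + by apply: cont.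
  + move=> z /andP[az zt]; apply: is_derive_bound => //; first by apply/andP; split; lra.
    by apply: (lt_trans da); apply: den_lt => //; lra.
  + move=> z /andP[az zt]; have dz : 0 < den h z by apply: (lt_trans da); apply: den_lt => //; lra.
    rewrite mulr_gt0 ?pos//; first by apply/andP; split; lra.
    rewrite -Sa; apply: shoot_lt => //; [lra|exact: ltW].
Qed.

End angle.

(** * Rectangular elasticae *)

Section extremals.
Context {R : realType}.
Implicit Types (a b c h k s t x y z : R) (p q v : R -> R).

Lemma within_interior a b f x : {within `[a, b], continuous f} -> a < x < b ->
  {for x, continuous (f : R -> R)}.
Proof.
move=> cf xab; have /andP[ax xb] := xab; have ab := lt_trans ax xb.
by have [cc _ _] := (continuous_within_itvP _ ab).1 cf; apply: cc; rewrite in_itv.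
Qed.

(** Coordinates, up to a common scale, of the point of slope t of the rectangular
    elastica that starts at the origin with slope s and zero curvature. *)
Definition abscissa s t : R :=
  2 * sqsin (atan s - atan t) * cos (atan s) + isqsin (atan s - atan t) * sin (atan s).
Definition ordinate s t : R :=
  2 * sqsin (atan s - atan t) * sin (atan s) - isqsin (atan s - atan t) * cos (atan s).

Let angle_der s t : is_derive t 1 (fun t => atan s - atan t) (- (qroot t ^+ 4)^-1).
Proof. by apply: der_eq (derB (der_cst (atan s) t) (is_derive_atan t)) _; rewrite sub0r. Qed.

Let isqsin_der s t : is_derive t 1 (fun t => isqsin (atan s - atan t))
  (sqsin (atan s - atan t) * - (qroot t ^+ 4)^-1).
Proof.
exact: (@der_comp _ isqsin (fun t => atan s - atan t) t _ _ (is_derive_isqsin (atan_diff_gt s t)) (angle_der s t)).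
Qed.

Lemma angle_gt0 s t : t < s -> 0 < atan s - atan t < pi.
Proof.
move=> ts; rewrite subr_gt0 lt_atan//=.
have := atan_gtNpi2 t; have := atan_ltpi2 s; lra.
Qed.

Let sq_der s t : t < s -> is_derive t 1 (fun t => sqsin (atan s - atan t))
  (cos (atan s - atan t) / (2 * sqsin (atan s - atan t)) * - (qroot t ^+ 4)^-1).
Proof.
move=> ts; exact: (@der_comp _ sqsin (fun t => atan s - atan t) t _ _ (is_derive_sqsin (angle_gt0 ts)) (angle_der s t)).
Qed.

Let cos_diff s t : cos (atan s - atan t) = (1 + s * t) / (qroot s ^+ 2 * qroot t ^+ 2).
Proof.
rewrite cosB !cos_atanE !sin_atanE; field; by rewrite !qroot_neq0.
Qed.

Lemma is_derive_abscissa s t : t < s ->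
  is_derive t 1 (abscissa s) (- (qroot s / (qroot t ^+ 5 * Num.sqrt (s - t)))).
Proof.
move=> ts; have st0 : 0 < Num.sqrt (s - t) by rewrite sqrtr_gt0 subr_gt0.
apply: der_eq (derD (derM (derM (der_cst 2 t) (sq_der ts)) (der_cst (cos (atan s)) t))
  (derM (isqsin_der s t) (der_cst (sin (atan s)) t))) _.
rewrite cos_diff sqsin_atanB cos_atanE sin_atanE.
have tE : t = s - Num.sqrt (s - t) ^+ 2 by rewrite sqr_sqrtr ?subKr// subr_ge0 ltW.
have := qroot_neq0 s; have := qroot_neq0 t; have := lt0r_neq0 st0; have := qroot4 s.
set r := Num.sqrt (s - t) in tE *; set Q := qroot s; set q := qroot t.
move=> Q4 r0 q0 Q0.
transitivity (- ((1 + s ^+ 2) / (Q ^+ 3 * q ^+ 5 * r))).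
  by rewrite tE; field; rewrite r0 q0 Q0.
by rewrite -Q4; field; rewrite r0 q0 Q0.
Qed.

Lemma is_derive_ordinate s t : t < s ->
  is_derive t 1 (ordinate s) (- (qroot s * t / (qroot t ^+ 5 * Num.sqrt (s - t)))).
Proof.
move=> ts; have st0 : 0 < Num.sqrt (s - t) by rewrite sqrtr_gt0 subr_gt0.
apply: der_eq (derB (derM (derM (der_cst 2 t) (sq_der ts)) (der_cst (sin (atan s)) t))
  (derM (isqsin_der s t) (der_cst (cos (atan s)) t))) _.
rewrite cos_diff sqsin_atanB cos_atanE sin_atanE.
have tE : t = s - Num.sqrt (s - t) ^+ 2 by rewrite sqr_sqrtr ?subKr// subr_ge0 ltW.
have := qroot_neq0 s; have := qroot_neq0 t; have := lt0r_neq0 st0; have := qroot4 s.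
set r := Num.sqrt (s - t) in tE *; set Q := qroot s; set q := qroot t.
move=> Q4 r0 q0 Q0.
transitivity (- ((1 + s ^+ 2) * t / (Q ^+ 3 * q ^+ 5 * r))).
  by rewrite tE; field; rewrite r0 q0 Q0.
by rewrite -Q4; field; rewrite r0 q0 Q0.
Qed.

Let atan_cont s : continuous (fun t => atan s - atan t).
Proof. by apply: contB; [exact: cont_cst|exact: continuous_atan]. Qed.

Let Y_cont s : continuous (fun t => isqsin (atan s - atan t)).
Proof. by move=> t; exact: der_continuous (isqsin_der s t). Qed.

Let sq_cont s : continuous (fun t => sqsin (atan s - atan t)).
Proof. by apply: cont_comp; [exact: sqsin_continuous|exact: atan_cont]. Qed.

Lemma abscissa_continuous s : continuous (abscissa s).
Proof.
apply: contD; apply: contM; try exact: cont_cst; last exact: Y_cont.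
by apply: contM; [exact: cont_cst|exact: sq_cont].
Qed.

Lemma ordinate_continuous s : continuous (ordinate s).
Proof.
apply: contB; apply: contM; try exact: cont_cst; last exact: Y_cont.
by apply: contM; [exact: cont_cst|exact: sq_cont].
Qed.

Lemma sqsin0 : sqsin 0 = 0 :> R.
Proof. by rewrite /sqsin sin0 sqrtr0. Qed.

Lemma abscissa_self s : abscissa s s = 0.
Proof. by rewrite /abscissa subrr sqsin0 isqsin0 mulr0 !mul0r addr0. Qed.

Lemma ordinate_self s : ordinate s s = 0.
Proof. by rewrite /ordinate subrr sqsin0 isqsin0 mulr0 !mul0r subr0. Qed.

Lemma abscissa_lt s t t' : t < t' -> t' <= s -> abscissa s t' < abscissa s t.
Proof.
move=> tt ts; have := @der_gt0_lt _ t t' (fun x => - abscissa s x)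
  (fun x => qroot s / (qroot x ^+ 5 * Num.sqrt (s - x))) tt.
rewrite ltrN2; apply.
- exact/contN/continuous_subspaceT/abscissa_continuous.
- move=> x /andP[_ xt]; have xs := lt_le_trans xt ts.
  by apply: der_eq (derN (is_derive_abscissa xs)) _; rewrite opprK.
- move=> x /andP[_ xt]; have xs := lt_le_trans xt ts.
  by rewrite divr_gt0 ?mulr_gt0 ?exprn_gt0 ?qroot_gt0// sqrtr_gt0 subr_gt0.
Qed.

Lemma abscissa_inj s t t' : t <= s -> t' <= s -> abscissa s t = abscissa s t' -> t = t'.
Proof.
move=> ts ts' E; case: (ltgtP t t') => // H.
  by have := abscissa_lt H ts'; rewrite E ltxx.
by have := abscissa_lt H ts; rewrite E ltxx.
Qed.

Lemma flow_continuous s c :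
  continuous (fun t : R => - (c * (qroot t ^+ 5 * Num.sqrt (s - t)))).
Proof.
apply: contN; apply: contM; first exact: cont_cst.
apply: contM; first exact: qroot_pow_continuous.
by apply: cont_sqrt; apply: contB; [exact: cont_cst|move=> ?; exact: cvg_id].
Qed.

Lemma abscissa_gt0 s : 0 < s -> 0 < abscissa s 0.
Proof. by move=> s0; rewrite -[ltLHS](abscissa_self s); apply: abscissa_lt. Qed.

(** The equation p' = - c (1 + p^2)^(5/4) sqrt(s - p) of the equality case of the
    energy bound; it describes a graph that is an arc of a free elastica. *)
Definition extremal s c p :=
  [/\ AC 0 (1 / 2) p (fun x => - (c * (qroot (p x) ^+ 5 * Num.sqrt (s - p x)))),
      p 0 = s & p (1 / 2) = 0].

Section properties.
Variables (s c : R) (p : R -> R).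
Hypotheses (s0 : 0 < s) (c0 : 0 < c) (E : extremal s c p).

Let h02 : 0 <= 1 / 2 :> R. Proof. lra. Qed.

Let cp : {within `[0, 1 / 2], continuous p}.
Proof. by have [A _ _] := E; exact: AC_continuous A. Qed.

Lemma extremal_nonincreasing x y : 0 <= x -> x <= y -> y <= 1 / 2 -> p y <= p x.
Proof.
have [A _ _] := E; apply: (AC_nonincreasing A); apply: aeI_all => t _.
by rewrite oppr_le0 !mulr_ge0 ?(ltW c0) ?sqrtr_ge0// exprn_ge0// ltW// qroot_gt0.
Qed.

Lemma extremal_range x : 0 <= x <= 1 / 2 -> 0 <= p x <= s.
Proof.
move=> /andP[x0 xh]; have [_ <- ph] := E.
by rewrite -{1}ph !extremal_nonincreasing.
Qed.

Lemma extremal_derive x : 0 < x < 1 / 2 ->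
  is_derive x 1 p (- (c * (qroot (p x) ^+ 5 * Num.sqrt (s - p x)))).
Proof.
move=> xh; have [A _ _] := E.
have cg : {within `[0, 1 / 2], continuous (fun x => - (c * (qroot (p x) ^+ 5 * Num.sqrt (s - p x))))}.
  exact: within_comp (@flow_continuous s c) cp.
exact: AC_derive A xh (within_interior cg xh).
Qed.

(** Along an extremal both sides have the same derivative as long as p < s. *)
Lemma extremal_abscissa_diff x : 0 <= x <= 1 / 2 -> (forall y, x < y < 1 / 2 -> p y < s) ->
  abscissa s 0 - abscissa s (p x) = c * qroot s * (1 / 2 - x) /\
  ordinate s 0 - ordinate s (p x) = c * qroot s * itg p x (1 / 2).
Proof.
move=> /andP[x0 xh] ps; have [A _ ph] := E; rewrite -{1 2}ph.
have cpx : {within `[x, 1 / 2], continuous p} by apply: within_sub cp.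
have dp y : x < y < 1 / 2 -> is_derive y 1 p (- (c * (qroot (p y) ^+ 5 * Num.sqrt (s - p y)))).
  by move=> /andP[xy yh]; apply: extremal_derive; rewrite yh (le_lt_trans x0 xy).
have r0 y : x < y < 1 / 2 -> Num.sqrt (s - p y) != 0.
  by move=> /ps py; rewrite gt_eqF// sqrtr_gt0 subr_gt0.
split.
  apply: (@der_cst_linear _ x (1 / 2) _ (fun y => abscissa s (p y)) xh).
    by apply: within_comp cpx; exact: abscissa_continuous.
  move=> y xy; apply: der_eq (der_comp (is_derive_abscissa (ps y xy)) (dp y xy)) _.
  by field; rewrite r0// qroot_neq0.
have Ap := AC_itg (L1_continuous cpx).
have := @der_cst_linear _ x (1 / 2) 0
  (fun y => ordinate s (p y) - c * qroot s * itg p x y) xh.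
rewrite itgxx mulr0 subr0 mul0r => H; apply/eqP; rewrite -subr_eq0 addrAC; apply/eqP; apply: H.
  apply: contB; first by apply: within_comp cpx; exact: ordinate_continuous.
  by apply: contM; [exact: cont_cst|exact: AC_continuous Ap].
move=> y xy; have d1 := der_comp (is_derive_ordinate (ps y xy)) (dp y xy).
have d2 := AC_derive Ap xy (within_interior cpx xy).
apply: der_eq (derB d1 (derM (der_cst (c * qroot s) y) d2)) _.
by field; rewrite r0// qroot_neq0.
Qed.

(** Write k for c * qroot s. Where p < s, the abscissa is k y at y by the previous
    lemma. If p were equal to s at some x > 0, the abscissa would vanish at x and
    hence take the value k x / 2 at some y > x, where it is k y. *)
Lemma extremal_abscissa x : c * qroot s = 2 * abscissa s 0 -> 0 <= x <= 1 / 2 ->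
  abscissa s (p x) = c * qroot s * x.
Proof.
move=> k2 x01; have [_ p0 ph] := E.
have main y : 0 <= y <= 1 / 2 -> p y < s -> abscissa s (p y) = c * qroot s * y.
  move=> y01 py; have /andP[y0 yh] := y01.
  have [|H _] := extremal_abscissa_diff y01.
    by move=> z /andP[yz zh]; apply: le_lt_trans py; apply: extremal_nonincreasing; lra.
  lra.
have k0 : 0 < c * qroot s by rewrite mulr_gt0// qroot_gt0.
have /andP[_] := extremal_range x01; rewrite le_eqVlt => /predU1P[pxs|]; last exact: main.
rewrite pxs abscissa_self; have /andP[x0 xh] := x01.
move: x0; rewrite le_eqVlt => /predU1P[<-|x0]; first by rewrite mulr0.
exfalso.
have cX : {within `[x, 1 / 2], continuous (fun y => abscissa s (p y))}.
  by apply: within_comp (within_sub _ _ cp); [exact: abscissa_continuous|exact: ltW|].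
have [|y] := IVT (v := c * qroot s * (x / 2)) xh cX.
  have A0 : 0 <= abscissa s 0 by lra.
  have Kx := mulr_gt0 k0 x0; have Kh := ler_wpM2l (ltW k0) xh.
  rewrite pxs abscissa_self ph (min_l A0) (max_r A0); apply/andP; split; lra.
rewrite in_itv/= => /andP[xy yh] Ey.
have y01 : 0 <= y <= 1 / 2 by apply/andP; split; lra.
have /andP[_] := extremal_range y01; rewrite le_eqVlt => /predU1P[pys|pys].
  by move: Ey; rewrite pys abscissa_self; have := mulr_gt0 k0 x0; lra.
by move: Ey; rewrite main//; have := mulr_gt0 k0 x0; nra.
Qed.

Lemma extremal_scale : (forall x, 0 < x <= 1 / 2 -> p x < s) ->
  c * qroot s = 2 * abscissa s 0 /\ ordinate s 0 = c * qroot s * itg p 0 (1 / 2).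
Proof.
move=> ps; have h0 : ((0 : R) <= 0) && ((0 : R) <= 1 / 2) by rewrite lexx/=; lra.
have [|H1 H2] := extremal_abscissa_diff h0.
  by move=> y /andP[y0 yh]; apply: ps; rewrite y0 ltW.
have [_ p0 _] := E.
rewrite p0 abscissa_self subr0 subr0 in H1; rewrite p0 ordinate_self subr0 in H2.
by split=> //; rewrite H1; field.
Qed.

End properties.

(** The equation is not Lipschitz at p = s, where it admits the stationary
    solution; the relation between c and s excludes that the solution waits
    there. *)
Lemma extremal_unique s c p q : 0 < s -> 0 < c -> c * qroot s = 2 * abscissa s 0 ->
  extremal s c p -> extremal s c q -> forall x, 0 <= x <= 1 / 2 -> p x = q x.
Proof.
move=> s0 c0 k2 Ep Eq x x01.
have /andP[_ ps] := extremal_range c0 Ep x01; have /andP[_ qs] := extremal_range c0 Eq x01.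
by apply: (abscissa_inj ps qs); rewrite (extremal_abscissa c0 Ep)// (extremal_abscissa c0 Eq).
Qed.

(** The slope is the inverse function of the abscissa, rescaled to [0, 1/2]. *)
Lemma extremal_exists s : 0 < s -> exists2 p,
  extremal s (2 * abscissa s 0 / qroot s) p &
  forall x, 0 < x <= 1 / 2 -> p x < s.
Proof.
move=> s0; set X := abscissa s; set c := 2 * X 0 / qroot s.
have X0 : 0 < X 0 by exact: abscissa_gt0.
have kE : c * qroot s = 2 * X 0 by rewrite divfK// qroot_neq0.
(* T is the inverse of X on [0, s]. *)
pose T y := xget 0 [set t | 0 <= t <= s /\ X t = y].
have XT y : 0 <= y <= X 0 -> 0 <= T y <= s /\ X (T y) = y.
  move=> y01; apply: (@xgetPex _ 0 [set t | 0 <= t <= s /\ X t = y]).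
  have [|t] := IVT (v := y) (ltW s0) (continuous_subspaceT (@abscissa_continuous s)).
    by rewrite abscissa_self (min_r (ltW X0)) (max_l (ltW X0)).
  by rewrite in_itv/= => t0 E; exists t.
have TX t : 0 <= t <= s -> T (X t) = t.
  move=> /andP[t0 ts].
  have XtX : 0 <= X t <= X 0.
    apply/andP; split.
      move: ts; rewrite le_eqVlt => /predU1P[->|ts]; first by rewrite /X abscissa_self.
      by rewrite -(abscissa_self s) ltW// abscissa_lt.
    by move: t0; rewrite le_eqVlt => /predU1P[<-//|t0]; rewrite ltW// abscissa_lt.
  have [/andP[_ H1] H2] := XT _ XtX; exact: abscissa_inj H2.
have cT : {within `[0, X 0], continuous T}.
  have := @segment_can_ge_continuous R 0 s X T (ltW s0).
  rewrite /X abscissa_self; apply; last by move=> t; rewrite in_itv; exact: TX.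
  exact/continuous_subspaceT/abscissa_continuous.
pose p x := T (2 * X 0 * x).
have k0 : 0 < 2 * X 0 by rewrite mulr_gt0.
have kx x : 0 <= x <= 1 / 2 -> 0 <= 2 * X 0 * x <= X 0.
  by move=> /andP[x0 xh]; apply/andP; split; nra.
have Xp x : 0 <= x <= 1 / 2 -> 0 <= p x <= s /\ X (p x) = 2 * X 0 * x.
  by move=> /kx; exact: XT.
have cp : {within `[0, 1 / 2], continuous p}.
  apply: within_cvg => x x01 e e0; have [d d0 H] := within_cvgP cT (kx x x01) e0.
  exists (d / (2 * X 0)) => [|y y01 yx]; first by rewrite divr_gt0.
  apply: H; first exact: kx.
  by rewrite -mulrBr normrM (gtr0_norm k0) mulrC -ltr_pdivlMr.
have pls x : 0 < x <= 1 / 2 -> p x < s.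
  move=> /andP[x0 xh]; have [|/andP[_ px] E] := Xp x; first by rewrite ltW.
  rewrite lt_neqAle px andbT; apply/eqP => H.
  by move: E; rewrite H /X abscissa_self => /eqP; rewrite lt_eqF// mulr_gt0.
have p0g x : 0 <= x < 1 / 2 -> 0 < p x.
  move=> /andP[x0 xh]; have [|/andP[px _] E] := Xp x; first by rewrite x0 ltW.
  rewrite lt_neqAle px andbT; apply/eqP => H.
  by move: E; rewrite -H => /eqP; rewrite gt_eqF//; nra.
exists p => //; split; last 2 first.
- by rewrite /p mulr0 -(abscissa_self s) TX// lexx ltW.
- by rewrite /p (_ : 2 * X 0 * (1 / 2) = X 0) ?TX ?lexx ?ltW//; field.
apply: derive_AC => //; last exact: within_comp (@flow_continuous s c) cp.
move=> x /andP[x0 xh].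
have x01 : 0 <= x <= 1 / 2 by rewrite !ltW.
have x01' : 0 < x <= 1 / 2 by rewrite x0 ltW.
have x01'' : 0 <= x < 1 / 2 by rewrite xh ltW.
have ps := pls x x01'; have pp := p0g x x01''; have [_ XE] := Xp x x01.
have dX := is_derive_abscissa ps.
have r0 : 0 < Num.sqrt (s - p x) by rewrite sqrtr_gt0 subr_gt0.
have dT : is_derive (X (p x)) 1 T (- (qroot s / (qroot (p x) ^+ 5 * Num.sqrt (s - p x))))^-1.
  apply: is_derive_inverse dX _.
  - have p0s : 0 < p x < s by rewrite pp.
    apply: filterS (near_itv p0s) => t /andP[t0 ts]; apply: TX; by rewrite !ltW.
  - by near=> t; exact: abscissa_continuous.
  - by rewrite oppr_eq0 mulf_neq0 ?qroot_neq0// invr_eq0 mulf_neq0 ?expf_neq0 ?qroot_neq0// gt_eqF.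
rewrite XE in dT.
have dk : is_derive x 1 (fun x => 2 * X 0 * x) (2 * X 0).
  by apply: der_eq (derM (der_cst (2 * X 0) x) (der_id x)) _; rewrite mulr1 mulr0 addr0.
apply: der_eq (@der_comp _ T (fun x => 2 * X 0 * x) x _ _ dT dk) _.
rewrite -kE; field.
by rewrite !qroot_neq0 gt_eqF.
Unshelve. all: by end_near.
Qed.

(** The left-hand side says that the arc has height h over a half span 1/2, after
    rescaling. *)
Lemma height_shoot s h : 0 < s -> 0 < h ->
  (ordinate s 0 = 2 * h * abscissa s 0) <-> shoot h (atan s) = 0.
Proof.
move=> s0 h0; have a0 : 0 < atan s by rewrite -atan0 lt_atan.
have api := atan_ltpi2 s.
have dn0 : 0 < den' h (atan s) by apply: den'_gt0 => //; rewrite !ltW.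
have E : ordinate s 0 - 2 * h * abscissa s 0 = den' h (atan s) * shoot h (atan s).
  rewrite /ordinate /abscissa /shoot atan0 subr0 /den; move: dn0; rewrite /den' => dn0.
  by field; rewrite gt_eqF.
split=> [H|H].
  move/eqP: E; rewrite H subrr eq_sym mulf_eq0 (gt_eqF dn0)/= => /eqP; exact.
by apply/eqP; rewrite -subr_eq0 E H mulr0.
Qed.

End extremals.

(** * The critical height *)

Section critical_height.
Context {R : realType}.
Implicit Types (h s t x : R).

Notation mu := (@lebesgue_measure R).

(** The substitution t = tan x turns c0 into twice the integral of sqrt(sin)
    over a quarter period. *)
Lemma c0_isqsin : c0 R = 2 * isqsin (pi / 2).
Proof.
pose f t : R := (qroot t ^+ 5)^-1.
pose F t : R := isqsin (pi / 2) - isqsin (pi / 2 - atan t).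
have fE t : (1 + t ^+ 2) `^ (- (5 / 4)) = f t by rewrite powRN (@qroot_powR _ _ 5).
have f0 t : 0 <= f t by rewrite invr_ge0 exprn_ge0// ltW// qroot_gt0.
have cf : continuous f by exact: qrootV_continuous.
have ph := @pi_half_gt0 R; have p4 := pihalf_lt2 R.
have big t : -4 < pi / 2 - atan t by have := atan_ltpi2 t; lra.
have dF t : is_derive t 1 F (f t).
  have d1 : is_derive t 1 (fun t => pi / 2 - atan t) (- (qroot t ^+ 4)^-1).
    by apply: der_eq (derB (der_cst (pi / 2) t) (is_derive_atan t)) _; rewrite sub0r.
  have d2 := @der_comp _ isqsin (fun t => pi / 2 - atan t) t _ _ (is_derive_isqsin (big t)) d1.
  apply: der_eq (derB (der_cst (isqsin (pi / 2)) t) d2) _.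
  have -> : sqsin (pi / 2 - atan t) = (qroot t)^-1.
    rewrite /sqsin sinB cos_pihalf sin_pihalf mul1r mul0r subr0 cos_atanE.
    by rewrite sqrtrV ?exprn_ge0 ?ltW ?qroot_gt0// sqrtr_sqr gtr0_norm// qroot_gt0.
  rewrite /f; field; exact: qroot_neq0.
have Fl : F t @[t --> +oo] --> isqsin (pi / 2).
  rewrite -[X in _ --> X]subr0; apply: cvgB; first exact: cvg_cst.
  have H : (pi / 2 - atan t) @[t --> +oo] --> (0 : R).
    rewrite -[X in _ --> X](subrr (pi / 2)); apply: cvgB; first exact: cvg_cst.
    exact: cvgy_atan.
  have n4 : -4 < 0 :> R by lra.
  have Y0 : isqsin x @[x --> (0 : R)] --> isqsin 0 := der_continuous (is_derive_isqsin n4).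
  have := cvg_comp _ _ H Y0; rewrite isqsin0; exact.
have F0 : F 0 = 0 by rewrite /F atan0 subr0 subrr.
have I1 : (\int[mu]_(x in `[0%R, +oo[) (f x)%:E = (isqsin (pi / 2))%:E)%E.
  rewrite (@ge0_continuous_FTC2y _ f F 0 (isqsin (pi / 2))) ?F0 ?sube0//.
  - exact: continuous_subspaceT.
  - by rewrite -{2}F0; apply: cvg_at_right_filter; exact: der_continuous (dF 0).
  - by move=> x _; rewrite derive1E; have [_ ->] := dF x.
rewrite /c0 /Rintegral; under eq_integral do rewrite fE.
rewrite (ge0_symfun_integralT f0 cf); last by move=> t; rewrite /f /= qrootN.
by rewrite -set_itvcy I1.
Qed.

Lemma cstar_isqsin : cstar R = (isqsin (pi / 2))^-1.
Proof.
have Y0 : 0 < isqsin (pi / 2 : R) by apply: isqsin_gt0; [exact: pi_half_gt0|have := @pi_gt0 R; lra].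
by rewrite /cstar c0_isqsin; field; rewrite gt_eqF.
Qed.

Lemma shoot_pihalf (h : R) : 0 < h -> shoot h (pi / 2) = h^-1 - isqsin (pi / 2).
Proof.
move=> h0; rewrite /shoot /den /den' sin_pihalf cos_pihalf mulr0 subr0 add0r mulr1.
by rewrite /sqsin sin_pihalf sqrtr1; field; rewrite gt_eqF.
Qed.

Lemma den_atan2 (h : R) : den h (atan (2 * h)) = 0.
Proof. by rewrite den_atan subrr mul0r. Qed.

(** Below the critical height the shooting function is positive at pi / 2, while
    it is negative at the angle of slope 2 h, where den h vanishes. *)
Lemma shoot_exists (h : R) : 0 < h -> h < cstar R ->
  exists s, [/\ 2 * h < s, 0 < den h (atan s) & shoot h (atan s) = 0].
Proof.
move=> h0 hc; have ph := @pi_half_gt0 R.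
have Y0 : 0 < isqsin (pi / 2 : R) by apply: isqsin_gt0; [exact: pi_half_gt0|have := @pi_gt0 R; lra].
have top : 0 < shoot h (pi / 2).
  by rewrite shoot_pihalf// subr_gt0 -(invrK (isqsin _)) ltf_pV2 -?cstar_isqsin// posrE cstar_isqsin invr_gt0.
set a := atan (2 * h); have a0 : 0 < a by rewrite -atan0 lt_atan// mulr_gt0.
have api : a < pi / 2 := atan_ltpi2 _.
have bot : shoot h a < 0.
  rewrite /shoot den_atan2 mul0r mulr0 sub0r oppr_lt0 isqsin_gt0//; have := @pi_gt0 R; lra.
have cS : {within `[a, pi / 2], continuous shoot h}.
  apply: within_cvg => x /andP[ax xb] e e0.
  have x0 : 0 < x <= pi / 2 by apply/andP; split; lra.
  have := der_continuous (is_derive_shoot h0 x0).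
  move=> /cvgrPdist_lt /(_ e e0) /nbhs_ballP[d d0 H]; exists d => // y _ yx.
  by rewrite distrC; apply: H; rewrite /ball/= distrC.
have [|al] := IVT (v := 0) (ltW api) cS.
  by rewrite (min_l (ltW (lt_trans bot top))) (max_r (ltW (lt_trans bot top))) !ltW.
rewrite in_itv/= => /andP[]; rewrite le_eqVlt => /predU1P[<-|aal].
  by move=> _ H; move: bot; rewrite H ltxx.
rewrite le_eqVlt => /predU1P[->|alpi] Sal; first by move: top; rewrite Sal ltxx.
have tanE : atan (tan al) = al by apply: tanK; rewrite in_itv/= alpi andbT; lra.
exists (tan al); rewrite tanE; split=> //.
- rewrite -(atanK (2 * h)) ltr_tan//; rewrite in_itv/=; apply/andP; split=> //; rewrite -/a; lra.
- by rewrite -(den_atan2 h); apply: den_lt => //; exact: ltW.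
Qed.

Lemma atan_itv s : 0 < s -> 0 < atan s < pi / 2.
Proof. by move=> s0; rewrite atan_ltpi2 andbT -atan0 lt_atan. Qed.

Lemma shoot_zero_den h s : 0 < h -> 0 < s -> shoot h (atan s) = 0 -> 0 <= den h (atan s).
Proof.
move=> h0 s0 S0; have /andP[a0 api] := atan_itv s0.
have Ya : 0 < isqsin (atan s) by apply: isqsin_gt0 => //; have := @pi_gt0 R; lra.
have dn0 : 0 < den' h (atan s) by apply: den'_gt0 => //; rewrite !ltW.
rewrite leNgt; apply/negP => dneg; move: S0; rewrite /shoot => /eqP; apply/negP.
rewrite lt_eqF// subr_lt0 (le_lt_trans _ Ya)//.
by rewrite mulr_ge0_le0 ?mulr_ge0 ?sqrtr_ge0// pmulr_lle0 ?invr_gt0// ltW.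
Qed.

Lemma shoot_zero_unique h s t : 0 < h -> 0 < s -> 0 < t ->
  shoot h (atan s) = 0 -> shoot h (atan t) = 0 -> s = t.
Proof.
move=> h0; wlog: s t / s < t => [H s0 t0 S T|st s0 t0 S T].
  case: (ltgtP s t) => // st; first exact: H.
  by apply/esym; exact: H.
have /andP[a0 _] := atan_itv s0; have /andP[_ bpi] := atan_itv t0.
have ab : atan s < atan t by rewrite lt_atan.
have := shoot_lt h0 a0 ab (ltW bpi) (shoot_zero_den h0 s0 S).
by rewrite S T ltxx.
Qed.

(** The shooting function increases from a zero up to pi / 2, where its value is
    at most 0 from the critical height on. *)
Lemma shoot_none (h s : R) : 0 < h -> cstar R <= h -> 0 < s -> shoot h (atan s) != 0.
Proof.
move=> h0 hc s0; apply/eqP => S0; have ph := @pi_half_gt0 R.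
have Y0 : 0 < isqsin (pi / 2 : R) by apply: isqsin_gt0; [exact: pi_half_gt0|have := @pi_gt0 R; lra].
have /andP[a0 api] := atan_itv s0.
have top : shoot h (pi / 2) <= 0.
  by rewrite shoot_pihalf// subr_le0 -(invrK (isqsin _)) lef_pV2 -?cstar_isqsin// posrE cstar_isqsin invr_gt0.
have d0 := shoot_zero_den h0 s0 S0.
have := shoot_lt h0 a0 api (lexx _) d0; rewrite S0; lra.
Qed.

End critical_height.

(** * The lower bound of the energy *)

Section energy_bound.
Context {R : realType}.
Implicit Types (a b c d h s x y : R) (p g v : R -> R).

(** It vanishes exactly when p' = - d (1 + p^2)^(5/4) sqrt(s - p); in its
    expansion the mixed term is an exact derivative. *)
Definition defect s d p g x : R := (g x / qroot (p x) ^+ 5 + d * Num.sqrt (s - p x)) ^+ 2.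

Lemma itg_defect a b s d p g : a <= b -> AC a b p g -> Q2 a b g ->
  (forall x, a <= x <= b -> p x <= s) ->
  L1 a b (defect s d p g) /\
  itg (defect s d p g) a b = itg (energy_density p g) a b +
    2 * d * (Phi s (p b) - Phi s (p a)) + d ^+ 2 * (s * (b - a) - itg p a b).
Proof.
move=> ab pg gQ ps; have cp := AC_continuous pg; have pi := L1_continuous cp.
have mp := continuous_itv_meas cp.
have [mi /(_ a b (lexx _) ab (lexx _)) mE] := AC_comp (is_derive_Phi s) (@Phi_der_continuous _ s) pg.
have Ei := energy_density_L1 mp gQ.
have si : L1 a b (fun x => s - p x) by apply: L1B => //; exact: L1_cst.
have dE x : a < x < b -> defect s d p g x = energy_density p g x +
   2 * d * (Num.sqrt (s - p x) / qroot (p x) ^+ 5 * g x) + d ^+ 2 * (s - p x).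
  move=> /andP[ax xb]; rewrite /defect /energy_density.
  have r2 : s - p x = Num.sqrt (s - p x) ^+ 2 by rewrite sqr_sqrtr// subr_ge0 ps// !ltW.
  rewrite [X in _ = _ + _ + _ * X]r2; field; exact: qroot_neq0.
have di := L1D (L1D Ei (L1Z (2 * d) mi)) (L1Z (d ^+ 2) si).
split; first by apply: eq_L1 di => x /dE.
rewrite (eq_itg dE) itgD; [|exact/L1D/L1Z|exact: L1Z].
rewrite itgD//; last exact: L1Z.
rewrite itgZ// [in X in _ + X]itgZ// itgB//; last exact: L1_cst.
by rewrite itg_cst// mE.
Qed.

Lemma half_continuous v p g : half v p g -> {within `[0, 1 / 2], continuous p}.
Proof. by move=> [_ pg _ _ _]; exact: AC_continuous pg. Qed.

Lemma half_height v p g : half v p g -> v (1 / 2) = itg p 0 (1 / 2).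
Proof. by move=> [[_ vp] _ _ v0 _]; rewrite -vp ?v0 ?subr0//; lra. Qed.

(** The mean slope is at least 2 h, and the maximum exceeds the mean because the
    slope is not constant: it vanishes at 1/2. *)
Lemma half_max_slope v p g h : half v p g -> 0 < h -> h <= v (1 / 2) ->
  exists s x0, [/\ 2 * h < s, 0 <= x0 <= 1 / 2, p x0 = s &
    forall x, 0 <= x <= 1 / 2 -> p x <= s].
Proof.
move=> hv h0 hv2; have cp := half_continuous hv.
have h02 : 0 <= 1 / 2 :> R by lra.
have [x0 x0h pm] := EVT_max h02 cp.
exists (p x0), x0.
have ps x : 0 <= x <= 1 / 2 -> p x <= p x0 by move=> x01; apply: pm; rewrite in_itv.
split=> //; rewrite ltNge; apply/negP => sh.
have pi := L1_continuous cp.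
have si : L1 0 (1 / 2) (fun x => p x0 - p x) by apply: L1B => //; exact: L1_cst.
have nn x : 0 < x < 1 / 2 -> 0 <= p x0 - p x.
  by move=> /andP[? ?]; rewrite subr_ge0 ps// !ltW.
have I0 : itg (fun x => p x0 - p x) 0 (1 / 2) = 0.
  apply/eqP; rewrite eq_le itg_ge0// andbT itgB//; last exact: L1_cst.
  by rewrite itg_cst// -(half_height hv); lra.
have ae := itg_eq0_ae si (aeI_all nn) I0.
have h12 : 0 < 1 / 2 :> R by lra.
have ca : {within `[0, 1 / 2], continuous (fun x => p x0 - p x)} by apply: contB => //; exact: cont_cst.
have cz : {within `[0, 1 / 2], continuous (fun _ : R => 0 : R)} by exact: cont_cst.
have := continuous_ae_eq h12 ca cz ae (x := 1 / 2); rewrite lexx h02 => /(_ isT).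
have [_ _ _ _ ->] := hv; rewrite subr0 => E.
have : v (1 / 2) = 0.
  rewrite (half_height hv); apply: itg0 => x /andP[x0' xh].
  have xI : 0 <= x <= 1 / 2 by apply/andP; split; exact: ltW.
  by have := continuous_ae_eq h12 ca cz ae xI; lra.
lra.
Qed.

(** The constant changes sign at the maximum x0 of the slope, where [Phi s]
    vanishes; the mixed terms then contribute - 2 c Phi s (p 0) and - 2 c Phi s 0,
    both of which are nonnegative. *)
Lemma energy_split v p g s c x0 : half v p g -> 0 <= x0 <= 1 / 2 ->
  (forall x, 0 <= x <= 1 / 2 -> p x <= s) -> p x0 = s ->
  itg (energy_density p g) 0 (1 / 2) =
    itg (defect s (- c) p g) 0 x0 + itg (defect s c p g) x0 (1 / 2) +
    2 * c * (qroot s * isqsin (atan s)) - 2 * c * Phi s (p 0) - c ^+ 2 * (s / 2 - v (1 / 2)).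
Proof.
move=> hv /andP[x0p xh] ps pxs; have [vp pg gQ v0 ph] := hv.
have cp := half_continuous hv; have pi := L1_continuous cp.
have mp := continuous_itv_meas cp.
have Ei := energy_density_L1 mp gQ.
have pg1 : AC 0 x0 p g by apply: AC_sub pg.
have pg2 : AC x0 (1 / 2) p g by apply: AC_sub pg.
have gQ1 : Q2 0 x0 g by apply: Q2_sub gQ.
have gQ2 : Q2 x0 (1 / 2) g by apply: Q2_sub gQ.
have ps1 x : 0 <= x <= x0 -> p x <= s by move=> /andP[? ?]; apply: ps; apply/andP; split; lra.
have ps2 x : x0 <= x <= 1 / 2 -> p x <= s by move=> /andP[? ?]; apply: ps; apply/andP; split; lra.
have [_ ->] := itg_defect (- c) x0p pg1 gQ1 ps1.
have [_ ->] := itg_defect c xh pg2 gQ2 ps2.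
rewrite (@itg_split _ _ 0 x0)// (half_height hv) (@itg_split _ p 0 x0 (1 / 2))//.
by rewrite ph pxs Phi_self Phi0; field.
Qed.

(** With I = - Phi s 0 and K = s/2 - h, the energy is at least 2 c I - c^2 K for
    every c > 0, and c = I / K is the best choice. In the case of equality all the
    discarded nonnegative terms vanish. *)
Lemma energy_bound v p g h : half v p g -> 0 < h -> h <= v (1 / 2) ->
  exists s, [/\ 2 * h < s, bound h (atan s) <= itg (energy_density p g) 0 (1 / 2) &
    itg (energy_density p g) 0 (1 / 2) <= bound h (atan s) ->
    v (1 / 2) = h /\ extremal s (qroot s * isqsin (atan s) / (s / 2 - h)) p].
Proof.
move=> hv h0 hv2; have [s [x0 [hs x0h pxs ps]]] := half_max_slope hv h0 hv2.
have [vp pg gQ v0 ph] := hv; have s0 : 0 < s by lra.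
have h02 : 0 <= 1 / 2 :> R by lra.
have K0 : 0 < s / 2 - h by lra.
have a0 : 0 < atan s by rewrite -atan0 lt_atan.
have Y0 : 0 < isqsin (atan s).
  by apply: isqsin_gt0 => //; have := atan_ltpi2 s; have := @pi_gt0 R; lra.
set I := qroot s * isqsin (atan s); set K := s / 2 - h in K0 *; set c := I / K.
have I0 : 0 < I by rewrite mulr_gt0// qroot_gt0.
have c0 : 0 < c by rewrite divr_gt0.
have BE : bound h (atan s) = 2 * c * I - c ^+ 2 * K.
  rewrite /bound den_atan /c /I /K; field.
  rewrite qroot_neq0 !gt_eqF//; lra.
have p0s : p 0 <= s by apply: ps; rewrite lexx.
have N1 y z d : 0 <= itg (defect s d p g) y z by apply: itg_ge0 => t _; exact: sqr_ge0.
have P0 := Phi_le0 p0s.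
have cP : 0 <= - (2 * c * Phi s (p 0)).
  by rewrite -mulrN mulr_ge0 ?oppr_ge0// mulr_ge0// ltW.
have c20 : 0 < 2 * c by rewrite mulr_gt0.
have cc0 : 0 < c ^+ 2 by rewrite exprn_gt0.
have cv : 0 <= c ^+ 2 * (v (1 / 2) - h) by rewrite mulr_ge0 ?sqr_ge0// subr_ge0.
exists s; split=> //.
  rewrite (energy_split c hv x0h ps pxs) BE -/I.
  by have := N1 0 x0 (- c); have := N1 x0 (1 / 2) c; rewrite /K; lra.
move=> EB.
have := EB; rewrite (energy_split c hv x0h ps pxs) BE -/I => EB1.
have N2 := N1 0 x0 (- c); have N3 := N1 x0 (1 / 2) c.
have P1 : Phi s (p 0) = 0.
  have : 2 * c * Phi s (p 0) = 0 by rewrite /K in EB1; lra.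
  by move/eqP; rewrite mulf_eq0 (gt_eqF c20)/= => /eqP.
have p0 := Phi_eq0 p0s P1.
have vh : v (1 / 2) = h.
  have : c ^+ 2 * (v (1 / 2) - h) = 0 by rewrite /K in EB1; lra.
  by move/eqP; rewrite mulf_eq0 (gt_eqF cc0)/= subr_eq0 => /eqP.
split=> //; split=> //.
have z0h : (0 <= (0 : R)) && ((0 : R) <= 1 / 2) by rewrite lexx.
have := EB; rewrite (energy_split c hv z0h ps p0) BE -/I itgxx p0 Phi_self vh => EB2.
have N4 := N1 0 (1 / 2) c.
have N0 : itg (defect s c p g) 0 (1 / 2) = 0 by rewrite /K in EB2; lra.
have [di _] := itg_defect c h02 pg gQ ps.
have ae := itg_eq0_ae di (aeI_all (fun x _ => sqr_ge0 _)) N0.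
apply: AC_ae pg; last first.
  apply: aeI_imp ae => x _ /eqP; rewrite sqrf_eq0 addr_eq0 => /eqP E.
  rewrite -[LHS](divfK (expf_neq0 5 (qroot_neq0 (p x)))) E -/K -/c; ring.
apply: continuous_itv_meas.
exact: within_comp (@flow_continuous _ s c) (half_continuous hv).
Qed.

End energy_bound.

(** * The symmetric elastica *)

Section symmetric_elastica.
Context {R : realType}.
Implicit Types (a b c d h s t x y z : R) (p g q r u v w psi phi : R -> R).

Let h02 : 0 <= 1 / 2 :> R. Proof. lra. Qed.

Lemma half_itg v p g x : half v p g -> 0 <= x <= 1 / 2 -> v x = itg p 0 x.
Proof. by move=> [[_ vp] _ _ v0 _] /andP[x0 xh]; rewrite -vp// v0 subr0. Qed.

Lemma half_above_chord v p g x : half v p g ->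
  (forall x y, 0 <= x -> x <= y -> y <= 1 / 2 -> p y <= p x) ->
  0 <= x <= 1 / 2 -> 2 * x * v (1 / 2) <= v x.
Proof.
move=> hv mono /andP[x0 xh]; have [vp pg _ v0 _] := hv.
have pi := L1_continuous (half_continuous hv).
have [_ H] := vp.
have A : x * p x <= v x.
  have -> : v x = itg p 0 x by rewrite -H// v0 subr0.
  have -> : x * p x = itg (fun=> p x) 0 x by rewrite itg_cst// subr0 mulrC.
  apply: itg_le; [exact: L1_cst|by apply: L1_sub pi|].
  by move=> t /andP[t0 tx]; apply: mono; lra.
have B : v (1 / 2) - v x <= (1 / 2 - x) * p x.
  have -> : v (1 / 2) - v x = itg p x (1 / 2) by apply: H.
  have -> : (1 / 2 - x) * p x = itg (fun=> p x) x (1 / 2) by rewrite itg_cst// mulrC.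
  apply: itg_le; [by apply: L1_sub pi|exact: L1_cst|].
  by move=> t /andP[t0 tx]; apply: mono; lra.
have A' := ler_wpM2l (_ : 0 <= 1 / 2 - x) A; have B' := ler_wpM2l x0 B.
by have := A' ltac:(lra); lra.
Qed.

(** A concave function on [0, 1/2] lies above its chord, and the obstacle is
    affine there. *)
Lemma chord_above_obstacle psi v p g x : SC psi -> half v p g ->
  (forall x y, 0 <= x -> x <= y -> y <= 1 / 2 -> p y <= p x) -> 0 <= x <= 1 / 2 ->
  (1 - 2 * x) * - psi 0 + 2 * x * (v (1 / 2) - psi (1 / 2)) <= v x - psi x.
Proof.
move=> [_ _ _ E] hv mono x01; have := half_above_chord hv mono x01.
by rewrite (E x x01); lra.
Qed.

Lemma half_ext v p g w q k : half v p g -> half w q k ->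
  (forall x, 0 <= x <= 1 / 2 -> p x = q x) ->
  forall x, 0 <= x <= 1 / 2 -> v x = w x.
Proof.
move=> hv hw pq x x01; rewrite (half_itg hv)// (half_itg hw)//.
have /andP[_ xh] := x01.
by apply: eq_itg => t /andP[t0 tx]; apply: pq; rewrite ltW//=; lra.
Qed.

Lemma symmetric_ext v w : symmetric v -> symmetric w ->
  (forall x, 0 <= x <= 1 / 2 -> v x = w x) -> {in `[0, 1], v =1 w}.
Proof.
move=> Sv Sw E x; rewrite in_itv/= => x01; have /andP[x0 x1] := x01.
have [xh|xh] := leP x (1 / 2); first by apply: E; rewrite x0.
by rewrite symmetricE// (symmetricE Sw)// E//; apply/andP; split; lra.
Qed.

Section extremal.
Variables (s c h : R) (v p g : R -> R).
Hypotheses (s0 : 0 < s) (c0 : 0 < c) (h0 : 0 < h).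
Hypotheses (E : extremal s c p) (ps : forall x, 0 < x <= 1 / 2 -> p x < s).
Hypotheses (hv : half v p g)
  (gE : forall x, 0 < x < 1 / 2 -> g x = - (c * (qroot (p x) ^+ 5 * Num.sqrt (s - p x)))).

Lemma extremal_height : v (1 / 2) = h <-> shoot h (atan s) = 0.
Proof.
have [k2 o] := extremal_scale E ps; have X0 := abscissa_gt0 s0.
rewrite -(height_shoot s0 h0) o k2 (half_height hv); split=> [->|]; first ring.
have X2 : 2 * abscissa s 0 != 0 by rewrite mulf_neq0// gt_eqF.
by move=> H; apply: (mulfI X2); rewrite H; ring.
Qed.

(** The constant is fixed by the length of the half interval; when the height is h
    it coincides with the optimal constant of the energy bound. *)
Lemma extremal_const : 2 * h < s -> shoot h (atan s) = 0 ->
  c = qroot s * isqsin (atan s) / (s / 2 - h).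
Proof.
move=> hs S0; have [k2 _] := extremal_scale E ps.
have /andP[a0 api] := atan_itv s0.
have dn0 : 0 < den' h (atan s) by apply: den'_gt0 => //; rewrite !ltW.
have K0 : s / 2 - h != 0 by rewrite gt_eqF//; lra.
have Q0 := qroot_neq0 s.
have Y : isqsin (atan s) * den' h (atan s) = 2 * sqsin (atan s) * den h (atan s).
  by move/eqP: S0; rewrite /shoot subr_eq0 => /eqP <-; field; rewrite gt_eqF.
apply: (mulIf Q0); rewrite k2; apply: (mulIf K0).
transitivity (qroot s ^+ 2 * isqsin (atan s)); last by rewrite [RHS]mulrAC divfK//; ring.
have Q2n : qroot s ^+ 2 != 0 by rewrite expf_neq0.
apply: (mulIf Q2n); transitivity (qroot s ^+ 4 * isqsin (atan s)); last by ring.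
rewrite qroot4.
move: Y; rewrite /abscissa /den /den' atan0 subr0 cos_atanE sin_atanE => Y.
transitivity (2 * (2 * sqsin (atan s) + isqsin (atan s) * s) * (s / 2 - h)); first by field.
suff : isqsin (atan s) * (1 + 2 * h * s) = 2 * sqsin (atan s) * (s - 2 * h) by lra.
transitivity (isqsin (atan s) * ((qroot s ^+ 2)^-1 + 2 * h * (s / qroot s ^+ 2)) * qroot s ^+ 2).
  by field.
by rewrite Y; field.
Qed.

Lemma extremal_energy : 2 * h < s -> shoot h (atan s) = 0 -> v (1 / 2) = h ->
  itg (energy_density p g) 0 (1 / 2) = bound h (atan s).
Proof.
move=> hs S0 vh; have cE := extremal_const hs S0.
have K0 : s / 2 - h != 0 by rewrite gt_eqF//; lra.
have [_ p0 _] := E.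
have ple x : 0 <= x <= 1 / 2 -> p x <= s by move=> /(extremal_range c0 E)/andP[].
have z0h : (0 <= (0 : R)) && ((0 : R) <= 1 / 2) by rewrite lexx.
rewrite (energy_split c hv z0h ple p0) itgxx p0 Phi_self vh.
rewrite itg0 ?add0r => [|x x01]; last first.
  by rewrite /defect gE//; field; exact: qroot_neq0.
rewrite /bound den_atan cE; field.
by rewrite qroot_neq0 !gt_eqF//; lra.
Qed.

(** Along an extremal a = p' / (1 + p^2)^(5/2) is absolutely continuous, with
    a' = - c^2 / 2 - (5/2) p'^2 p / (1 + p^2)^(7/2); hence the variation in the
    direction phi is the integral of 2 (a phi')' + c^2 phi'. *)
Lemma extremal_variation phi r q : AC 0 (1 / 2) phi r -> AC 0 (1 / 2) r q ->
  r (1 / 2) = 0 ->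
  itg (variation_density p g r q) 0 (1 / 2) = c ^+ 2 * (phi (1 / 2) - phi 0).
Proof.
move=> phir rq rh; have cp := half_continuous hv; have cr := AC_continuous rq.
pose a x := - (c * (Num.sqrt (s - p x) / qroot (p x) ^+ 5)).
pose a' x := - (c ^+ 2 / 2) - 5 / 2 * c ^+ 2 * ((s - p x) * p x / qroot (p x) ^+ 4).
have cs : {within `[0, 1 / 2], continuous (fun x => s - p x)}.
  by apply: contB => //; exact: cont_cst.
have cV n : {within `[0, 1 / 2], continuous (fun x => (qroot (p x) ^+ n)^-1)}.
  by apply: (@within_comp _ _ _ (fun t => (qroot t ^+ n)^-1)) cp; exact: qrootV_continuous.
have aA : AC 0 (1 / 2) a a'.
  apply: derive_AC.
  - apply: contN; apply: contM; first exact: cont_cst.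
    by apply: contM; [apply: (cont_sqrt cs)|exact: cV].
  - move=> x xh; have /andP[x0 xl] := xh.
    have px : p x < s by apply: ps; rewrite x0 ltW.
    have r0 : 0 < s - p x by rewrite subr_gt0.
    have r0' : Num.sqrt (s - p x) != 0 by rewrite gt_eqF// sqrtr_gt0.
    have dp := extremal_derive E xh.
    have d1 := @der_sqrt _ (fun x => s - p x) x _ r0 (derB (der_cst s x) dp).
    have d2 := @derV _ (fun x => qroot (p x) ^+ 5) x _ (expf_neq0 5 (qroot_neq0 (p x))) (derX 4 (der_comp (is_derive_qroot (p x)) dp)).
    apply: der_eq (derN (derM (der_cst c x) (derM d1 d2))) _.
    rewrite /a' /=.
    have -> : s - p x = Num.sqrt (s - p x) ^+ 2 by rewrite sqr_sqrtr// ltW.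
    rewrite sqrtr_sqr ger0_norm ?sqrtr_ge0//; move: r0' (qroot_neq0 (p x)).
    by set rt := Num.sqrt _; set Q := qroot _ => r0' Q0; field; rewrite r0' Q0.
  - apply: contB; first exact: cont_cst.
    have c1 : {within `[0, 1 / 2], continuous (fun x => (s - p x) * p x / qroot (p x) ^+ 4)}.
      by apply: contM; [exact: contM|exact: cV].
    by apply: contM => //; exact: cont_cst.
have [pi E1] := ACM aA rq.
have ri := L1_continuous cr.
have vE x : 0 < x < 1 / 2 ->
    variation_density p g r q x = 2 * (a x * q x + r x * a' x) + c ^+ 2 * r x.
  move=> xh; rewrite /variation_density gE// /a /a'.
  have /andP[x0 xl] := xh.
  have px : p x < s by apply: ps; rewrite x0 ltW.
  have -> : s - p x = Num.sqrt (s - p x) ^+ 2 by rewrite sqr_sqrtr// subr_ge0 ltW.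
  rewrite sqrtr_sqr ger0_norm ?sqrtr_ge0//; move: (qroot_neq0 (p x)).
  by set rt := Num.sqrt _; set Q := qroot _ => Q0; field.
rewrite (eq_itg vE) itgD; [|exact: L1Z|exact: L1Z].
rewrite !itgZ// -E1//; have [_ Hphi] := phir; rewrite -Hphi// rh.
by have [_ p0 _] := E; rewrite /a p0 subrr sqrtr0; ring.
Qed.

End extremal.

Lemma elastica_exists psi : SC psi -> psi (1 / 2) < cstar R ->
  exists s c u p g, [/\ 2 * psi (1 / 2) < s, 0 < den (psi (1 / 2)) (atan s),
    shoot (psi (1 / 2)) (atan s) = 0 & 0 < c] /\
   [/\ Msym psi u, rep u p g, symmetric u & u (1 / 2) = psi (1 / 2)] /\
   [/\ extremal s c p, forall x, 0 < x <= 1 / 2 -> p x < s &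
    forall x, 0 < x < 1 / 2 -> g x = - (c * (qroot (p x) ^+ 5 * Num.sqrt (s - p x)))].
Proof.
move=> hpsi; have [_ psi0 h0 _] := hpsi; set h := psi (1 / 2) in h0 * => hc.
have [s [hs d0 S0]] := shoot_exists h0 hc; have s0 : 0 < s by lra.
have [p E ps] := extremal_exists s0; set c := 2 * abscissa s 0 / qroot s in E *.
have c0 : 0 < c by rewrite divr_gt0 ?qroot_gt0// mulr_gt0// abscissa_gt0.
have [A p0 ph] := E; have cp := AC_continuous A.
have hv : half (itg p 0) p (fun x => - (c * (qroot (p x) ^+ 5 * Num.sqrt (s - p x)))).
  split=> //; [exact/AC_itg/L1_continuous| |exact: itgxx].
  apply: Q2_continuous; exact: within_comp (@flow_continuous _ s c) cp.
have vh := (extremal_height s0 h0 E ps hv).2 S0.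
have [V [P [G [VPG SV VE PE GE]]]] := half_extend hv.
have EP : extremal s c P.
  split; last 2 first.
  - by rewrite PE ?p0// lexx.
  - by rewrite PE ?ph// lexx h02.
  apply: AC_eq_density (AC_eq _ A) => x /andP[x0 xh]; rewrite PE//; apply/andP; split; lra.
have HV := rep_half VPG SV.
have Vh : V (1 / 2) = h by rewrite VE ?lexx ?h02.
exists s, c, V, P, G; do 2?split=> //.
- split=> //; apply: (rep_Msym hpsi VPG SV) => x x01.
  have := chord_above_obstacle hpsi HV (extremal_nonincreasing c0 EP) x01.
  rewrite Vh -/h subrr mulr0 addr0.
  have /andP[_ xh] := x01.
  have : 0 <= (1 - 2 * x) * - psi 0 by rewrite mulr_ge0//; lra.
  by lra.
- split=> // x /andP[x0 xh].
    by rewrite PE ?ps ?x0 ?(ltW x0).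
  by rewrite GE ?x0// PE// !ltW.
Qed.

Section elastica.
Variables (psi : R -> R) (s c : R) (u p g : R -> R).
Hypotheses (hpsi : SC psi) (hs : 2 * psi (1 / 2) < s)
  (d0 : 0 < den (psi (1 / 2)) (atan s)) (S0 : shoot (psi (1 / 2)) (atan s) = 0) (c0 : 0 < c).
Hypotheses (uM : Msym psi u) (upg : rep u p g) (uS : symmetric u)
  (uh : u (1 / 2) = psi (1 / 2)).
Hypotheses (E : extremal s c p) (ps : forall x, 0 < x <= 1 / 2 -> p x < s)
  (gE : forall x, 0 < x < 1 / 2 -> g x = - (c * (qroot (p x) ^+ 5 * Num.sqrt (s - p x)))).

Let h := psi (1 / 2).
Let h0 : 0 < h. Proof. by have [] := hpsi. Qed.
Let s0 : 0 < s. Proof. have := h0; move: hs; rewrite -/h; lra. Qed.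
Let hu : half u p g. Proof. exact: rep_half. Qed.

Lemma elastica_solves_P : solves_P psi u.
Proof.
split=> // w wM; have [q [k [wqk wS]]] := Msym_rep wM.
have [up pg gQ u0 u1] := upg; have [wq qk kQ w0 w1] := wqk.
have [_ _ _ _ ph] := hu; have [_ _ _ _ qh] := rep_half wqk wS.
rewrite (dW_half up pg gQ uS (ACB wq up) (ACB qk pg) (Q2B kQ gQ)); last first.
  by move=> x x01; rewrite /= uS// wS.
rewrite (@extremal_variation _ _ _ _ _ E ps hu gE (fun x => w x - u x)); last 3 first.
- by apply: AC_sub (ACB wq up); lra.
- by apply: AC_sub (ACB qk pg); lra.
- by rewrite ph qh subrr.
have [_ wpsi _] := wM.
rewrite u0 w0 subrr subr0 uh mulr_ge0// mulr_ge0 ?sqr_ge0//.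
by rewrite subr_ge0; apply: wpsi; apply/andP; split; lra.
Qed.

Let u_energy : W u = 2 * bound h (atan s).
Proof.
have [up pg gQ _ _] := upg.
by rewrite (W_half up pg gQ uS) (extremal_energy s0 c0 h0 E ps hu gE).
Qed.

(** Among the admissible functions of largest slope t the energy is at least the
    bound at t, whose minimum is attained at s and is the energy of u. *)
Lemma elastica_least_energy w : Msym psi w ->
  W u <= W w /\ (W w <= W u -> {in `[0, 1], w =1 u}).
Proof.
move=> wM; have [q [k [wqk wS]]] := Msym_rep wM.
have [wq qk kQ _ _] := wqk; have hw := rep_half wqk wS.
have [_ wpsi _] := wM.
have hwh : h <= w (1 / 2) by apply: wpsi; apply/andP; split; lra.
have [t [ht B1 B2]] := energy_bound hw h0 hwh.
have t0 : 0 < t by have := h0; lra.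
have dt : 0 < den h (atan t).
  by rewrite den_atan divr_gt0 ?exprn_gt0 ?qroot_gt0//; lra.
rewrite u_energy (W_half wq qk kQ wS).
have [ts|ts] := eqVneq (atan t) (atan s); last first.
  have := bound_min h0 (atan_itv s0) d0 S0 (atan_itv t0) dt ts.
  by split; lra.
rewrite ts in B1 B2; split; first by lra.
move=> W2; have [|wh Ew] := B2; first lra.
have ts' : t = s by rewrite -(atanK t) ts atanK.
rewrite ts' -(extremal_const s0 h0 E ps hs S0) in Ew.
have [k2 _] := extremal_scale E ps.
apply: (symmetric_ext wS uS); apply: (half_ext hw hu).
exact: extremal_unique s0 c0 k2 Ew E.
Qed.

End elastica.

End symmetric_elastica.

(** * Solutions of the variational inequality *)

Section necessary_conditions.
Context {R : realType}.
Implicit Types (a b c d h s t x y z : R) (p g q r u v w psi phi : R -> R).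

Let h02 : 0 <= 1 / 2 :> R. Proof. lra. Qed.
Let h12 : 0 < 1 / 2 :> R. Proof. lra. Qed.

Lemma AC_id a b : AC a b (fun x : R => x) (fun=> 1).
Proof.
by split; [exact: L1_cst|move=> x y ax xy yb; rewrite itg_cst// mul1r].
Qed.

(** The test directions are parametrized by their second derivatives. *)
Definition slope_of q x : R := itg q 0 x - itg q 0 (1 / 2).
Definition height_of q : R -> R := itg (slope_of q) 0.

Lemma half_height_of q : Q2 0 (1 / 2) q -> half (height_of q) (slope_of q) q.
Proof.
move=> qQ; have A : AC 0 (1 / 2) (slope_of q) q.
  apply: AC_eq_density (ACB (AC_itg (Q2_L1 qQ)) (AC_cst 0 (1 / 2) (itg q 0 (1 / 2)))) => x _.
  by rewrite subr0.
split=> //; first exact/AC_itg/L1_continuous/(AC_continuous A).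
- exact: itgxx.
- exact: subrr.
Qed.

Lemma halfZ k v p g : half v p g -> half (fun x => k * v x) (fun x => k * p x) (fun x => k * g x).
Proof.
move=> [vp pg gQ v0 ph]; split; [exact: ACZ|exact: ACZ|exact: Q2Z| |].
  by rewrite v0 mulr0.
by rewrite ph mulr0.
Qed.

Lemma half_moment v p g : half v p g -> v (1 / 2) = - itg (fun x => x * g x) 0 (1 / 2).
Proof.
move=> hv; have [_ pg _ _ ph] := hv.
rewrite (AC_by_parts h02 (AC_id 0 (1 / 2)) pg) (half_height hv) ph.
by rewrite (@eq_itg _ _ _ (fun x => p x * 1) p) => [|x _]; [ring|rewrite mulr1].
Qed.

Section solution.
Variables (psi w p g : R -> R).
Hypotheses (hpsi : SC psi) (wP : solves_P psi w) (wpg : rep w p g) (wS : symmetric w).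

Let h := psi (1 / 2).
Let hw : half w p g. Proof. exact: rep_half. Qed.
Let pg : AC 0 (1 / 2) p g. Proof. by have [] := hw. Qed.
Let gQ : Q2 0 (1 / 2) g. Proof. by have [] := hw. Qed.
Let cp : {within `[0, 1 / 2], continuous p}. Proof. exact: half_continuous hw. Qed.
Let cV n : {within `[0, 1 / 2], continuous (fun x => (qroot (p x) ^+ n)^-1)}.
Proof. by apply: (@within_comp _ _ _ (fun t => (qroot t ^+ n)^-1)) cp; exact: qrootV_continuous. Qed.
Let cq n : {within `[0, 1 / 2], continuous (fun x => qroot (p x) ^+ n)}.
Proof. by apply: (@within_comp _ _ _ (fun t => qroot t ^+ n)) cp; exact: qroot_pow_continuous. Qed.

Let w_psi x : 0 <= x <= 1 / 2 -> psi x <= w x.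
Proof.
move=> /andP[x0 xh]; have [[_ H _] _] := wP; apply: H; apply/andP; split; lra.
Qed.

Lemma admissible_variation phi r q : half phi r q ->
  (forall x, 0 <= x <= 1 / 2 -> psi x <= w x + phi x) ->
  0 <= itg (variation_density p g r q) 0 (1 / 2).
Proof.
move=> hphi adm; have [F [F' [F'' [FFF FS FE F'E F''E]]]] := half_extend hphi.
have [wp pg1 gQ1 w0 w1] := wpg; have [FF' FF'' FQ F0 F1] := FFF.
have vM : Msym psi (fun x => w x + F x).
  apply: (@rep_Msym _ _ _ (fun x => p x + F' x) (fun x => g x + F'' x) hpsi).
  - split; [exact: ACD|exact: ACD|exact: Q2D| |].
      by rewrite w0 F0 addr0.
    by rewrite w1 F1 addr0.
  - by move=> x x01; rewrite wS// FS.
  - by move=> x x01; rewrite FE//; exact: adm.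
have [_ /(_ _ vM)] := wP.
have E x : F x = ((fun x => w x + F x) \- w) x by rewrite /= addrC addKr.
rewrite (dW_half wp pg1 gQ1 wS _ FF'' FQ).
- rewrite pmulr_rge0//; congr (0 <= _); apply: eq_itg => x xh.
  have /andP[x0 xl] := xh.
  by rewrite /variation_density F'E ?F''E// !ltW.
- by apply: AC_eq FF' => x _.
- by move=> x x01; rewrite -!E FS.
Qed.

(* The positive part of g, in a form that is visibly square integrable. *)
Let gpos x : R := (g x + `|g x|) / 2.

Let gposQ : Q2 0 (1 / 2) gpos.
Proof.
have nQ : Q2 0 (1 / 2) (fun x => `|g x|).
  have [mg gi] := gQ; split; first exact: measurableT_comp.
  by apply: eq_L1 gi => x _; rewrite real_normK// num_real.
have [mG Gi] := Q2Z (2^-1) (Q2D gQ nQ).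
split; first by apply: eq_measurable_fun mG => x _; rewrite mulrC.
by apply: eq_L1 Gi => x _; rewrite mulrC.
Qed.

(** The slope of the test direction is r = z (1 + p^2)^(5/4). The factor is such
    that the terms with z cancel in the variation, which becomes the integral of
    2 g z' / (1 + p^2)^(5/4); and z' = - (1 + p^2)^(5/4) max(g, 0), z(1/2) = 0
    give a nonnegative direction and the integrand - 2 max(g, 0)^2. *)
Lemma solution_concave : aeI 0 (1 / 2) (fun x => g x <= 0).
Proof.
pose k x := - (qroot (p x) ^+ 5 * gpos x).
have kQ : Q2 0 (1 / 2) k.
  by have := Q2Z (-1) (Q2_mul_continuous (@cq 5) gposQ); congr (Q2 _ _ _);
    apply/funext => x; rewrite mulN1r.
have [_ kA _ _ z1] := half_height_of kQ; set z := slope_of k in kA z1.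
have gpos_ge0 x : 0 <= gpos x.
  by rewrite divr_ge0//; have := ler_norm (- g x); rewrite normrN; lra.
have z_ge0 x : 0 <= x <= 1 / 2 -> 0 <= z x.
  move=> /andP[x0 xh]; rewrite -z1; apply: (AC_nonincreasing kA) => //.
  apply: aeI_all => t _; rewrite oppr_le0 mulr_ge0// exprn_ge0// ltW//; exact: qroot_gt0.
have dq t : is_derive t 1 (fun t => qroot t ^+ 5) (5 / 2 * (t * qroot t)).
  apply: der_eq (derX 4 (is_derive_qroot t)) _; field; exact: qroot_neq0.
have cdq : continuous (fun t : R => 5 / 2 * (t * qroot t)).
  apply: contM; first exact: cont_cst.
  by apply: contM; [move=> ?; exact: cvg_id|exact: qroot_continuous].
have rA := ACM (AC_comp dq cdq pg) kA; set r := (fun x => _) in rA.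
set q := (fun x => _) in rA.
have r_ge0 x : 0 <= x <= 1 / 2 -> 0 <= r x.
  by move=> x01; rewrite mulr_ge0 ?z_ge0// exprn_ge0// ltW// qroot_gt0.
have qQ : Q2 0 (1 / 2) q.
  apply: Q2D; first exact: Q2_mul_continuous (@cq 5) kQ.
  apply: Q2_mul_continuous; first exact: AC_continuous kA.
  apply: Q2_mul_continuous gQ.
  exact: (@within_comp _ _ _ (fun t => 5 / 2 * (t * qroot t))) cp.
have hphi : half (itg r 0) r q.
  split=> //; [exact/AC_itg/L1_continuous/(AC_continuous rA)|exact: itgxx|].
  by rewrite /r z1 mulr0.
have := admissible_variation hphi.
have vE x : 0 < x < 1 / 2 -> variation_density p g r q x = - (2 * gpos x ^+ 2).
  move=> _; have E : g x * gpos x = gpos x ^+ 2.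
    have := real_normK (num_real (g x)); rewrite /gpos => H.
    by rewrite expr_div_n sqrrD H; field.
  rewrite /variation_density /q /r /k -E; field; exact: qroot_neq0.
have [_ gi] := gposQ.
rewrite (eq_itg vE) itgN; last exact: L1Z.
rewrite itgZ// => H.
have I0 : itg (fun x => gpos x ^+ 2) 0 (1 / 2) = 0.
  apply/eqP; rewrite eq_le itg_ge0 ?andbT => [|x _]; last exact: sqr_ge0.
  have := H _; rewrite oppr_ge0 pmulr_rle0//; apply => x x01.
  rewrite (le_trans (w_psi x01))// lerDl itg_ge0// => t /andP[t0 tx]; apply: r_ge0.
  by have /andP[_ xh] := x01; apply/andP; split; lra.
have := itg_eq0_ae gi (aeI_all (fun x _ => sqr_ge0 _)) I0.
apply: aeI_imp => x _ /eqP; rewrite sqrf_eq0 /gpos => /eqP.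
by have := normr_ge0 (g x); lra.
Qed.

Lemma solution_mono x y : 0 <= x -> x <= y -> y <= 1 / 2 -> p y <= p x.
Proof. exact: (AC_nonincreasing pg solution_concave). Qed.

Let b x := 5 / 2 * (g x ^+ 2 * p x / qroot (p x) ^+ 14).
Let B := itg b 0.
Let M x := g x / qroot (p x) ^+ 10 + B x.

Let b_L1 : L1 0 (1 / 2) b.
Proof.
apply: L1Z; have [_ gi] := gQ.
apply: (@eq_L1 _ _ _ (fun x => p x * (qroot (p x) ^+ 14)^-1 * g x ^+ 2)).
  by move=> x _; ring.
by apply: L1_mul_continuous gi; apply: contM; [exact: cp|exact: cV].
Qed.

Let BA : AC 0 (1 / 2) B b. Proof. exact: AC_itg. Qed.

Let MQ : Q2 0 (1 / 2) M.
Proof.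
apply: Q2D; last exact/Q2_continuous/(AC_continuous BA).
have := Q2_mul_continuous (@cV 10) gQ; congr (Q2 _ _ _); apply/funext => x.
exact: mulrC.
Qed.

(** Integration by parts puts the whole variation on the second derivative of
    the direction. *)
Let variation_moment phi r q : half phi r q ->
  itg (variation_density p g r q) 0 (1 / 2) = 2 * itg (fun x => M x * q x) 0 (1 / 2).
Proof.
move=> [_ rq qQ _ rh]; have cB := AC_continuous BA; have cr := AC_continuous rq.
have i1 : L1 0 (1 / 2) (fun x => g x * q x / qroot (p x) ^+ 10).
  by apply: eq_L1 (L1_mul_continuous (@cV 10) (Q2_L1M gQ qQ)) => x _; rewrite mulrC.
have i2 : L1 0 (1 / 2) (fun x => B x * q x) := L1_mul_continuous cB (Q2_L1 qQ).
have i3 : L1 0 (1 / 2) (fun x => r x * b x) := L1_mul_continuous cr b_L1.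
have E := AC_by_parts h02 rq BA.
rewrite rh /B itgxx mul0r mulr0 subr0 sub0r -/B in E.
transitivity (itg (fun x => 2 * (g x * q x / qroot (p x) ^+ 10) - 2 * (r x * b x)) 0 (1 / 2)).
  by apply: eq_itg => x _; rewrite /variation_density /b; field; exact: qroot_neq0.
rewrite itgB ?itgZ ?E; [|exact: i3|exact: i1|exact: L1Z|exact: L1Z].
have -> : itg (fun x => M x * q x) 0 (1 / 2) =
   itg (fun x => g x * q x / qroot (p x) ^+ 10 + B x * q x) 0 (1 / 2).
  by apply: eq_itg => x _; rewrite /M; ring.
by rewrite itgD//; ring.
Qed.

(** Near 0 there is room below the solution since psi 0 < 0; concavity turns
    this into room everywhere except at 1/2, where a nonnegative value of the
    direction suffices. So a small multiple of the direction is admissible. *)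
Let moment_ge0 q : Q2 0 (1 / 2) q ->
  itg (fun x => x * q x) 0 (1 / 2) <= 0 \/ h < w (1 / 2) ->
  0 <= itg (fun x => M x * q x) 0 (1 / 2).
Proof.
move=> qQ room; have hphi := half_height_of qQ.
set phi := height_of q in hphi; set r := slope_of q in hphi.
have [pr rq _ phi0 rh] := hphi.
have cr := AC_continuous rq; have [N N0 rN] := continuous_itv_bounded cr.
have incr x y : 0 <= x -> x <= y -> y <= 1 / 2 -> `|phi y - phi x| <= N * (y - x).
  move=> x0 xy yh; have [ri H] := pr; rewrite H//; apply: itg_norm_cst => //.
    exact: L1_sub ri.
  by apply: aeI_all => t /andP[xt ty]; apply: rN; apply/andP; split; lra.
have [_ psi0 _ _] := hpsi.
have wh : h <= w (1 / 2) by apply: w_psi; apply/andP; split; lra.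
have gap := chord_above_obstacle hpsi hw solution_mono; rewrite -/h in gap.
have [e e0 adm] : exists2 e : R, 0 < e &
    forall x, 0 <= x <= 1 / 2 -> psi x <= w x + e * phi x.
  case: room => [m|wh'].
    have phih : 0 <= phi (1 / 2) by rewrite (half_moment hphi) oppr_ge0.
    exists (2 * - psi 0 / N); first by rewrite divr_gt0// mulr_gt0// oppr_gt0.
    move=> x x01; have /andP[x0 xh] := x01; have := gap x x01.
    have := incr x (1 / 2) x0 xh (lexx _); rewrite ler_norml => /andP[_ I].
    have eN : 2 * - psi 0 / N * (N * (1 / 2 - x)) = (1 - 2 * x) * - psi 0.
      by field; rewrite gt_eqF.
    have e0 : 0 <= 2 * - psi 0 / N by rewrite ltW// divr_gt0// mulr_gt0// oppr_gt0.
    have := ler_wpM2l e0 I; rewrite eN mulrBr.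
    have := mulr_ge0 e0 phih.
    have : 0 <= 2 * x * (w (1 / 2) - h) by rewrite mulr_ge0 ?subr_ge0// mulr_ge0.
    lra.
  exists (2 * (w (1 / 2) - h) / N); first by rewrite divr_gt0// mulr_gt0// subr_gt0.
  move=> x x01; have /andP[x0 xh] := x01; have := gap x x01.
  have := incr 0 x (lexx _) x0 xh; rewrite phi0 !subr0 ler_norml => /andP[I _].
  have eN : 2 * (w (1 / 2) - h) / N * - (N * x) = - (2 * x * (w (1 / 2) - h)).
    by field; rewrite gt_eqF.
  have e0 : 0 <= 2 * (w (1 / 2) - h) / N by rewrite ltW// divr_gt0// mulr_gt0// subr_gt0.
  have := ler_wpM2l e0 I; rewrite eN.
  have : 0 <= (1 - 2 * x) * - psi 0 by rewrite mulr_ge0//; lra.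
  lra.
have hphi' := halfZ e hphi.
have := admissible_variation hphi' adm; rewrite (variation_moment hphi').
have -> : itg (fun x => M x * (e * q x)) 0 (1 / 2) = e * itg (fun x => M x * q x) 0 (1 / 2).
  by rewrite -itgZ; [apply: eq_itg => x _; ring|exact: (Q2_L1M MQ qQ)].
by rewrite pmulr_rge0// pmulr_rge0.
Qed.

Let itg_sqr : itg (fun x => x * x) 0 (1 / 2) = 24^-1 :> R.
Proof.
have [|||_ H] := @derive_AC _ 0 (1 / 2) (fun x : R => x ^+ 3 / 3) (fun x => x * x).
- apply: continuous_subspaceT; apply: contM; last exact: cont_cst.
  by apply: contX => ?; exact: cvg_id.
- move=> x _; apply: der_eq (derM (derX 2 (der_id x)) (der_cst (3^-1) x)) _; by field.
- by apply: continuous_subspaceT; apply: contM => ?; exact: cvg_id.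
by rewrite -H//; field.
Qed.

(** By [half_moment] a direction does not lower the value at 1/2 if and only if the
    integral of x q is nonpositive. The variation must therefore vanish where this
    integral is 0, so M is a multiple of x. *)
Let multiplier : exists l : R, [/\ 0 <= l, h < w (1 / 2) -> l = 0 &
  aeI 0 (1 / 2) (fun x => M x = - (l * x))].
Proof.
have idQ : Q2 0 (1 / 2) (fun x : R => x).
  by apply: Q2_continuous; apply: continuous_subspaceT => ?; exact: cvg_id.
have Mx := Q2_L1M MQ idQ; set m := itg (fun x => M x * x) 0 (1 / 2).
have N q : (fun x : R => -1 * q x) = (fun x => - q x) by apply/funext => x; rewrite mulN1r.
have itN f q : L1 0 (1 / 2) (fun x => f x * q x) ->
    itg (fun x => f x * (-1 * q x)) 0 (1 / 2) = - itg (fun x => f x * q x) 0 (1 / 2).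
  by move=> fq; rewrite -[RHS]mulN1r -itgZ//; apply: eq_itg => x _; ring.
have m0 : m <= 0.
  rewrite -oppr_ge0 -itN//; apply: moment_ge0; first exact: Q2Z.
  by left; rewrite itN ?itg_sqr ?oppr_le0//; exact: Q2_L1M.
exists (- 24 * m); split.
- by lra.
- move=> wh; suff : 0 <= m by lra.
  by apply: moment_ge0 => //; right.
pose k x := M x - 24 * m * x.
have kQ : Q2 0 (1 / 2) k by apply: Q2B => //; exact: Q2Z.
have xk : itg (fun x => x * k x) 0 (1 / 2) = 0.
  rewrite (@eq_itg _ _ _ _ (fun x => M x * x - 24 * m * (x * x))); last by move=> x _; rewrite /k; ring.
  have xx := Q2_L1M idQ idQ.
  by rewrite itgB ?itgZ//; [rewrite itg_sqr -/m; field|exact: L1Z].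
have Mk : itg (fun x => M x * k x) 0 (1 / 2) = 0.
  apply/eqP; rewrite eq_le; apply/andP; split.
    rewrite -oppr_ge0 -itN; last exact: Q2_L1M.
    apply: moment_ge0; first exact: Q2Z.
    by left; rewrite itN ?xk ?oppr0//; exact: Q2_L1M.
  by apply: moment_ge0 => //; left; rewrite xk.
have kk : itg (fun x => k x ^+ 2) 0 (1 / 2) = 0.
  rewrite (@eq_itg _ _ _ _ (fun x => M x * k x - 24 * m * (x * k x))); last by move=> x _; rewrite /k; ring.
  by rewrite itgB ?itgZ ?Mk ?xk; [ring| | |apply: L1Z]; exact: Q2_L1M.
have [_ ki] := kQ.
have := itg_eq0_ae ki (aeI_all (fun x _ => sqr_ge0 _)) kk.
apply: aeI_imp => x _ /eqP; rewrite sqrf_eq0 /k => /eqP; lra.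
Qed.

(** Once M = - l x, the function a = p' / (1 + p^2)^(5/2) is continuously
    differentiable. Then a^2 (1 + p^2)^(5/2) + 2 l p is a first integral, and
    a (1 + p^2)^(5/4) decreases from 0 since its derivative is
    - l (1 + p^2)^(5/4). Taking the square root of the first integral gives the
    equation of the extremals. The multiplier is positive, for otherwise p = 0. *)
Lemma solution_extremal : exists s c, [/\ 0 < s, 0 < c, extremal s c p,
  forall x, 0 < x <= 1 / 2 -> p x < s & shoot (psi (1 / 2)) (atan s) = 0].
Proof.
have [l [l0 lh ML]] := multiplier.
pose a x := - (l * x) - B x.
have cB := AC_continuous BA.
have ca : {within `[0, 1 / 2], continuous a}.
  apply: contB => //; apply: contN; apply: contM; first exact: cont_cst.
  by apply: continuous_subspaceT => ?; exact: cvg_id.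
have cG : {within `[0, 1 / 2], continuous (fun x => a x * qroot (p x) ^+ 10)}.
  by apply: contM; [exact: ca|exact: cq].
have gE : aeI 0 (1 / 2) (fun x => g x = a x * qroot (p x) ^+ 10).
  apply: aeI_imp ML => x _ E; rewrite /a -E /M addrK divfK// expf_neq0//; exact: qroot_neq0.
have pG : AC 0 (1 / 2) p (fun x => a x * qroot (p x) ^+ 10).
  exact: AC_ae (continuous_itv_meas cG) gE pg.
have cb' : {within `[0, 1 / 2], continuous (fun x => 5 / 2 * (a x ^+ 2 * (p x * qroot (p x) ^+ 6)))}.
  apply: contM; first exact: cont_cst.
  by apply: contM; [exact: contX|apply: contM; [exact: cp|exact: cq]].
have BA' : AC 0 (1 / 2) B (fun x => 5 / 2 * (a x ^+ 2 * (p x * qroot (p x) ^+ 6))).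
  apply: AC_ae (continuous_itv_meas cb') _ BA; apply: aeI_imp gE => x _ E.
  rewrite /b E; field; exact: qroot_neq0.
have dp x : 0 < x < 1 / 2 -> is_derive x 1 p (a x * qroot (p x) ^+ 10).
  by move=> xh; exact: AC_derive pG xh (within_interior cG xh).
have da x : 0 < x < 1 / 2 ->
    is_derive x 1 a (- l - 5 / 2 * (a x ^+ 2 * (p x * qroot (p x) ^+ 6))).
  move=> xh; have dB := AC_derive BA' xh (within_interior cb' xh).
  apply: der_eq (derB (derN (derM (der_cst l x) (der_id x))) dB) _; ring.
have dqn n x : 0 < x < 1 / 2 -> is_derive x 1 (fun x => qroot (p x) ^+ n.+1) _ :=
  fun xh => derX n (der_comp (is_derive_qroot (p x)) (dp x xh)).
have B0 : B 0 = 0 by exact: itgxx.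
have a0 : a 0 = 0 by rewrite /a B0; ring.
have first_integral x : 0 <= x <= 1 / 2 -> a x ^+ 2 * qroot (p x) ^+ 10 = 2 * l * (p 0 - p x).
  move=> /andP[x0 xh].
  have := @der_cst_linear _ 0 x 0 (fun x => a x ^+ 2 * qroot (p x) ^+ 10 + 2 * l * p x) x0.
  rewrite mul0r a0 expr0n mul0r add0r => H.
  suff : a x ^+ 2 * qroot (p x) ^+ 10 + 2 * l * p x - 2 * l * p 0 = 0 by lra.
  apply: H.
    apply: (@within_sub _ 0 (1 / 2)) => //; apply: contD.
      by apply: contM; [exact: contX|exact: cq].
    by apply: contM; [exact: cont_cst|exact: cp].
  move=> y /andP[y0 yx]; have yh : 0 < y < 1 / 2 by rewrite y0 (lt_le_trans yx xh).
  apply: der_eq (derD (derM (derX 1 (da y yh)) (dqn 9 y yh)) (derM (der_cst (2 * l) y) (dp y yh))) _.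
  field; exact: qroot_neq0.
have [_ _ h0 _] := hpsi; have wh : h <= w (1 / 2) by apply: w_psi; apply/andP; split; lra.
have p0 : p (1 / 2) = 0 by have [] := hw.
have l_gt0 : 0 < l.
  rewrite lt_neqAle l0 andbT; apply/eqP => lE.
  have ax x : 0 <= x <= 1 / 2 -> a x = 0.
    move=> /first_integral; rewrite -lE mulr0 mul0r => /eqP.
    by rewrite mulf_eq0 expf_eq0/= (negbTE (expf_neq0 10 (qroot_neq0 (p x)))) orbF => /eqP.
  have px x : 0 < x < 1 / 2 -> p x = 0.
    move=> /andP[x0 xh]; have [_ H] := pG; have := H x (1 / 2) (ltW x0) (ltW xh) (lexx _).
    rewrite p0 itg0; first by lra.
    move=> t /andP[xt th]; rewrite ax ?mul0r//; apply/andP; split; lra.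
  by move: wh; rewrite (half_height hw) itg0//; rewrite /h; lra.
have wE : w (1 / 2) = h.
  apply/eqP; rewrite eq_le wh andbT leNgt; apply/negP => /lh lE.
  by move: l_gt0; rewrite lE ltxx.
have a_lt0 x : 0 < x <= 1 / 2 -> a x * qroot (p x) ^+ 5 < 0.
  move=> /andP[x0 xh].
  have := @der_gt0_lt _ 0 x (fun x => - (a x * qroot (p x) ^+ 5)) (fun x => l * qroot (p x) ^+ 5) x0.
  rewrite a0 mul0r oppr0 oppr_gt0; apply.
  - apply: (@within_sub _ 0 (1 / 2)) => //; apply: contN.
    by apply: contM; [exact: ca|exact: cq].
  - move=> y /andP[y0 yx]; have yh : 0 < y < 1 / 2 by rewrite y0 (lt_le_trans yx xh).
    apply: der_eq (derN (derM (da y yh) (dqn 4 y yh))) _.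
    field; exact: qroot_neq0.
  - by move=> y _; rewrite mulr_gt0// exprn_gt0// qroot_gt0.
have sqr_a x : (a x * qroot (p x) ^+ 5) ^+ 2 = a x ^+ 2 * qroot (p x) ^+ 10 by ring.
have ps x : 0 < x <= 1 / 2 -> p x < p 0.
  move=> x01; have /andP[x0 xh] := x01.
  have : 0 < (a x * qroot (p x) ^+ 5) ^+ 2 by rewrite exprn_even_gt0/= ?lt_eqF ?a_lt0.
  rewrite sqr_a first_integral ?(ltW x0)// pmulr_rgt0 ?subr_gt0// mulr_gt0//.
have s0 : 0 < p 0 by rewrite -[ltLHS]p0; apply: ps; rewrite h12 lexx.
have aE x : 0 < x < 1 / 2 ->
    a x * qroot (p x) ^+ 10 = - (Num.sqrt (2 * l) * (qroot (p x) ^+ 5 * Num.sqrt (p 0 - p x))).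
  move=> /andP[x0 xh]; have x01 : 0 < x <= 1 / 2 by rewrite x0 ltW.
  have E : a x * qroot (p x) ^+ 5 = - (Num.sqrt (2 * l) * Num.sqrt (p 0 - p x)).
    rewrite -sqrtrM ?mulr_ge0// -first_integral ?ltW// -sqr_a sqrtr_sqr.
    by rewrite ltr0_norm ?opprK// a_lt0.
  by rewrite -[10%N]/(5 + 5)%N exprD mulrA E; ring.
have c0 : 0 < Num.sqrt (2 * l) by rewrite sqrtr_gt0 mulr_gt0.
have Ex : extremal (p 0) (Num.sqrt (2 * l)) p by split=> //; apply: AC_eq_density pG.
exists (p 0), (Num.sqrt (2 * l)); split=> //.
exact: (extremal_height s0 h0 Ex ps hw).1 wE.
Qed.

End solution.

End necessary_conditions.

(** * Existence and uniqueness *)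

Section uniqueness.
Context {R : realType}.
Implicit Types (psi u w : R -> R).

(** Both solutions are extremals whose initial slopes are zeros of the same
    shooting function, and the slope determines the constant. *)
Lemma solution_unique psi u w : SC psi -> solves_P psi u -> solves_P psi w ->
  {in `[0, 1], w =1 u}.
Proof.
move=> hpsi uP wP; have [_ _ h0 _] := hpsi.
have [uM _] := uP; have [p [g [upg uS]]] := Msym_rep uM.
have [wM _] := wP; have [q [k [wqk wS]]] := Msym_rep wM.
have [s [c [s0 c0 E ps S]]] := solution_extremal hpsi uP upg uS.
have [t [d [t0 d0 F qt T]]] := solution_extremal hpsi wP wqk wS.
have ts := shoot_zero_unique h0 t0 s0 T S; subst t.
have [k2 _] := extremal_scale E ps; have [k2' _] := extremal_scale F qt.
have dc : d = c by apply: (mulIf (qroot_neq0 s)); rewrite k2 k2'.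
subst d; apply: (symmetric_ext wS uS); apply: (half_ext (rep_half wqk wS) (rep_half upg uS)).
exact: extremal_unique s0 c0 k2 F E.
Qed.

End uniqueness.

Theorem theorem1p3 (R : realType) (psi : R -> R) (hpsi : SC psi) :
  (psi (1 / 2) < cstar R ->
     exists u : R -> R,
       [/\ solves_P psi u,
           forall w : R -> R, solves_P psi w -> {in `[0, 1], w =1 u},
           minimizes_W psi u &
           forall w : R -> R, minimizes_W psi w -> {in `[0, 1], w =1 u}]) /\
  (cstar R <= psi (1 / 2) -> ~ exists u : R -> R, solves_P psi u).
Proof.
have [_ _ h0 _] := hpsi; split=> [hc|hc [u uP]].
  have [s [c [u [p [g [[hs d0 S0 c0] [[uM upg uS uh] [E ps gE]]]]]]]] := elastica_exists hpsi hc.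
  have uP := elastica_solves_P uM upg uS uh E ps gE.
  have least := elastica_least_energy hpsi hs d0 S0 c0 upg uS uh E ps gE.
  exists u; split; first exact: uP.
  - by move=> w; exact: solution_unique.
  - by split=> [|w /least[]]; first exact: uM.
  - by move=> w [wM H]; have [_] := least w wM; apply; exact: H.
have [uM _] := uP; have [p [g [upg uS]]] := Msym_rep uM.
have [s [c [s0 _ _ _ S]]] := solution_extremal hpsi uP upg uS.
by have := shoot_none h0 hc s0; rewrite S eqxx.
Qed.
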